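(* Let $n \geq 3$ and let $M$ be a compact, connected surface (possibly with boundary) different from the sphere $S^2$ and the real projective plane $\mathbb{R}P^2$. If $H$ is a subgroup of $B_n(M)$ with $P_n(M) \subsetneq H \subset B_n(M)$, then $H$ is not bi-orderable.
   Context: For a surface $M$, $F_n(M)=\{(z_1,\dots,z_n)\in M^n : z_i\neq z_j \text{ for } i\neq j\}$ is the ordered configuration space and $C_n(M)=F_n(M)/S_n$ the unordered configuration space (quotient by permuting coordinates). The pure braid group is $P_n(M)=\pi_1(F_n(M))$ and the braid group is $B_n(M)=\pi_1(C_n(M))$; $P_n(M)$ is the kernel of the permutation homomorphism $B_n(M)\to S_n$ induced by the covering $F_n(M)\to C_n(M)$. A group is bi-orderable if it admits a strict total ordering $<$ such that $x<y$ implies $gx<gy$ and $xg<yg$ for all $x,y,g$. *)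

(* Defs.v *)
From HB Require Import structures.
From mathcomp Require Import all_boot all_order all_algebra.
From mathcomp Require Import all_classical all_reals topology.
From mathcomp Require Import Rstruct Rstruct_topology.
From Stdlib Require Rdefinitions.
Notation R := Rdefinitions.R.

Unset Printing Implicit Defensive.
Import Order.TTheory GRing.Theory Num.Theory.
Local Open Scope classical_set_scope.
Local Open Scope ring_scope.

Definition rel_open {X : topologicalType} (A V : set X) : Prop :=
  exists W : set X, open W /\ W `&` A = V `&` A.

Definition homeo_between {X Y : topologicalType} (A : set X) (B : set Y)
  (f : X -> Y) : Prop :=
  exists g : Y -> X,
    [/\ {within A, continuous f}, {within B, continuous g},
        (forall x, A x -> B (f x)), (forall y, B y -> A (g y))
      & (forall x, A x -> g (f x) = x) /\ (forall y, B y -> f (g y) = y)].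

Definition homeomorphic_to {X Y : topologicalType} (B : set Y) : Prop :=
  exists f : X -> Y, homeo_between [set: X] B f.

Definition R2 := (R * R)%type.
Definition R3 := (R * (R * R))%type.

Definition halfplane : set R2 := [set p | 0 <= p.2].

Definition sphere2 : set R3 :=
  [set p | p.1 ^+ 2 + p.2.1 ^+ 2 + p.2.2 ^+ 2 = 1].

Definition antipode (p : R3) : R3 := (- p.1, (- p.2.1, - p.2.2)).

Definition surface_with_boundary (M : topologicalType) : Prop :=
  hausdorff_space M /\
  forall x : M, exists U : set M, exists V : set R2, exists f : M -> R2,
    [/\ open U, U x, V `<=` halfplane, rel_open halfplane V
      & homeo_between U V f].

Definition homeomorphic_S2 (M : topologicalType) : Prop :=
  homeomorphic_to (X := M) sphere2.

(* M is homeomorphic to RP^2 = S^2 / (x ~ -x): there is a quotient map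
   q : S^2 -> M whose fibres are exactly the antipodal pairs. *)
Definition homeomorphic_RP2 (M : topologicalType) : Prop :=
  exists q : R3 -> M,
    [/\ {within sphere2, continuous q},
        (forall y : M, exists2 x, sphere2 x & q x = y),
        (forall x y, sphere2 x -> sphere2 y ->
           (q x = q y <-> (x = y \/ x = antipode y)))
      & (forall U : set M, open U <-> rel_open sphere2 (q @^-1` U))].

Definition Mpow (n : nat) (M : topologicalType) : topologicalType :=
  prod_topology (fun _ : 'I_n => M).

Definition Fconf (n : nat) (M : topologicalType) : set (Mpow n M) :=
  [set z | injective (z : 'I_n -> M)].

(* The quotient map F_n(M) -> C_n(M) = F_n(M)/S_n.  Two configurations
   have the same image iff they differ by a permutation of coordinates,
   so a point of C_n(M) is represented by the n-element subset
   {z_1, ..., z_n} of M. *)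
Definition qconf (n : nat) (M : topologicalType) (z : Mpow n M) : set M :=
  range (z : 'I_n -> M).
Arguments qconf {n M}.

Definition Cconf (n : nat) (M : topologicalType) : set (set M) :=
  [set qconf z | z in Fconf n M].

Definition Cconf_open (n : nat) (M : topologicalType) (U : set (set M))
  : Prop :=
  rel_open (Fconf n M) (qconf @^-1` U).

Definition Cconf_cont (n : nat) (M : topologicalType) {X : topologicalType}
  (A : set X) (h : X -> set M) : Prop :=
  (forall t, A t -> Cconf n M (h t)) /\
  forall U : set (set M), Cconf_open n M U -> rel_open A (h @^-1` U).

Definition unit_interval : set R := `[0, 1]%classic.
Definition unit_square : set R2 :=
  [set p | unit_interval p.1 /\ unit_interval p.2].

Definition Cloop (n : nat) (M : topologicalType) (c : set M)
  (g : R -> set M) : Prop :=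
  [/\ Cconf_cont n M unit_interval g, g 0 = c & g 1 = c].

Definition Chomotopic (n : nat) (M : topologicalType) (c : set M)
  (g1 g2 : R -> set M) : Prop :=
  exists K : R2 -> set M,
    [/\ Cconf_cont n M unit_square K,
        (forall s, unit_interval s -> K (s, 0) = g1 s /\ K (s, 1) = g2 s)
      & (forall t, unit_interval t -> K (0, t) = c /\ K (1, t) = c)].

Definition Cconcat {T : Type} (g1 g2 : R -> T) : R -> T :=
  fun t => if t <= 2^-1 then g1 (2 * t) else g2 (2 * t - 1).
Definition Creverse {T : Type} (g : R -> T) : R -> T := fun t => g (1 - t).
Definition Cconst {T : Type} (c : T) : R -> T := fun _ => c.

(* Elements of B_n(M) = pi_1(C_n(M), c) are homotopy classes of loops
   Cloop n M c; a subgroup of B_n(M) is represented by the set of loops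
   whose classes belong to it. *)
Definition braid_subgroup (n : nat) (M : topologicalType) (c : set M)
  (H : set (R -> set M)) : Prop :=
  [/\ (forall g, H g -> Cloop n M c g),
      (forall g g', H g -> Cloop n M c g' -> Chomotopic n M c g g' -> H g'),
      H (Cconst c),
      (forall g1 g2, H g1 -> H g2 -> H (Cconcat g1 g2))
    & (forall g, H g -> H (Creverse g))].

(* The pure braid group P_n(M) = pi_1(F_n(M), z0), viewed inside
   B_n(M) = pi_1(C_n(M), qconf z0) via the covering map qconf (this is the
   kernel of the permutation homomorphism B_n(M) -> S_n): the classes of
   loops homotopic to the image of a loop of F_n(M) based at z0. *)
Definition pure_braids (n : nat) (M : topologicalType) (z0 : Mpow n M)
  : set (R -> set M) :=
  [set g | Cloop n M (qconf z0) g /\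
     exists b : R -> Mpow n M,
       [/\ {within unit_interval, continuous b},
           (forall t, unit_interval t -> Fconf n M (b t)),
           b 0 = z0, b 1 = z0
         & Chomotopic n M (qconf z0) g (qconf \o b)]].

Definition biorderable_subgroup (n : nat) (M : topologicalType) (c : set M)
  (H : set (R -> set M)) : Prop :=
  exists lt : (R -> set M) -> (R -> set M) -> Prop,
    let eqv := Chomotopic n M c in
    [/\ (forall x x' y y', H x -> H x' -> H y -> H y' ->
           eqv x x' -> eqv y y' -> lt x y -> lt x' y'),
        (forall x, H x -> ~ lt x x),
        (forall x y z, H x -> H y -> H z -> lt x y -> lt y z -> lt x z),
        (forall x y, H x -> H y -> [\/ lt x y, eqv x y | lt y x])
      & (forall x y g, H x -> H y -> H g -> lt x y ->
           lt (Cconcat g x) (Cconcat g y) /\ lt (Cconcat x g) (Cconcat y g))].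

Arguments pure_braids {n M}.

(* Main.v *)
Require Import Defs.
From mathcomp Require Import all_boot all_order all_algebra all_fingroup cyclic.
From mathcomp Require Import all_classical all_reals topology.
From mathcomp Require Import normedtype trigo derive realfun.
From mathcomp Require Import Rstruct Rstruct_topology.
From mathcomp Require Import lra ring.
Set Implicit Arguments.
Unset Strict Implicit.
Unset Printing Implicit Defensive.
Import Order.TTheory GRing.Theory Num.Theory.
Import numFieldNormedType.Exports.
Local Open Scope classical_set_scope.
Local Open Scope ring_scope.

(** A bi-ordered group has unique roots: [x ^ k = y ^ k] forces [x = y]. So it
is enough to find, for a permutation [t != 1] realised in [H], two braids with
permutations in the cyclic group of [t] that are distinct but have a common
power; [t] may be assumed to have prime order [p].

If [p] is odd, place the moved labels in the plane so that [t], resp. [t^-1],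
is the rotation by [1 / p] of a turn. Up to conjugation both rotations are [p]-th
roots of the full rotation, so [t = t^-1], which is absurd.

If [p = 2], the half rotation [x] of a symmetric planar configuration and its
conjugates by planar pure braids [g] have the same square, so that [g] is
homotopic to its rotated and relabelled copy. For a twist [tw z k a] (label [k]
runs once around label [a]) this gives, except for four labels without fixed
point, the equality of two twists of one label around two different ones.
Doubling the label [i1] in a homotopy witnessing this equality, over a local
system on the square, shows that a strand running around two close labels is
trivial; in the plane this says that the product of the two twists is trivial,
so twists have trivial square and are trivial. The product of half twists with
permutation [t] then has trivial square, hence is trivial: a contradiction. With
four labels the same conclusion holds for the product of one half twist and the
inverse of the other. *)

(** * Homotopies and path classes *)

(** A braid over a permutation [s] is handled as a path of ordered configurations from [z] to
    [act s z]. The group law becomes that of the fundamental groupoid twisted by the symmetric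
    group, and an equality of braids forces one of end points, hence of permutations. No
    presentation of a surface braid group is used: apart from doubling, relations are explicit
    homotopies of planar configurations, pushed into [M] by an embedding of the plane. These alone
    do not show that a twist is trivial in [M]; doubling does. Its obstacle is that a topological
    surface offers no canonical second point beside a moving one, and two choices may differ by
    rotations of the second point about the first. Hence all choices are kept at once, up to
    homotopy, in a local system, and the unknown rotation is killed by watching two configurations
    that carry the same pair of close points. Four labels without fixed point are special because
    two twists of one label are compared through a twist disjoint from both, which takes five
    labels. *)

Section ContinuousExpressions.
Context {T : topologicalType}.
Implicit Types (f g : T -> R).

Lemma cont_comp (X Y : topologicalType) (g : X -> Y) (f : T -> X) :
  continuous g -> continuous f -> continuous (fun t => g (f t)).
Proof. by move=> cg cf x; apply: continuous_comp; [exact: cf | exact: cg]. Qed.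

Lemma cont_pair (X Y : topologicalType) (f : T -> X) (g : T -> Y) :
  continuous f -> continuous g -> continuous (fun t => (f t, g t)).
Proof. by move=> cf cg x; apply: cvg_pair; [exact: cf | exact: cg]. Qed.

Lemma cont_fst (X Y : topologicalType) (f : T -> X * Y) :
  continuous f -> continuous (fun t => (f t).1).
Proof. by move=> cf x; apply: (@continuous_comp _ _ _ f fst x (cf x)); exact: cvg_fst. Qed.

Lemma cont_snd (X Y : topologicalType) (f : T -> X * Y) :
  continuous f -> continuous (fun t => (f t).2).
Proof. by move=> cf x; apply: (@continuous_comp _ _ _ f snd x (cf x)); exact: cvg_snd. Qed.

Lemma cont_id : continuous (fun t : T => t).
Proof. by move=> x. Qed.

Lemma cont_cst (X : topologicalType) (a : X) : continuous (fun _ : T => a).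
Proof. by move=> x; exact: cvg_cst. Qed.

Lemma cont_add f g : continuous f -> continuous g ->
  continuous (fun t => f t + g t).
Proof. by move=> cf cg x; exact: (@continuousD R R^o T f g x (cf x) (cg x)). Qed.

Lemma cont_opp f : continuous f -> continuous (fun t => - f t).
Proof. by move=> cf x; exact: (@continuousN R R^o T f x (cf x)). Qed.

Lemma cont_mul f g : continuous f -> continuous g ->
  continuous (fun t => f t * g t).
Proof. by move=> cf cg x; apply: cvgM; [exact: cf | exact: cg]. Qed.

Lemma cont_cos f : continuous f -> continuous (fun t => cos (f t)).
Proof. by move=> cf; apply: cont_comp => //; exact: continuous_cos. Qed.

Lemma cont_sin f : continuous f -> continuous (fun t => sin (f t)).
Proof. by move=> cf; apply: cont_comp => //; exact: continuous_sin. Qed.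

Lemma cont_norm f : continuous f -> continuous (fun t => `|f t|).
Proof. by move=> cf; apply: cont_comp => // x; exact: (@norm_continuous R R^o x). Qed.

Lemma cont_inv f : (forall t, f t != 0) -> continuous f ->
  continuous (fun t => (f t)^-1).
Proof. by move=> f0 cf x; apply: cvgV; [exact: f0 | exact: cf]. Qed.

Lemma cont_min f g : continuous f -> continuous g ->
  continuous (fun t => Num.min (f t) (g t)).
Proof.
move=> cf cg.
have -> : (fun t => Num.min (f t) (g t)) =
    (fun t => 2^-1 * (f t + g t + - `|f t + - g t|)).
  apply/funext => t.
  by case: (leP (f t) (g t)) => h; [rewrite ler0_norm | rewrite gtr0_norm]; lra.
by apply: cont_mul; [exact: cont_cst|]; apply: cont_add; [exact: cont_add|];
  apply: cont_opp; apply: cont_norm; apply: cont_add => //; exact: cont_opp.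
Qed.

Lemma cont_max f g : continuous f -> continuous g ->
  continuous (fun t => Num.max (f t) (g t)).
Proof.
move=> cf cg.
have -> : (fun t => Num.max (f t) (g t)) =
    (fun t => 2^-1 * (f t + g t + `|f t + - g t|)).
  apply/funext => t.
  by case: (leP (f t) (g t)) => h; [rewrite ler0_norm | rewrite gtr0_norm]; lra.
by apply: cont_mul; [exact: cont_cst|]; apply: cont_add; [exact: cont_add|];
  apply: cont_norm; apply: cont_add => //; exact: cont_opp.
Qed.

Lemma cont_proj n (M : topologicalType) (f : T -> Mpow n M) i :
  continuous f -> continuous (fun t => f t i).
Proof.
move=> cf; apply: (@cont_comp _ _ (fun z : Mpow n M => z i)) => //.
exact: (@proj_continuous _ (fun _ : 'I_n => M) i).
Qed.

Lemma cont_Mpow n (M : topologicalType) (f : T -> Mpow n M) :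
  (forall i, continuous (fun t => f t i)) -> continuous f.
Proof.
move=> cf t; apply/cvg_sup => i; apply/cvg_image; last first.
  move=> U /cf; rewrite /= => nU.
  exists ((fun z : Mpow n M => z i) @^-1` U) => //=.
  by rewrite image_preimage // predeqE => y; split=> // _; exists (fun=> y).
by rewrite predeqE => y; split=> // _; exists (fun=> y).
Qed.

End ContinuousExpressions.

(** Pasting: near a point with [c t] different from [r] only one branch is visible, and where
    [c t = r] both branches have the same value, so a neighbourhood good for both serves. *)
Lemma cont_if (T X : topologicalType) (f g : T -> X) (c : T -> R) (r : R) :
  continuous f -> continuous g -> continuous c ->
  (forall t, c t = r -> f t = g t) ->
  continuous (fun t => if c t <= r then f t else g t).
Proof.
move=> cf cg cc efg t U nU.
change (nbhs t [set x | U (if c x <= r then f x else g x)]).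
case: (ltgtP (c t) r) nU => htr nU.
- have nt : nbhs t [set x | c x < r] := cc t _ (lt_nbhsl htr).
  have h1 : nbhs t (f @^-1` U) := cf t _ nU.
  by apply: filterS2 nt h1 => x /= /ltW ->.
- have nt : nbhs t [set x | r < c x] := cc t _ (lt_nbhsr htr).
  have h1 : nbhs t (g @^-1` U) := cg t _ nU.
  by apply: filterS2 nt h1 => x /=; rewrite leNgt => ->.
- have nU' : nbhs (g t) U by rewrite -efg.
  have h1 : nbhs t (f @^-1` U) := cf t _ nU.
  have h2 : nbhs t (g @^-1` U) := cg t _ nU'.
  by apply: filterS2 h1 h2 => x /=; case: ifP.
Qed.

Lemma continuous_fst (X Y : topologicalType) : continuous (@fst X Y).
Proof. by move=> x; exact: cvg_fst. Qed.

Lemma continuous_snd (X Y : topologicalType) : continuous (@snd X Y).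
Proof. by move=> x; exact: cvg_snd. Qed.

Ltac cont1 :=
  match goal with
  | |- continuous (fun x => x) => exact: cont_id
  | |- continuous id => exact: cont_id
  | |- continuous (fun _ => ?c) => exact: cont_cst
  | h : continuous ?g |- continuous ?g => exact: h
  | h : continuous ?g |- continuous (fun t => ?g t) => exact: h
  | |- continuous (fun x => (@?f x, @?g x)) => apply: (@cont_pair _ _ _ f g)
  | |- continuous (fun x => fst (@?f x)) => apply: (@cont_fst _ _ _ f)
  | |- continuous (fun x => snd (@?f x)) => apply: (@cont_snd _ _ _ f)
  | |- continuous (fun x => @GRing.add _ (@?f x) (@?g x)) =>
      apply: (@cont_add _ f g)
  | |- continuous (fun x => @GRing.mul _ (@?f x) (@?g x)) =>
      apply: (@cont_mul _ f g)
  | |- continuous (fun x => @GRing.opp _ (@?f x)) => apply: (@cont_opp _ f)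
  | |- continuous (fun x => @cos _ (@?f x)) => apply: (@cont_cos _ f)
  | |- continuous (fun x => @sin _ (@?f x)) => apply: (@cont_sin _ f)
  | |- continuous (fun x => @Num.norm _ _ (@?f x)) => apply: (@cont_norm _ f)
  | |- continuous (fun x => @Order.min _ _ (@?f x) (@?g x)) =>
      apply: (@cont_min _ f g)
  | |- continuous (fun x => @Order.max _ _ (@?f x) (@?g x)) =>
      apply: (@cont_max _ f g)
  | h : continuous ?g |- continuous (fun t => ?g (@?f t)) =>
      apply: (@cont_comp _ _ _ g f h)
  | |- continuous _ => exact: continuous_fst
  | |- continuous _ => exact: continuous_snd
  end.
Ltac cont := repeat cont1.

(** Paths are defined on all of [R], and homotopies on all of [R2], so that plain continuity
    suffices and no subspace topology intervenes. Outside the unit interval the values are arbitrary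
    points of [A]; [hpt_eq] shows that they do not matter. *)
Definition pth (X : topologicalType) (A : set X) (x y : X) (a : R -> X) :=
  [/\ continuous a, forall t, A (a t), a 0 = x & a 1 = y].

Definition hpt (X : topologicalType) (A : set X) (a b : R -> X) :=
  exists h : R2 -> X,
    [/\ continuous h, forall p, A (h p), forall s, h (s, 0) = a s,
        forall s, h (s, 1) = b s & forall t, h (0, t) = a 0 /\ h (1, t) = a 1].

Section Homotopy.
Context {X : topologicalType} (A : set X).
Implicit Types a b c : R -> X.

Lemma hpt_ends a b : hpt A a b -> b 0 = a 0 /\ b 1 = a 1.
Proof.
case=> h [ch Ah h0 h1 he]; rewrite -!h1.
by have [-> _] := he 1; have [_ ->] := he 1.
Qed.

Lemma hpt_pthr a b : hpt A a b -> pth A (a 0) (a 1) b.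
Proof.
move=> hab; have [e0 e1] := hpt_ends hab.
case: hab => h [ch Ah h0 h1 he]; split=> //; last by move=> t; rewrite -h1.
have -> : b = (fun s => h (s, 1)) by apply/funext => s; rewrite h1.
by cont.
Qed.

Lemma hpt_refl x y a : pth A x y a -> hpt A a a.
Proof.
by case=> ca Aa _ _; exists (fun p => a p.1); split=> //; cont.
Qed.

Lemma hpt_sym a b : hpt A a b -> hpt A b a.
Proof.
move=> hab; have [e0 e1] := hpt_ends hab.
case: hab => h [ch Ah h0 h1 he].
exists (fun p => h (p.1, 1 + - p.2)); split=> // [|s|s|t] /=; first by cont.
- by rewrite subr0.
- by rewrite subrr.
- by rewrite e0 e1.
Qed.

Lemma hpt_trans b a c : hpt A a b -> hpt A b c -> hpt A a c.
Proof.
move=> hab; have [e0 e1] := hpt_ends hab.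
case: hab => h [ch Ah h0 h1 he] [k [ck Ak k0 k1 ke]].
exists (fun p => if p.2 <= 2^-1 then h (p.1, 2 * p.2) else k (p.1, 2 * p.2 - 1)).
split=> [|p|s|s|t] /=.
- apply: cont_if; [cont | cont | cont | move=> t ->].
  have -> : (2 : R) * 2^-1 = 1 by lra.
  by rewrite subrr h1 k0.
- by case: ifP.
- by rewrite invr_ge0 ler0n mulr0.
- have -> : (1 <= 2^-1 :> R) = false by apply/negbTE; lra.
  by rewrite -k1; congr k; congr pair; lra.
- by case: ifP => _; [exact: he | rewrite -e0 -e1; exact: ke].
Qed.

(** The plane of parameters is convex, so two paths in it with common ends are joined by the
    straight-line homotopy, which [H] carries into [A]. Reparametrisations and the boundary of a
    square are instances. *)
Lemma hpt_line (H : R2 -> X) (p q : R -> R2) : continuous H ->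
  (forall u, A (H u)) -> continuous p -> continuous q ->
  p 0 = q 0 -> p 1 = q 1 -> hpt A (H \o p) (H \o q).
Proof.
move=> cH AH cp cq e0 e1.
exists (fun u => H ((1 - u.2) * (p u.1).1 + u.2 * (q u.1).1,
                    (1 - u.2) * (p u.1).2 + u.2 * (q u.1).2)).
split=> // [|s|s|t] /=; first by cont.
- by rewrite subr0 !mul1r !mul0r !addr0 -surjective_pairing.
- by rewrite subrr !mul1r !mul0r !add0r -surjective_pairing.
- rewrite e0 e1; split; congr H; rewrite [RHS]surjective_pairing;
    congr pair; lra.
Qed.

Lemma hpt_repar a (p q : R -> R) : continuous a -> (forall t, A (a t)) ->
  continuous p -> continuous q ->
  p 0 = q 0 -> p 1 = q 1 -> hpt A (a \o p) (a \o q).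
Proof.
move=> ca Aa cp cq e0 e1.
have := @hpt_line (fun u => a u.1) (fun t => (p t, 0)) (fun t => (q t, 0)).
by rewrite /comp /=; apply=> //; [cont | cont | cont | rewrite e0 | rewrite e1].
Qed.

(** Both paths are homotopic to their composites with the retraction [cl] of the line onto the unit
    interval, and these composites coincide. *)
Lemma hpt_eq x y a b : pth A x y a -> pth A x y b ->
  (forall t, 0 <= t <= 1 -> a t = b t) -> hpt A a b.
Proof.
move=> [ca Aa _ _] [cb Ab _ _] ab.
pose cl := fun t : R => Num.max 0 (Num.min 1 t).
have ccl : continuous cl by rewrite /cl; cont.
have cl0 : cl 0 = 0 by rewrite /cl minEle ler10 maxEle lexx.
have cl1 : cl 1 = 1 by rewrite /cl minEle lexx maxEle ler01.
have eab : a \o cl = b \o cl.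
  apply/funext => t /=; apply: ab; rewrite /cl le_max lexx /=.
  by rewrite ge_max ler01 ge_min lexx.
apply: (@hpt_trans (a \o cl)).
  by apply: (@hpt_repar a id) => //; cont.
rewrite eab; apply: hpt_sym.
by apply: (@hpt_repar b id) => //; cont.
Qed.

Lemma pth_cat x y z a b : pth A x y a -> pth A y z b ->
  pth A x z (Cconcat a b).
Proof.
move=> [ca Aa a0 a1] [cb Ab b0 b1]; rewrite /Cconcat; split.
- apply: cont_if; [by cont | by cont | by cont | move=> t ->].
  have -> : (2 : R) * 2^-1 = 1 by lra.
  by rewrite subrr a1 b0.
- by move=> t; case: ifP.
- by rewrite invr_ge0 ler0n mulr0.
- have -> : (1 <= 2^-1 :> R) = false by apply/negbTE; lra.
  by rewrite -b1; congr b; lra.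
Qed.

Lemma pth_rev x y a : pth A x y a -> pth A y x (Creverse a).
Proof.
move=> [ca Aa a0 a1]; rewrite /Creverse; split=> //; first by cont.
- by rewrite subr0.
- by rewrite subrr.
Qed.

Lemma pth_cst x : A x -> pth A x x (Cconst x).
Proof. by move=> Ax; rewrite /Cconst; split=> //; cont. Qed.

Lemma hpt_cat a a' b b' : a 1 = b 0 -> hpt A a a' -> hpt A b b' ->
  hpt A (Cconcat a b) (Cconcat a' b').
Proof.
move=> eab [h [ch Ah h0 h1 he]] [k [ck Ak k0 k1 ke]].
exists (fun p => if p.1 <= 2^-1 then h (2 * p.1, p.2) else k (2 * p.1 - 1, p.2)).
split=> [|p|s|s|t] /=.
- apply: cont_if; [by cont | by cont | by cont | move=> t ->].
  have -> : (2 : R) * 2^-1 = 1 by lra.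
  by rewrite subrr; have [_ ->] := he t.2; have [-> _] := ke t.2.
- by case: ifP.
- by rewrite /Cconcat; case: ifP.
- by rewrite /Cconcat; case: ifP.
- rewrite /Cconcat invr_ge0 ler0n mulr0.
  have -> : (1 <= 2^-1 :> R) = false by apply/negbTE; lra.
  have -> : (2 : R) * 1 - 1 = 1 by lra.
  by have [-> _] := he t; have [_ ->] := ke t.
Qed.

Lemma hpt_rev a b : hpt A a b -> hpt A (Creverse a) (Creverse b).
Proof.
move=> [h [ch Ah h0 h1 he]].
exists (fun p => h (1 - p.1, p.2)); rewrite /Creverse.
split=> // [|t] /=; first by cont.
by rewrite subr0 subrr; have [-> ->] := he t.
Qed.

Lemma hpt_catA x y z w a b c : pth A x y a -> pth A y z b -> pth A z w c ->
  hpt A (Cconcat (Cconcat a b) c) (Cconcat a (Cconcat b c)).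
Proof.
move=> pa pb pc; have pbc := pth_cat pa (pth_cat pb pc).
have [cg Ag g0 g1] := pbc.
(* The reparametrisation has slopes 2, 1, 1/2, with breaks at 1/4 and 1/2; being concave, it is the
   minimum of its three affine pieces. *)
pose p (t : R) := Num.min (2 * t) (Num.min (t + 4^-1) (2^-1 * t + 2^-1)).
have -> : Cconcat (Cconcat a b) c = Cconcat a (Cconcat b c) \o p.
  apply/funext => t /=; rewrite /p /Cconcat !minEle.
  case: (leP (t + 4^-1) (2^-1 * t + 2^-1)) => h1; last first.
    have -> : (2 * t <= 2^-1 * t + 2^-1) = false by apply/negbTE; lra.
    have -> : (t <= 2^-1) = false by apply/negbTE; lra.
    have -> : (2^-1 * t + 2^-1 <= 2^-1) = false by apply/negbTE; lra.
    have -> : (2 * (2^-1 * t + 2^-1) - 1 <= 2^-1) = false by apply/negbTE; lra.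
    by congr c; lra.
  case: (leP (2 * t) (t + 4^-1)) => h2.
    have -> : (t <= 2^-1) = true by apply/idP; lra.
    by have -> : (2 * t <= 2^-1) = true by apply/idP; lra.
  have -> : (t <= 2^-1) = true by apply/idP; lra.
  have -> : (2 * t <= 2^-1) = false by apply/negbTE; lra.
  have -> : (t + 4^-1 <= 2^-1) = false by apply/negbTE; lra.
  have -> : (2 * (t + 4^-1) - 1 <= 2^-1) = true by apply/idP; lra.
  by congr b; lra.
apply: (@hpt_repar _ p id) => //; [by rewrite /p; cont | by cont | |].
- by rewrite /p !minEle; case: ifP; case: ifP; lra.
- by rewrite /p !minEle; case: ifP; case: ifP; lra.
Qed.

Lemma hpt_cat1 x y a : pth A x y a -> hpt A (Cconcat a (Cconst y)) a.
Proof.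
move=> [ca Aa a0 a1].
have -> : Cconcat a (Cconst y) = a \o (fun t => Num.min (2 * t) 1).
  apply/funext => t /=; rewrite /Cconcat /Cconst minEle.
  by case: (leP t 2^-1) => h; [rewrite ifT //; lra | rewrite ifF ?a1 //; apply/negbTE; lra].
apply: (@hpt_repar a _ id) => //; [by cont | by cont | |].
- by rewrite minEle; case: ifP; lra.
- by rewrite minEle; case: ifP; lra.
Qed.

Lemma hpt_1cat x y a : pth A x y a -> hpt A (Cconcat (Cconst x) a) a.
Proof.
move=> [ca Aa a0 a1].
have -> : Cconcat (Cconst x) a = a \o (fun t => Num.max (2 * t - 1) 0).
  apply/funext => t /=; rewrite /Cconcat /Cconst maxEle.
  by case: (leP t 2^-1) => h; [rewrite ifT ?a0 //; lra | rewrite ifF //; apply/negbTE; lra].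
apply: (@hpt_repar a _ id) => //; [by cont | by cont | |].
- by rewrite maxEle; case: ifP; lra.
- by rewrite maxEle; case: ifP; lra.
Qed.

Lemma hpt_catV x y a : pth A x y a -> hpt A (Cconcat a (Creverse a)) (Cconst x).
Proof.
move=> [ca Aa a0 a1].
have -> : Cconcat a (Creverse a) = a \o (fun t => Num.min (2 * t) (2 - 2 * t)).
  apply/funext => t /=; rewrite /Cconcat /Creverse minEle.
  by case: (leP t 2^-1) => h; [rewrite ifT //; lra | rewrite ifF; [congr a; lra | apply/negbTE; lra]].
have -> : Cconst x = a \o (fun=> 0) by apply/funext => t /=; rewrite a0.
apply: hpt_repar => //; [by cont | by cont | |].
- by rewrite minEle; case: ifP; lra.
- by rewrite minEle; case: ifP; lra.
Qed.

Lemma hpt_Vcat x y a : pth A x y a -> hpt A (Cconcat (Creverse a) a) (Cconst y).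
Proof.
move=> /pth_rev/hpt_catV.
rewrite (_ : Creverse (Creverse a) = a) //.
by apply/funext => t; rewrite /Creverse; congr a; lra.
Qed.

End Homotopy.

Section Classes.
Context {X : topologicalType} (A : set X).
Implicit Types (a b c : R -> X) (p q r : set (R -> X)).

(** A class is the set of its representatives, so that homotopy turns into equality and can be
    rewritten with. The operations on classes are total functions on sets of paths; [arr] records
    the ends that the groupoid laws refer to. *)
Definition cls a : set (R -> X) := [set b | hpt A a b].

Definition cmul p q : set (R -> X) :=
  [set c | exists a b x y z, [/\ p a, q b, pth A x y a, pth A y z b
                              & hpt A (Cconcat a b) c]].

Definition cinv p : set (R -> X) :=
  [set c | exists a x y, [/\ p a, pth A x y a & hpt A (Creverse a) c]].

Definition arr x y p := exists2 a, pth A x y a & p = cls a.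

Lemma cls_eq a b : hpt A a b -> cls a = cls b.
Proof.
move=> hab; rewrite predeqE => c; split=> h.
- exact: hpt_trans (hpt_sym hab) h.
- exact: hpt_trans hab h.
Qed.

Lemma clsP x y a b : pth A x y b -> cls a = cls b -> hpt A a b.
Proof. by move=> /hpt_refl hb; rewrite predeqE => /(_ b) [_]; exact. Qed.

Lemma arr_cls x y a : pth A x y a -> arr x y (cls a).
Proof. by move=> pa; exists a. Qed.

Lemma pth_hpt x y a b : pth A x y a -> hpt A a b -> pth A x y b.
Proof. by move=> [_ _ <- <-] /hpt_pthr. Qed.

Lemma cmul_cls x y z a b : pth A x y a -> pth A y z b ->
  cmul (cls a) (cls b) = cls (Cconcat a b).
Proof.
move=> pa pb; rewrite predeqE => c; split.
- move=> [a' [b' [x' [y' [z' [ha hb _ _ h]]]]]].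
  apply: hpt_trans h; apply: hpt_cat => //.
  by case: pa => _ _ _ ->; case: pb => _ _ ->.
- move=> h; exists a, b, x, y, z; split=> //.
  + exact: hpt_refl pa.
  + exact: hpt_refl pb.
Qed.

Lemma cinv_cls x y a : pth A x y a -> cinv (cls a) = cls (Creverse a).
Proof.
move=> pa; rewrite predeqE => c; split.
- by move=> [a' [x' [y' [ha _ h]]]]; apply: hpt_trans h; apply: hpt_rev.
- by move=> h; exists a, x, y; split=> //; exact: hpt_refl pa.
Qed.

Lemma arr_mul y x z p q : arr x y p -> arr y z q -> arr x z (cmul p q).
Proof.
move=> [a pa ->] [b pb ->]; exists (Cconcat a b); first exact: pth_cat pa pb.
exact: cmul_cls pa pb.
Qed.

Lemma arr_inv x y p : arr x y p -> arr y x (cinv p).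
Proof.
move=> [a pa ->]; exists (Creverse a); first exact: pth_rev.
exact: cinv_cls pa.
Qed.

Lemma arr1 x : A x -> arr x x (cls (Cconst x)).
Proof. by move=> Ax; exists (Cconst x) => //; exact: pth_cst. Qed.

(** No ends are prescribed: [cmul] collects composable representatives only, and homotopies preserve
    ends, so the end points found on one side match those wanted on the other. *)
Lemma cmulA p q r : cmul p (cmul q r) = cmul (cmul p q) r.
Proof.
rewrite predeqE => d; split.
- move=> [a [e [x [y [w [pa qre ax pe he]]]]]].
  move: qre => [b [c [y' [z [w' [qb rc bx cx hbc]]]]]].
  have [? ?] : y' = y /\ w' = w.
    have [_ _ e0 e1] := pth_hpt (pth_cat bx cx) hbc.
    by case: pe => _ _ <- <-.
  subst y' w'; exists (Cconcat a b), c, x, z, w; split=> //.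
  + by exists a, b, x, y, z; split=> //; exact: hpt_refl (pth_cat ax bx).
  + exact: pth_cat ax bx.
  + apply: hpt_trans (hpt_catA ax bx cx) _.
    apply: hpt_trans _ he; apply: hpt_cat => //; last exact: hpt_refl ax.
    by case: (pth_cat bx cx) => _ _ -> _; case: ax => _ _ _ ->.
- move=> [e [c [x [z [w [pqe rc pe cx he]]]]]].
  move: pqe => [a [b [x' [y [z' [pa qb ax bx hab]]]]]].
  have [? ?] : x' = x /\ z' = z.
    have [_ _ e0 e1] := pth_hpt (pth_cat ax bx) hab.
    by case: pe => _ _ <- <-.
  subst x' z'; exists a, (Cconcat b c), x, y, w; split=> //.
  + by exists b, c, y, z, w; split=> //; exact: hpt_refl (pth_cat bx cx).
  + exact: pth_cat bx cx.
  + apply: hpt_trans (hpt_sym (hpt_catA ax bx cx)) _.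
    apply: hpt_trans _ he; apply: hpt_cat => //; last exact: hpt_refl cx.
    by case: (pth_cat ax bx) => _ _ _ ->; case: cx => _ _ ->.
Qed.

Lemma arr_ends x y p : arr x y p -> A x /\ A y.
Proof. by case=> a [_ Aa <- <-] _; split; exact: Aa. Qed.

Lemma cmulr1 x y p : arr x y p -> cmul p (cls (Cconst y)) = p.
Proof.
move=> ap; have [_ Ay] := arr_ends ap; case: ap => a pa ->.
rewrite (cmul_cls pa (pth_cst Ay)); apply: cls_eq; exact: hpt_cat1 pa.
Qed.

Lemma cmul1r x y p : arr x y p -> cmul (cls (Cconst x)) p = p.
Proof.
move=> ap; have [Ax _] := arr_ends ap; case: ap => a pa ->.
rewrite (cmul_cls (pth_cst Ax) pa); apply: cls_eq; exact: hpt_1cat pa.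
Qed.

Lemma cmulrV x y p : arr x y p -> cmul p (cinv p) = cls (Cconst x).
Proof.
move=> [a pa ->]; rewrite (cinv_cls pa) (cmul_cls pa (pth_rev pa)).
by apply: cls_eq; exact: hpt_catV pa.
Qed.

Lemma cmulVr x y p : arr x y p -> cmul (cinv p) p = cls (Cconst y).
Proof.
move=> [a pa ->]; rewrite (cinv_cls pa) (cmul_cls (pth_rev pa) pa).
by apply: cls_eq; exact: hpt_Vcat pa.
Qed.

Lemma cmulKr x y z p q : arr x y p -> arr y z q -> cmul (cinv p) (cmul p q) = q.
Proof. by move=> ap aq; rewrite cmulA (cmulVr ap) (cmul1r aq). Qed.

Lemma cmulVKr x y z p q : arr y x p -> arr y z q ->
  cmul p (cmul (cinv p) q) = q.
Proof. by move=> ap aq; rewrite cmulA (cmulrV ap) (cmul1r aq). Qed.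

Lemma cmulrK x y z p q : arr x y p -> arr y z q -> cmul (cmul p q) (cinv q) = p.
Proof. by move=> ap aq; rewrite -cmulA (cmulrV aq) (cmulr1 ap). Qed.

Lemma cmulrVK x y z p q : arr x y p -> arr z y q ->
  cmul (cmul p (cinv q)) q = p.
Proof. by move=> ap aq; rewrite -cmulA (cmulVr aq) (cmulr1 ap). Qed.

(** The two halves of the boundary of the square are paths in the plane with the same ends. Many
    relations between braids below are read off from a suitable [H]. *)
Lemma cls_square (H : R2 -> X) : continuous H -> (forall u, A (H u)) ->
  cmul (cls (fun s => H (s, 0))) (cls (fun t => H (1, t))) =
  cmul (cls (fun t => H (0, t))) (cls (fun s => H (s, 1))).
Proof.
move=> cH AH.
have p1 : pth A (H (0, 0)) (H (1, 0)) (fun s => H (s, 0)) by split=> //; cont.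
have p2 : pth A (H (1, 0)) (H (1, 1)) (fun t => H (1, t)) by split=> //; cont.
have p3 : pth A (H (0, 0)) (H (0, 1)) (fun t => H (0, t)) by split=> //; cont.
have p4 : pth A (H (0, 1)) (H (1, 1)) (fun s => H (s, 1)) by split=> //; cont.
rewrite (cmul_cls p1 p2) (cmul_cls p3 p4); apply: cls_eq.
pose u (t : R) : R2 := if t <= 2^-1 then (2 * t, 0) else (1, 2 * t - 1).
pose v (t : R) : R2 := if t <= 2^-1 then (0, 2 * t) else (2 * t - 1, 1).
have -> : Cconcat (fun s => H (s, 0)) (fun t => H (1, t)) = H \o u.
  by apply/funext => t; rewrite /Cconcat /u /=; case: ifP.
have -> : Cconcat (fun t => H (0, t)) (fun s => H (s, 1)) = H \o v.
  by apply/funext => t; rewrite /Cconcat /v /=; case: ifP.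
apply: hpt_line => //.
- by apply: cont_if; [cont | cont | cont | move=> t ->; congr pair; lra].
- by apply: cont_if; [cont | cont | cont | move=> t ->; congr pair; lra].
- by rewrite /u /v ifT ?ifT; [congr pair; lra | lra | lra].
- by rewrite /u /v ifF ?ifF; [congr pair; lra | apply/negbTE; lra | apply/negbTE; lra].
Qed.

(** A free homotopy amounts to a conjugation by the tracks of the two ends, which need not be the
    same path. *)
Lemma cls_free (H : R2 -> X) : continuous H -> (forall u, A (H u)) ->
  cls (fun s => H (s, 0)) =
  cmul (cmul (cls (fun t => H (0, t))) (cls (fun s => H (s, 1))))
       (cinv (cls (fun t => H (1, t)))).
Proof.
move=> cH AH; rewrite -(cls_square cH AH).
rewrite (@cmulrK (H (0, 0)) (H (1, 0)) (H (1, 1))) //;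
  by apply: arr_cls; split=> //; cont.
Qed.

End Classes.

Lemma comp_cat (S T : Type) (f : S -> T) (a b : R -> S) :
  f \o Cconcat a b = Cconcat (f \o a) (f \o b).
Proof. by apply/funext => t; rewrite /Cconcat /=; case: ifP. Qed.

Section Functor.
Context {X Y : topologicalType} (A : set X) (B : set Y) (f : X -> Y).
Hypotheses (cf : continuous f) (fAB : forall x, A x -> B (f x)).

Lemma pth_comp x y a : pth A x y a -> pth B (f x) (f y) (f \o a).
Proof.
move=> [ca Aa <- <-]; split=> // [|t] /=; last exact: fAB.
by rewrite /comp; cont.
Qed.

Lemma hpt_comp a b : hpt A a b -> hpt B (f \o a) (f \o b).
Proof.
move=> [h [ch Ah h0 h1 he]]; exists (f \o h); split=> [|p|s|s|t] /=.
- by rewrite /comp; cont.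
- exact: fAB.
- by rewrite h0.
- by rewrite h1.
- by have [-> ->] := he t.
Qed.

End Functor.

(** Completeness replaces the Lebesgue number: the supremum of the points [x] with [P 0 x] has a
    good neighbourhood, which carries the property beyond it unless 1 is reached. *)
Lemma interval_glue (P : R -> R -> Prop) :
  (forall a b c, 0 <= a -> a <= b -> b <= c -> c <= 1 ->
     P a b -> P b c -> P a c) ->
  (forall x, 0 <= x <= 1 -> exists2 d, 0 < d &
     forall a b, 0 <= a -> a <= b -> b <= 1 -> x - d < a -> b < x + d -> P a b) ->
  P 0 1.
Proof.
move=> glue loc.
pose E : set R := [set x | 0 <= x <= 1 /\ P 0 x].
have E0 : E 0.
  split; first by apply/andP; split; lra.
  have [|d d0] := loc 0; first by apply/andP; split; lra.
  by apply; lra.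
have supE : has_sup E.
  by split; [exists 0 | exists 1 => x [/andP[]]].
have s0 : 0 <= sup E by apply: sup_upper_bound.
have s1 : sup E <= 1 by apply: ge_sup; [exists 0 | move=> x [/andP[]]].
have [|d d0 hd] := loc (sup E); first by apply/andP.
have [e Ee ed] := sup_adherent d0 supE.
have es : e <= sup E by apply: sup_upper_bound.
case: Ee => /andP[e0 e1] Pe.
have [h1|h1] := leP 1 (sup E + d / 2).
  by apply: (glue 0 e 1) => //; apply: hd => //; lra.
have : E (sup E + d / 2).
  split; first by apply/andP; split; lra.
  by apply: (glue 0 e) => //; [lra | lra | apply: hd; lra].
move/(sup_upper_bound supE); lra.
Qed.

Lemma square_glue (P : R -> R -> R -> R -> Prop) :
  (forall a b c d e, 0 <= a -> a <= b -> b <= c -> c <= 1 -> 0 <= d -> d <= e ->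
     e <= 1 -> P a b d e -> P b c d e -> P a c d e) ->
  (forall a b c d e, 0 <= a -> a <= b -> b <= 1 -> 0 <= c -> c <= d -> d <= e ->
     e <= 1 -> P a b c d -> P a b d e -> P a b c e) ->
  (forall x y, 0 <= x <= 1 -> 0 <= y <= 1 -> exists2 r, 0 < r &
     forall a b c d, 0 <= a -> a <= b -> b <= 1 -> 0 <= c -> c <= d -> d <= 1 ->
       x - r < a -> b < x + r -> y - r < c -> d < y + r -> P a b c d) ->
  P 0 1 0 1.
Proof.
move=> glueh gluev loc.
apply: (@interval_glue (P 0 1)) => [a b c ? ? ? ?|y y01]; first exact: gluev.
(* Tube argument: [Q a b] asks for a strip of positive height about [y] that works over the whole of
   [[a, b]]; gluing two pieces takes the smaller height. *)
pose Q a b := exists2 r, 0 < r & forall c d, 0 <= c -> c <= d -> d <= 1 ->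
  y - r < c -> d < y + r -> P a b c d.
suff : Q 0 1 by [].
apply: interval_glue => [a b c ? ? ? ? [r r0 hr] [s s0 hs]|x x01].
  exists (Num.min r s); first by rewrite lt_min r0.
  move=> d e ? ? ?; have [? ? ?|? ? ?] := leP r s.
    by apply: (glueh a b c) => //; [apply: hr | apply: hs]; lra.
  by apply: (glueh a b c) => //; [apply: hr | apply: hs]; lra.
have [r r0 hr] := loc x y x01 y01.
by exists r => // a b ? ? ? ? ?; exists r => // c d ? ? ? ? ?; exact: hr.
Qed.

(** * Local systems over the square *)

Lemma open_sublevel (T : topologicalType) (c : T -> R) (r : R) :
  continuous c -> open [set v | c v < r].
Proof. by move=> cc; rewrite openE => v /= h; exact: (cc v _ (lt_nbhsl h)). Qed.

Lemma open_superlevel (T : topologicalType) (c : T -> R) (r : R) :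
  continuous c -> open [set v | r < c v].
Proof. by move=> cc; rewrite openE => v /= h; exact: (cc v _ (lt_nbhsr h)). Qed.

Section LocalSystem.
(** A covering of the plane described without a topology on [E]: [sh i e e'] says that [e] and [e']
    lie on one sheet over [O i]. By [sh_lift] each sheet meets every fibre over [O i], and by
    [sh_compat] the sheets of two members of the cover agree locally. Distinct points of a fibre may
    share their sheets, so uniqueness holds up to [same_germ] only. *)
Variables (E I : Type) (p : E -> R2) (O : I -> set R2) (sh : I -> E -> E -> Prop).
Hypothesis O_open : forall i, open (O i).
Hypothesis O_cover : forall u, exists i, O i u.
Hypothesis sh_sym : forall i e e', sh i e e' -> sh i e' e.
Hypothesis sh_trans : forall i e' e e'',
  O i (p e) -> O i (p e') -> O i (p e'') -> sh i e e' -> sh i e' e'' -> sh i e e''.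
Hypothesis sh_lift : forall i e u, O i (p e) -> O i u ->
  exists2 e', p e' = u & sh i e e'.
Hypothesis sh_compat : forall i j u, O i u -> O j u ->
  exists W : set R2, [/\ open W, W u &
    forall e e', W (p e) -> W (p e') -> sh i e e' -> sh j e e'].

Definition same_germ e e' := p e = p e' /\ forall i, O i (p e) -> sh i e e'.

Definition flat_on (Q : set R2) (s : R2 -> E) :=
  (forall u, Q u -> p (s u) = u) /\
  forall u i, Q u -> O i u -> exists W : set R2,
    [/\ open W, W u & forall v, Q v -> W v -> sh i (s u) (s v)].

Definition flat_along (c : R -> R2) (s : R -> E) :=
  (forall t, 0 <= t <= 1 -> p (s t) = c t) /\
  forall t i, 0 <= t <= 1 -> O i (c t) -> exists2 d, 0 < d &
    forall t', 0 <= t' <= 1 -> t - d < t' -> t' < t + d -> sh i (s t) (s t').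

Lemma same_germ1 i e e' : O i (p e) -> p e = p e' -> sh i e e' -> same_germ e e'.
Proof.
move=> Oi ep h; split=> // j Oj; have [W [_ Wu hW]] := sh_compat Oi Oj.
by apply: hW => //; rewrite -ep.
Qed.

(** Near each time some [O i] contains the curve and each section stays on one sheet over it, so
    lying on a common sheet passes from one end of a short interval to the other. *)
Lemma flat_along_unique c s s' : continuous c -> flat_along c s ->
  flat_along c s' -> same_germ (s 0) (s' 0) -> same_germ (s 1) (s' 1).
Proof.
move=> cc [ps fs] [ps' fs'].
pose P a b := same_germ (s a) (s' a) -> same_germ (s b) (s' b).
suff : P 0 1 by [].
apply: interval_glue => [a b d _ _ _ _ h1 h2 /h1/h2 //|x x01].
have [i Oi] := O_cover (c x).
have [d1 d10 h1] := fs x i x01 Oi; have [d2 d20 h2] := fs' x i x01 Oi.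
have : nbhs x (c @^-1` O i).
  by apply: cc; apply: open_nbhs_nbhs; split=> //; exact: O_open.
move=> /nbhs_ballP [d3 /= d30 h3].
have h3' t : x - d3 < t -> t < x + d3 -> O i (c t).
  by move=> ? ?; apply: h3; rewrite /ball /= ltr_norml; apply/andP; split; lra.
exists (Num.min d1 (Num.min d2 d3)); first by rewrite !lt_min d10 d20.
move=> a b a0 ab b1 xa bx.
have [d1m d2m d3m] : [/\ Num.min d1 (Num.min d2 d3) <= d1,
    Num.min d1 (Num.min d2 d3) <= d2 & Num.min d1 (Num.min d2 d3) <= d3].
  by split; rewrite !ge_min lexx ?orbT.
have Oa : O i (c a) by apply: h3'; lra.
have Ob : O i (c b) by apply: h3'; lra.
have pa : p (s a) = c a by apply: ps; apply/andP; split; lra.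
have pb : p (s b) = c b by apply: ps; apply/andP; split; lra.
have pa' : p (s' a) = c a by apply: ps'; apply/andP; split; lra.
have pb' : p (s' b) = c b by apply: ps'; apply/andP; split; lra.
have px : p (s x) = c x by exact: ps.
have px' : p (s' x) = c x by exact: ps'.
have sa : sh i (s x) (s a) by apply: h1; [apply/andP; split | |]; lra.
have sb : sh i (s x) (s b) by apply: h1; [apply/andP; split | |]; lra.
have sa' : sh i (s' x) (s' a) by apply: h2; [apply/andP; split | |]; lra.
have sb' : sh i (s' x) (s' b) by apply: h2; [apply/andP; split | |]; lra.
move=> [_ /(_ i)]; rewrite pa => /(_ Oa) haa.
apply: (@same_germ1 i); rewrite ?pb ?pb' //.
apply: (sh_trans (e' := s x)); rewrite ?pb ?px ?pb' //; first exact: sh_sym.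
apply: (sh_trans (e' := s a)); rewrite ?pa ?px ?pb' //.
apply: (sh_trans (e' := s' a)); rewrite ?pa ?pa' ?pb' //.
apply: (sh_trans (e' := s' x)); rewrite ?pa' ?px' ?pb' //; exact: sh_sym.
Qed.

Lemma flat_on_along Q s (c : R -> R2) : continuous c -> flat_on Q s ->
  (forall t, 0 <= t <= 1 -> Q (c t)) -> flat_along c (s \o c).
Proof.
move=> cc [ps fs] Qc; split=> [t t01|t i t01 Oi] /=; first by rewrite ps //; exact: Qc.
have [W [oW Wu hW]] := fs _ _ (Qc t t01) Oi.
have : nbhs t (c @^-1` W) by apply: cc; apply: open_nbhs_nbhs.
move=> /nbhs_ballP [d /= d0 hd]; exists d => // t' t'01 h1 h2.
apply: hW; first exact: Qc.
by apply: hd; rewrite /ball /= ltr_norml; apply/andP; split; lra.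
Qed.

Definition trivial_on (Q : set R2) := forall e, Q (p e) ->
  exists2 s, flat_on Q s & same_germ e (s (p e)).

(** The section over [Q2] is taken through the value at [u0] of the section over [Q1]. They agree on
    the common edge [c = r], which is star-shaped about [u0], by uniqueness of lifts along the
    segments issuing from [u0]. *)
Lemma trivial_glue_half (Q1 Q2 : set R2) (c : R2 -> R) (r : R) (u0 : R2) e :
  continuous c ->
  (forall v, Q1 v -> c v <= r) -> (forall v, Q2 v -> r <= c v) ->
  (forall v, c v = r -> Q1 v <-> Q2 v) ->
  Q1 u0 -> c u0 = r ->
  (forall v, Q1 v -> c v = r -> forall t, 0 <= t <= 1 ->
     c (u0.1 + t * (v.1 - u0.1), u0.2 + t * (v.2 - u0.2)) = r /\
     Q1 (u0.1 + t * (v.1 - u0.1), u0.2 + t * (v.2 - u0.2))) ->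
  trivial_on Q1 -> trivial_on Q2 -> Q1 (p e) ->
  exists2 s, flat_on (Q1 `|` Q2) s & same_germ e (s (p e)).
Proof.
move=> cc c1 c2 c12 Qu0 cu0 seg t1 t2 Qe.
have [s1 f1 g1] := t1 e Qe.
have pu0 : p (s1 u0) = u0 by exact: f1.1.
have [|s2 f2 g2] := t2 (s1 u0).
  by rewrite pu0; exact/(c12 _ cu0).
have side v : Q1 v -> c v = r -> same_germ (s1 v) (s2 v).
  move=> Qv cv.
  pose l (t : R) : R2 := (u0.1 + t * (v.1 - u0.1), u0.2 + t * (v.2 - u0.2)).
  have cl : continuous l by rewrite /l; cont.
  have l0 : l 0 = u0 by rewrite /l [RHS]surjective_pairing; congr pair; lra.
  have l1 : l 1 = v by rewrite /l [RHS]surjective_pairing; congr pair; lra.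
  have := @flat_along_unique l (s1 \o l) (s2 \o l) cl.
  rewrite /= l0 l1; apply.
  - by apply: (@flat_on_along Q1) => // t t01; have [] := seg v Qv cv t t01.
  - apply: (@flat_on_along Q2) => // t t01; have [h1 h2] := seg v Qv cv t t01.
    exact/(c12 _ h1).
  - by move: g2; rewrite pu0.
exists (fun v => if c v <= r then s1 v else s2 v); last by rewrite c1.
have far v : Q2 v -> c v <= r -> Q1 v /\ c v = r.
  move=> Qv cv; have e1 : c v = r by apply/eqP; rewrite eq_le cv c2.
  by split=> //; exact/(c12 _ e1).
have pside v : (Q1 `|` Q2) v -> p (if c v <= r then s1 v else s2 v) = v.
  move=> [] Qv; first by rewrite c1 //; exact: f1.1.
  case: ifP => h; last exact: f2.1.
  by apply: f1.1; have [] := far v Qv h.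
have nc v : ~~ (c v <= r) -> (Q1 `|` Q2) v -> Q2 v.
  by move=> /negP h [/c1|].
split=> // u i Qu Oi; case: (ltgtP (c u) r) => cu.
- have Q1u : Q1 u by case: Qu => // /c2; rewrite leNgt cu.
  have [W [oW Wu hW]] := f1.2 u i Q1u Oi.
  exists (W `&` [set v | c v < r]); split=> //.
    by apply: openI => //; exact: open_sublevel.
  move=> v Qv [Wv /= cv]; rewrite (ltW cv); apply: hW => //.
  by case: Qv => // /c2; rewrite leNgt cv.
- have Q2u : Q2 u by case: Qu => // /c1; rewrite leNgt cu.
  have [W [oW Wu hW]] := f2.2 u i Q2u Oi.
  exists (W `&` [set v | r < c v]); split=> //.
    by apply: openI => //; exact: open_superlevel.
  move=> v Qv [Wv /= cv]; rewrite leNgt cv /=; apply: hW => //.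
  by case: Qv => // /c1; rewrite leNgt cv.
- have [Q1u Q2u] : Q1 u /\ Q2 u.
    by case: Qu => h; split=> //; apply/(c12 _ cu).
  have [W [oW Wu hW]] := f1.2 u i Q1u Oi.
  have [W' [oW' Wu' hW']] := f2.2 u i Q2u Oi.
  have OOi : nbhs u (O i) by apply: open_nbhs_nbhs; split=> //; exact: O_open.
  exists ((W `&` W') `&` O i); split=> //.
    by apply: openI => //; exact: openI.
  move=> v Qv [[Wv Wv'] Ov]; case: ifPn => cv.
    apply: hW => //; case: Qv => // Qv; by have [] := far v Qv cv.
  have [pe1 /(_ i) h] := side u Q1u cu.
  have pu1 : p (s1 u) = u by exact: f1.1.
  have pu2 : p (s2 u) = u by exact: f2.1.
  have Q2v := nc v cv Qv; have pv2 : p (s2 v) = v by exact: f2.1.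
  apply: (sh_trans (e' := s2 u)); rewrite ?pu1 ?pu2 ?pv2 //.
    by apply: h; rewrite pu1.
  by apply: hW'.
Qed.

Lemma trivial_glue (Q1 Q2 : set R2) (c : R2 -> R) (r : R) (u0 : R2) :
  continuous c ->
  (forall v, Q1 v -> c v <= r) -> (forall v, Q2 v -> r <= c v) ->
  (forall v, c v = r -> Q1 v <-> Q2 v) ->
  Q1 u0 -> c u0 = r ->
  (forall v, Q1 v -> c v = r -> forall t, 0 <= t <= 1 ->
     c (u0.1 + t * (v.1 - u0.1), u0.2 + t * (v.2 - u0.2)) = r /\
     Q1 (u0.1 + t * (v.1 - u0.1), u0.2 + t * (v.2 - u0.2))) ->
  trivial_on Q1 -> trivial_on Q2 -> trivial_on (Q1 `|` Q2).
Proof.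
move=> cc c1 c2 c12 Qu0 cu0 seg t1 t2 e [Qe|Qe].
  exact: (@trivial_glue_half Q1 Q2 c r u0).
(* With [- c] the two pieces exchange their roles, which settles the points lying over [Q2]. *)
rewrite setUC; apply: (@trivial_glue_half Q2 Q1 (fun v => - c v) (- r) u0) => //.
- by cont.
- by move=> v /c2 h; rewrite lerN2.
- by move=> v /c1 h; rewrite lerN2.
- by move=> v /oppr_inj /c12 h; split=> /h.
- exact/(c12 _ cu0).
- by rewrite cu0.
- move=> v Qv /oppr_inj cv t t01; have [|h1 h2] := seg v _ cv t t01.
    exact/(c12 _ cv).
  by rewrite h1; split=> //; exact/(c12 _ h1).
Qed.

Definition rect (a b c d : R) : set R2 :=
  [set u | (a <= u.1 <= b) /\ (c <= u.2 <= d)].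

Theorem local_system_trivial : trivial_on unit_square.
Proof.
suff : trivial_on (rect 0 1 0 1).
  by [].
apply: (@square_glue (fun a b c d => trivial_on (rect a b c d))).
- move=> a b c d e a0 ab bc c1 d0 de e1 t1 t2.
  have -> : rect a c d e = rect a b d e `|` rect b c d e.
    rewrite predeqE => u; split.
      move=> [/andP[h1 h2] h3]; case: (leP u.1 b) => h; [left|right];
        by split=> //; apply/andP; split=> //; exact: ltW.
    by case=> -[/andP[h1 h2] h3]; split=> //; apply/andP; split; lra.
  apply: (@trivial_glue _ _ fst b (b, d)) => //.
  + by cont.
  + by move=> v [/andP[]].
  + by move=> v [/andP[]].
  + by move=> v h; rewrite /rect /= h lexx ab bc; split.
  + by rewrite /rect /= ab !lexx de.
  + move=> v [h1 /andP[h2 h3]] h t /andP[t0 t1'] /=; rewrite h subrr mulr0 addr0.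
    by split=> //; rewrite /rect /= ab lexx; split=> //; apply/andP; split; nra.
- move=> a b c d e a0 ab b1 c0 cd de e1 t1 t2.
  have -> : rect a b c e = rect a b c d `|` rect a b d e.
    rewrite predeqE => u; split.
      move=> [h3 /andP[h1 h2]]; case: (leP u.2 d) => h; [left|right];
        by split=> //; apply/andP; split=> //; exact: ltW.
    by case=> -[h3 /andP[h1 h2]]; split=> //; apply/andP; split; lra.
  apply: (@trivial_glue _ _ snd d (a, d)) => //.
  + by cont.
  + by move=> v [_ /andP[]].
  + by move=> v [_ /andP[]].
  + by move=> v h; rewrite /rect /= h lexx cd de; split.
  + by rewrite /rect /= ab !lexx cd.
  + move=> v [/andP[h2 h3] h1] h t /andP[t0 t1'] /=; rewrite h subrr mulr0 addr0.
    by split=> //; rewrite /rect /= cd lexx; split=> //; apply/andP; split; nra.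
- move=> x y x01 y01; have [i Oi] := O_cover (x, y).
  have : nbhs (x, y) (O i) by apply: open_nbhs_nbhs; split=> //; exact: O_open.
  move=> /nbhs_ballP [r /= r0 hr]; exists r => // a b c d _ _ _ _ _ _ xa bx yc dy.
  have sub u : rect a b c d u -> O i u.
    move=> [/andP[h1 h2] /andP[h3 h4]]; apply: hr; split; rewrite /ball /= ltr_norml;
      by apply/andP; split; lra.
  move=> e Qe; have Oe := sub _ Qe.
  have : forall u, exists e', rect a b c d u -> p e' = u /\ sh i e e'.
    (* Outside the rectangle the value is immaterial, and [e] serves as a default. *)
    move=> u; case: (pselect (rect a b c d u)) => [Qu|nQ]; last by exists e.
    by have [e' h1 h2] := sh_lift Oe (sub u Qu); exists e'.
  move=> /choice [s hs]; exists s; last first.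
    by have [h1 h2] := hs _ Qe; apply: (@same_germ1 i) => //; rewrite h1.
  split=> [u Qu|u j Qu Oj]; first by have [] := hs u Qu.
  have [W [oW Wu hW]] := sh_compat (sub u Qu) Oj.
  exists W; split=> // v Qv Wv; have [h1 h2] := hs u Qu; have [h3 h4] := hs v Qv.
  apply: hW; rewrite ?h1 ?h3 //.
  apply: (sh_trans (e' := e)); rewrite ?h1 ?h3 //; try exact: sub.
  exact: sh_sym.
Qed.

End LocalSystem.

(** * Configurations and lifting *)

Lemma nbhs_forall (T : topologicalType) (x : T) (I : finType) (f : I -> set T) :
  (forall i, nbhs x (f i)) -> nbhs x [set y | forall i, f i y].
Proof. by move=> h; exact: (@filter_forall _ I f (nbhs x) (nbhs_filter x) h). Qed.

Section Configurations.
Context {n : nat} {M : topologicalType}.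
Implicit Types (z : Mpow n M) (s : 'S_n).

(** Products of permutations compose from left to right, so precomposition is an action in the order
    shown by [actM], without inverses. *)
Definition act s z : Mpow n M := fun i => z (s i).

Lemma act_continuous s : continuous (act s).
Proof. by apply: cont_Mpow => i; apply: (@cont_proj _ _ _ (fun z => z) (s i)); exact: cont_id. Qed.

Lemma Fconf_act s z : Fconf n M z -> Fconf n M (act s z).
Proof. by move=> iz i j /iz /perm_inj. Qed.

Lemma qconf_act s z : qconf (act s z) = qconf z.
Proof.
rewrite /qconf predeqE => x; split=> -[i _ <-]; first by exists (s i).
by exists ((s^-1)%g i) => //; rewrite /act permKV.
Qed.

Lemma qconf_eq z z' : Fconf n M z' -> qconf z = qconf z' ->
  exists s, z' = act s z.
Proof.
move=> iz'; rewrite predeqE => e.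
have : forall i, exists j, z j = z' i.
  by move=> i; have [_ [|j _ h]] := e (z' i); [exists i | exists j].
move=> /choice [f hf].
have fi : injective f by move=> i j fij; apply: iz'; rewrite -!hf fij.
by exists (perm fi); apply/funext => i; rewrite /act permE hf.
Qed.

Lemma actM s (t : 'S_n) z : act s (act t z) = act (s * t)%g z.
Proof. by apply/funext => i; rewrite /act permM. Qed.

Lemma act1 z : act 1%g z = z.
Proof. by apply/funext => i; rewrite /act perm1. Qed.

Lemma act_inj z s (t : 'S_n) : Fconf n M z -> act s z = act t z -> s = t.
Proof.
by move=> iz e; apply/permP => i; apply: iz; exact: (congr1 (@^~ i) e).
Qed.

Definition separating (U : 'I_n -> set M) :=
  (forall i, open (U i)) /\ forall i j x, U i x -> U j x -> i = j.

Lemma separate z (V : 'I_n -> set M) : hausdorff_space M -> Fconf n M z ->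
  (forall i, open (V i) /\ V i (z i)) ->
  exists2 U, separating U & forall i, U i (z i) /\ U i `<=` V i.
Proof.
rewrite open_hausdorff => hM iz hV.
have : forall ij : 'I_n * 'I_n, exists AB : set M * set M, ij.1 != ij.2 ->
  [/\ z ij.1 \in AB.1, z ij.2 \in AB.2, open AB.1, open AB.2
    & AB.1 `&` AB.2 = set0].
  move=> [i j] /=; have [->|ij] := eqVneq i j; first by exists (setT, setT).
  have [|AB [h1 h2] [h3 h4 /eqP h5]] := hM (z i) (z j).
    by apply: contra ij => /eqP /iz ->.
  by exists AB.
move=> /choice [f hf].
(* The sets chosen for [(i, j)] need not be those chosen for [(j, i)] in reverse order, so
   membership in both is imposed. *)
pose U i : set M := [set x | V i x /\
  forall j, j != i -> (f (i, j)).1 x /\ (f (j, i)).2 x].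
exists U; last first.
  move=> i; split; last by move=> x [].
  split; first exact: (hV i).2.
  move=> j ji; have [|h1 _ _ _ _] := hf (i, j); first by rewrite eq_sym.
  have [//|_ h2 _ _ _] := hf (j, i).
  by split; [move: h1 | move: h2]; rewrite inE.
split=> [i|i j x [_ h1] [_ h2]]; last first.
  apply/eqP; apply: contraT => ij.
  have [|_ _ _ _] := hf (i, j); first by [].
  rewrite predeqE => /(_ x) [] [] //.
  have [|h _] := h1 j; first by rewrite eq_sym.
  by have [//|_ h'] := h2 i.
rewrite openE => x [Vx hx]; rewrite /interior.
have nV : nbhs x (V i) by apply: open_nbhs_nbhs; split=> //; exact: (hV i).1.
have nj j : nbhs x [set y | j != i -> (f (i, j)).1 y /\ (f (j, i)).2 y].
  have [->|ji] := eqVneq j i; first by apply: filterE.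
  have [|h1 h2] := hx j; first by [].
  have [|_ _ o1 _ _] := hf (i, j); first by rewrite eq_sym.
  have [//|_ _ _ o2 _] := hf (j, i).
  have n1 : nbhs x (f (i, j)).1 by apply: open_nbhs_nbhs.
  have n2 : nbhs x (f (j, i)).2 by apply: open_nbhs_nbhs.
  by apply: filterS2 n1 n2 => y.
have nall : nbhs x [set y | forall j, j != i -> (f (i, j)).1 y /\ (f (j, i)).2 y].
  exact: nbhs_forall.
by apply: filterS2 nV nall => y.
Qed.

Lemma separated_act U z s : separating U -> (forall i, U i (z i)) ->
  (forall i, U i (act s z i)) -> s = 1%g.
Proof.
move=> [_ dU] h1 h2; apply/permP => i; rewrite perm1.
by apply: (dU _ _ (z (s i))); [exact: h1 | exact: h2].
Qed.

(** For a separating family this is an evenly covered set: each of its configurations has exactly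
    one labelling with label [i] in [U i], and its other labellings are the permuted ones. *)
Definition neighbour (U : 'I_n -> set M) : set (set M) :=
  [set c | exists2 z, qconf z = c & forall i, U i (z i)].

Lemma neighbour_open U : separating U -> Cconf_open n M (neighbour U).
Proof.
move=> [oU dU].
exists [set z | exists s, forall i, U i (act s z i)]; split.
  rewrite openE => z [s hs].
  have n1 i : nbhs z [set z' : Mpow n M | U i (act s z' i)].
    have ca : continuous (fun z' : Mpow n M => act s z' i).
      by apply: cont_proj; exact: act_continuous.
    by apply: (ca z); apply: open_nbhs_nbhs; split.
  have := nbhs_forall n1.
  by apply: filterS => z' h; exists s.
rewrite predeqE => z; split=> -[h iz]; split=> //.
  by case: h => s hs; exists (act s z) => //; rewrite qconf_act.
case: h => z' e hz'.
have iz' : Fconf n M z' by move=> i j e'; apply: (dU _ _ (z' i)); rewrite // e'.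
by have [s es] := qconf_eq iz' (esym e); exists s => i; rewrite -es.
Qed.

(** If two lifts agree at one time, then at nearby times both labellings respect the same disjoint
    neighbourhoods, and [separated_act] leaves no permutation between them. *)
Lemma path_lift_unique (f g : R -> Mpow n M) : hausdorff_space M ->
  continuous f -> continuous g -> (forall t, Fconf n M (f t)) ->
  (forall t, Fconf n M (g t)) ->
  (forall t, 0 <= t <= 1 -> qconf (f t) = qconf (g t)) ->
  f 0 = g 0 -> f 1 = g 1.
Proof.
move=> hM cf cg Ff Fg e.
pose P a b := f a = g a -> f b = g b; suff : P 0 1 by [].
apply: interval_glue => [a b c _ _ _ _ h1 h2 /h1 /h2 //|x x01].
have [U sU hU] := @separate (f x) (fun=> setT) hM (Ff x) (fun _ => conj openT I).
have [s es] := qconf_eq (Fg x) (e x x01).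
have nf : nbhs x [set t : R | forall i, U i (f t i)].
  apply: nbhs_forall => i; have cfi : continuous (fun t => f t i) by exact: cont_proj.
  by apply: (cfi x); apply: open_nbhs_nbhs; split; [exact: sU.1 | exact: (hU i).1].
have ng : nbhs x [set t : R | forall i, U (s i) (g t i)].
  apply: nbhs_forall => i; have cgi : continuous (fun t => g t i) by exact: cont_proj.
  apply: (cgi x); apply: open_nbhs_nbhs; split; first exact: sU.1.
  by rewrite es; exact: (hU (s i)).1.
have : nbhs x ([set t : R | forall i, U i (f t i)] `&` [set t : R | forall i, U (s i) (g t i)]).
  exact: filterI.
move=> /nbhs_ballP [d /= d0 hd].
have hd' t : x - d < t -> t < x + d ->
    (forall i, U i (f t i)) /\ (forall i, U (s i) (g t i)).
  by move=> ? ?; apply: hd; rewrite /ball /= ltr_norml; apply/andP; split; lra.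
exists d => // a b a0 ab b1 xa bx eab.
have [f1 g1] := hd' a xa ltac:(lra).
have [f2 g2] := hd' b ltac:(lra) bx.
have s1 i : s i = i by apply: (sU.2 _ _ (f a i)); [rewrite eab; exact: g1 | exact: f1].
have [|r er] := qconf_eq (Fg b) (e b _); first by apply/andP; split; lra.
rewrite er (@separated_act U (f b) r) ?act1 // => i.
by rewrite -er; have := g2 i; rewrite s1.
Qed.

(** The retraction of the line onto the unit interval extends data given on the interval or the
    square to the whole line or plane, as [pth] and [hpt] require. *)
Definition clamp (t : R) : R := Num.max 0 (Num.min 1 t).

Lemma clamp_continuous : continuous clamp.
Proof. by rewrite /clamp; cont. Qed.

Lemma clamp01 t : 0 <= clamp t <= 1.
Proof. by rewrite /clamp le_max lexx /= ge_max ler01 ge_min lexx. Qed.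

Lemma clamp_id t : 0 <= t <= 1 -> clamp t = t.
Proof.
by move=> /andP[t0 t1]; rewrite /clamp (min_idPr t1); apply/max_idPr.
Qed.

Lemma clamp_le0 t : t <= 0 -> clamp t = 0.
Proof. by move=> t0; rewrite /clamp; case: (leP 1 t) => h; [lra | apply/max_idPl]. Qed.

Lemma clamp_ge1 t : 1 <= t -> clamp t = 1.
Proof. by move=> t1; rewrite /clamp (min_idPl t1); apply/max_idPr; exact: ler01. Qed.

Lemma clamp0 : clamp 0 = 0. Proof. exact: clamp_le0. Qed.

Lemma clamp1 : clamp 1 = 1. Proof. exact: clamp_ge1. Qed.

(** The pullback along [K] of the covering by ordered configurations is a local system over the
    square, and a flat section of it is a lift of [K]. *)
Lemma lift_square (K : R2 -> set M) z0 : hausdorff_space M ->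
  Cconf_cont n M unit_square K -> Fconf n M z0 -> qconf z0 = K (0, 0) ->
  exists h : R2 -> Mpow n M, [/\ continuous h, forall u, Fconf n M (h u),
    forall u, qconf (h u) = K (clamp u.1, clamp u.2),
    forall u, h u = h (clamp u.1, clamp u.2) & h (0, 0) = z0].
Proof.
move=> hM [KC Kc] Fz0 ez0.
pose cl2 (u : R2) : R2 := (clamp u.1, clamp u.2).
have ccl := clamp_continuous.
have ccl2 : continuous cl2 by rewrite /cl2; cont.
have cl2S u : unit_square (cl2 u).
  by split; rewrite /unit_interval /= in_itv /= clamp01.
have cl2id u : unit_square u -> cl2 u = u.
  move=> [h1 h2]; rewrite /cl2 !clamp_id -?surjective_pairing //.
pose E := {e : R2 * Mpow n M | Fconf n M e.2 /\ qconf e.2 = K (cl2 e.1)}.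
pose p (e : E) : R2 := (sval e).1.
pose pt (e : E) : Mpow n M := (sval e).2.
(* Sheets are indexed by families of disjoint open sets: two labellings share a sheet when each
   label lies in the same members of the family. *)
pose J := {U : 'I_n -> set M | separating U}.
pose O (U : J) : set R2 := [set u | neighbour (sval U) (K (cl2 u))].
pose sh (U : J) (e e' : E) := forall i j, sval U j (pt e i) <-> sval U j (pt e' i).
have Oopen U : open (O U).
  have [W [oW eW]] := Kc _ (neighbour_open (svalP U)).
  have -> : O U = cl2 @^-1` W.
    rewrite predeqE => u; move: eW; rewrite predeqE => /(_ (cl2 u)) [h1 h2].
    by split=> h; [case: h2 | case: h1].
  exact: open_comp.
have sepof z : Fconf n M z -> exists2 U : J, True & forall i, sval U i (z i).
  move=> Fz; have [U sU hU] := @separate z (fun=> setT) hM Fz (fun _ => conj openT I).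
  by exists (exist _ U sU) => // i; exact: (hU i).1.
have Ocover u : exists U, O U u.
  have [z Fz ez] := KC _ (cl2S u); have [U _ hU] := sepof z Fz.
  by exists U; exists z.
have inO (U : J) (e : E) : O U (p e) ->
    exists s, forall i j, sval U j (pt e i) <-> j = s i.
  move=> [z ez hz]; have [Fe qe] := svalP e.
  have [s es] : exists s, pt e = act s z by apply: qconf_eq => //; rewrite ez -qe.
  exists s => i j; rewrite es /act; split=> [h|->]; last exact: hz.
  exact: ((svalP U).2 _ _ _ h (hz _)).
have FofU (U : J) z : (forall i, sval U i (z i)) -> Fconf n M z.
  by move=> hz i j eij; apply: ((svalP U).2 _ _ (z i)); [exact: hz | rewrite eij; exact: hz].
have S0 : unit_square (0, 0).
  by rewrite /unit_square /unit_interval /= !in_itv /= lexx ler01.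
have q0 : Fconf n M z0 /\ qconf z0 = K (cl2 (0, 0)) by rewrite cl2id.
have [||||s fs gs] := @local_system_trivial E J p O sh Oopen Ocover _ _ _ _
  (exist _ ((0, 0), z0) q0) S0.
- by move=> i e e' h a b; split=> /h.
- by move=> i e' e e'' _ _ _ h1 h2 a b; split=> [/h1 /h2 | /h2 /h1].
- move=> U e u Oe [z ez hz]; have [s hs] := inO U e Oe.
  have q : Fconf n M (act s z) /\ qconf (act s z) = K (cl2 u).
    by split; [apply: Fconf_act; exact: FofU hz | rewrite qconf_act].
  exists (exist _ (u, act s z) q) => // i j; rewrite hs /pt /= /act.
  split=> [->|h]; first exact: hz.
  exact: ((svalP U).2 _ _ _ h (hz _)).
- move=> U V u [z ez hz] [z' ez' hz'].
  have Fz' := FofU V z' hz'.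
  have [s es] : exists s, z' = act s z by apply: qconf_eq => //; rewrite ez.
  (* [s] compares the labelling fitted to [U] with the one fitted to [V]; on the refinement [T] the
     member of [U] containing a label determines the member of [V]. *)
  pose T i := sval U i `&` sval V ((s^-1)%g i).
  have sT : separating T.
    split=> [i|i j x [h1 _] [h2 _]]; last exact: ((svalP U).2 _ _ x).
    by apply: openI; [exact: (svalP U).1 | exact: (svalP V).1].
  exists (O (exist _ T sT)); split=> //.
    exists z => // i; split=> //.
    by have := hz' ((s^-1)%g i); rewrite es /act permKV.
  move=> e e' Oe Oe' sU; have [r hr] := inO _ _ Oe; have [r' hr'] := inO _ _ Oe'.
  have err i : r i = r' i.
    have [_ /(_ erefl) [h1 _]] := hr i (r i); have [_ /(_ erefl) [h2 _]] := hr' i (r' i).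
    by apply: ((svalP U).2 _ _ (pt e' i)) => //; apply/sU.
  move=> i j; have [_ /(_ erefl) [_ h1]] := hr i (r i).
  have [_ /(_ erefl) [_ h2]] := hr' i (r' i); rewrite /= in h1 h2.
  split=> h.
    by rewrite ((svalP V).2 _ _ _ h h1) err.
  by rewrite ((svalP V).2 _ _ _ h h2) -err.
have qs v : unit_square v -> qconf (pt (s v)) = K v.
  move=> Sv; have [_ q] := svalP (s v); rewrite /pt q.
  by have := fs.1 v Sv; rewrite /p => ->; rewrite cl2id.
exists (fun u => pt (s (cl2 u))); split.
- apply: cont_Mpow => i u B nB.
  have Fs := (svalP (s (cl2 u))).1; rewrite -/(pt _) in Fs.
  move: nB; rewrite /= nbhsE => -[B' [oB' B'u] sB'].
  (* Continuity of coordinate [i]: a separating family is chosen with [U i] inside the given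
     neighbourhood, and flatness keeps label [i] there. *)
  have [|U sU hU] := @separate _ (fun j => if j == i then B' else setT) hM Fs.
    by move=> j; case: eqP => [->|_]; split=> //; exact: openT.
  have OU : O (exist _ U sU) (cl2 u).
    exists (pt (s (cl2 u))); last by move=> j; exact: (hU j).1.
    by rewrite [cl2 (cl2 u)]cl2id // qs.
  have [W [oW Wu hW]] := fs.2 _ _ (cl2S u) OU.
  have nW : nbhs u (cl2 @^-1` W) by apply: ccl2; apply: open_nbhs_nbhs.
  apply: filterS nW => v Wv /=; apply: sB'.
  have := (hU i).2; rewrite eqxx; apply.
  by apply/(hW _ (cl2S v) Wv i i); exact: (hU i).1.
- by move=> u; exact: (svalP (s (cl2 u))).1.
- by move=> u; rewrite qs.
- by move=> u; rewrite -/(cl2 u) [cl2 (cl2 u)]cl2id.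
- rewrite cl2id //; have [pe] := gs; rewrite /p /= => gs'.
  have [r er] : exists r, pt (s (0, 0)) = act r z0.
    by apply: qconf_eq; [exact: (svalP (s (0, 0))).1 | rewrite qs].
  have [U _ hU] := sepof z0 Fz0.
  have OU : O U (0, 0) by exists z0 => //; rewrite cl2id.
  rewrite er (@separated_act _ z0 r (svalP U)) ?act1 // => i.
  by rewrite -er; apply/(gs' U OU i i); exact: hU.
Qed.

End Configurations.

(** * Unique roots from a bi-ordering *)

(** Homotopies fix the ends, so a class knows them. Together with [act_inj] this turns equalities of
    braids into equalities of permutations. *)
Lemma arr_inj (X : topologicalType) (A : set X) x y x' y' p :
  arr A x y p -> arr A x' y' p -> x = x' /\ y = y'.
Proof.
move=> [a pa ->] [b pb e]; have := clsP pb e => /hpt_ends [e0 e1].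
by case: pa e0 e1 => _ _ <- <-; case: pb => _ _ <- <- <- <-.
Qed.

Lemma unit_intervalE t : unit_interval t <-> 0 <= t <= 1.
Proof. by rewrite /unit_interval /= in_itv. Qed.

Section Braids.
Context {n : nat} {M : topologicalType}.
Hypothesis hM : hausdorff_space M.
Local Notation F := (Fconf n M).
Implicit Types (z : Mpow n M) (s : 'S_n) (p q : set (R -> Mpow n M)).

Lemma Cconf_cont_comp (X : topologicalType) (A : set X) (f : X -> Mpow n M) :
  continuous f -> (forall x, F (f x)) -> Cconf_cont n M A (qconf \o f).
Proof.
move=> cf Ff; split=> [x _|U [W [oW eW]]]; first by exists (f x).
exists (f @^-1` W); split; first exact: open_comp.
rewrite predeqE => x; move: eW; rewrite predeqE => /(_ (f x)) [h1 h2].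
by split=> -[h Ax]; split=> //; [case: h1 | case: h2].
Qed.

Lemma hpt_Chomotopic a b : hpt F a b -> qconf (a 1) = qconf (a 0) ->
  Chomotopic n M (qconf (a 0)) (qconf \o a) (qconf \o b).
Proof.
move=> [h [ch Fh h0 h1 he]] e; exists (qconf \o h); split.
- exact: Cconf_cont_comp.
- by move=> s _ /=; rewrite h0 h1.
- by move=> t _ /=; have [-> ->] := he t.
Qed.

(** The lift of [K] from [z] has constant vertical sides, being lifts of constant paths, and its
    horizontal sides are [a] and [b] by uniqueness of lifts. The equality of the ends [x] and [y]
    comes out of this. *)
Lemma Chomotopic_hpt z x y a b : pth F z x a -> pth F z y b ->
  Chomotopic n M (qconf z) (qconf \o a) (qconf \o b) -> hpt F a b.
Proof.
move=> pa pb [K [Kc K01 Kt]].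
have [ca Fa a0 a1] := pa; have [cb Fb b0 b1] := pb.
have Fz : F z by rewrite -a0.
have S0 : unit_interval 0 by apply/unit_intervalE; rewrite lexx ler01.
have S1 : unit_interval 1 by apply/unit_intervalE; rewrite lexx ler01.
have [|h [ch Fh qh hcl h00]] := @lift_square n M K z hM Kc Fz.
  by have [-> _] := Kt 0 S0.
have S t : unit_interval (clamp t) by apply/unit_intervalE; exact: clamp01.
have lift1 (f g : R -> Mpow n M) : continuous f -> continuous g ->
    (forall t, F (f t)) -> (forall t, F (g t)) ->
    (forall t, 0 <= t <= 1 -> qconf (f t) = qconf (g t)) -> f 0 = g 0 ->
    forall t, 0 <= t <= 1 -> f t = g t.
  move=> cf cg Ff Fg e e0 t /andP[t0 t1].
  (* Uniqueness was proved at time 1; rescaling the parameter by [t] gives it at every time of the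
     unit interval. *)
  have := @path_lift_unique n M (fun s : R => f (t * s)) (fun s : R => g (t * s)) hM.
  rewrite mulr1 mulr0; apply=> //; [by cont | by cont |].
  by move=> s /andP[s0 s1]; apply: e; apply/andP; split; nra.
have hl t : 0 <= t <= 1 -> h (0, t) = z.
  move=> t01; apply: (@lift1 (fun t => h (0, t)) (fun=> z)) => // [||s _].
  + by cont.
  + by cont.
  + by rewrite qh /= clamp0; have [-> _] := Kt _ (S s).
have hl' t : h (0, t) = z by rewrite hcl /= clamp0 hl ?clamp01.
have ha t : 0 <= t <= 1 -> h (t, 0) = a t.
  move=> t01; apply: (@lift1 (fun t => h (t, 0)) a) => // [|s s01|].
  + by cont.
  + by rewrite qh /= clamp0 clamp_id //; have [-> _] := K01 s (proj2 (unit_intervalE s) s01).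
  + by rewrite h00.
have hb t : 0 <= t <= 1 -> h (t, 1) = b t.
  move=> t01; apply: (@lift1 (fun t => h (t, 1)) b) => // [|s s01|].
  + by cont.
  + by rewrite qh /= clamp1 clamp_id //; have [_ ->] := K01 s (proj2 (unit_intervalE s) s01).
  + by rewrite hl'.
have I1 : 0 <= (1 : R) <= 1 by rewrite lexx ler01.
have hr t : h (1, t) = a 1.
  rewrite hcl /= clamp1 -(ha 1 I1).
  apply: (@lift1 (fun t => h (1, t)) (fun=> h (1, 0))) => // [||s _|]; last exact: clamp01.
  + by cont.
  + by cont.
  + by rewrite !qh /= clamp1 clamp0; have [_ ->] := Kt _ (S s); have [_ ->] := Kt _ S0.
have e1 : b 1 = a 1 by rewrite -(hb 1 I1) hr.
have ph0 : pth F z (a 1) (fun t => h (t, 0)).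
  by split=> //; cont.
have ph1 : pth F z (a 1) (fun t => h (t, 1)).
  by split=> //; cont.
apply: (@hpt_trans _ _ (fun t => h (t, 0))).
  by apply: hpt_eq ph0 _; [split | move=> t /ha].
apply: (@hpt_trans _ _ (fun t => h (t, 1))).
  by exists h; split=> // t; rewrite hl' !hr h00.
by apply: hpt_eq ph1 _ _; [split | move=> t /hb].
Qed.

Lemma Cloop_comp z s a : pth F z (act s z) a -> Cloop n M (qconf z) (qconf \o a).
Proof.
move=> [ca Fa a0 a1]; split=> /=; first exact: Cconf_cont_comp.
- by rewrite a0.
- by rewrite a1 qconf_act.
Qed.

Lemma Cconf_cont_fst g : Cconf_cont n M unit_interval g ->
  Cconf_cont n M unit_square (fun u => g u.1).
Proof.
move=> [h1 h2]; split=> [u [/h1 //]|U /h2 [W [oW eW]]].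
exists (fst @^-1` W); split; first by apply: open_comp => // u _; exact: continuous_fst.
rewrite predeqE => u; move: eW; rewrite predeqE => /(_ u.1) [k1 k2].
split=> -[h [I1 I2]]; split=> //.
- by have [] := k1 (conj h I1).
- by have [] := k2 (conj h I1).
Qed.

Lemma Chomotopic_eq c g g' : Cloop n M c g ->
  (forall t, unit_interval t -> g t = g' t) -> Chomotopic n M c g g'.
Proof.
move=> [gc g0 g1] e; exists (fun u => g u.1); split=> //=; first exact: Cconf_cont_fst.
by move=> s /e ->.
Qed.

Lemma path_lift c g z : Cloop n M c g -> F z -> qconf z = c ->
  exists b y, pth F z y b /\ forall t, unit_interval t -> qconf (b t) = g t.
Proof.
move=> [gc g0 g1] Fz ez.
have [|h [ch Fh qh _ h00]] := lift_square hM (Cconf_cont_fst gc) Fz.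
  by rewrite ez /= g0.
exists (fun t => h (t, 0)), (h (1, 0)); split; first by split=> //; cont.
by move=> t /unit_intervalE t01; rewrite qh /= clamp_id.
Qed.

Definition cact s p : set (R -> Mpow n M) := [set act s \o a | a in p].

Lemma cactM s (t : 'S_n) p : cact s (cact t p) = cact (s * t)%g p.
Proof.
rewrite predeqE => c; split.
- move=> [_ [a pa <-] <-]; exists a => //; apply/funext => x /=.
  by rewrite actM.
- move=> [a pa <-]; exists (act t \o a); first by exists a.
  by apply/funext => x /=; rewrite actM.
Qed.

Lemma pth_act s x y a : pth F x y a -> pth F (act s x) (act s y) (act s \o a).
Proof.
by move=> pa; apply: pth_comp pa; [exact: act_continuous | exact: Fconf_act].
Qed.

Lemma hpt_act s a b : hpt F a b -> hpt F (act s \o a) (act s \o b).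
Proof. by apply: hpt_comp; [exact: act_continuous | exact: Fconf_act]. Qed.

Lemma cact_cls s a : cact s (cls F a) = cls F (act s \o a).
Proof.
rewrite predeqE => c; split; first by move=> [b hb <-]; exact: hpt_act.
move=> hc; exists (act s^-1%g \o c); last first.
  by apply/funext => x /=; rewrite actM mulgV act1.
have := hpt_act s^-1%g hc; rewrite (_ : act s^-1%g \o (act s \o a) = a) //.
by apply/funext => x /=; rewrite actM mulVg act1.
Qed.

Lemma arr_act s x y p : arr F x y p -> arr F (act s x) (act s y) (cact s p).
Proof.
by move=> [a pa ->]; exists (act s \o a); [exact: pth_act | exact: cact_cls].
Qed.

Lemma cact_mul s x y z p q : arr F x y p -> arr F y z q ->
  cact s (cmul F p q) = cmul F (cact s p) (cact s q).
Proof.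
move=> [a pa ->] [b pb ->].
rewrite (cmul_cls pa pb) !cact_cls comp_cat.
by rewrite (cmul_cls (pth_act s pa) (pth_act s pb)).
Qed.

Lemma cact_inv s x y p : arr F x y p -> cact s (cinv F p) = cinv F (cact s p).
Proof.
move=> [a pa ->].
by rewrite (cinv_cls pa) !cact_cls (cinv_cls (pth_act s pa)).
Qed.

(** The power of a braid over [s], seen upstairs: the second factor has to start at [act s z], so it
    is the translate of [p] by [s], the third one the translate by [s ^+ 2], and so on. *)
Fixpoint cpow z s p k : set (R -> Mpow n M) :=
  if k is k'.+1 then cmul F p (cact s (cpow z s p k')) else cls F (Cconst z).

Lemma arr_pow z s p k : arr F z (act s z) p ->
  arr F z (act (s ^+ k)%g z) (cpow z s p k).
Proof.
move=> ap; elim: k => [|k IH] /=.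
  by rewrite expg0 act1; apply: arr1; have [] := arr_ends ap.
by apply: (arr_mul ap); rewrite expgS -actM; exact: arr_act.
Qed.

(** Only braids over powers of [t] are compared: [H] contains the pure braids and one braid over
    [t], hence all of these. *)
Definition unique_roots z (t : 'S_n) := forall k i j p q, (0 < k)%N ->
  arr F z (act (t ^+ i)%g z) p -> arr F z (act (t ^+ j)%g z) q ->
  cpow z (t ^+ i)%g p k = cpow z (t ^+ j)%g q k -> p = q.

Fixpoint Cpow (c : set M) (g : R -> set M) k :=
  if k is k'.+1 then Cconcat g (Cpow c g k') else Cconst c.

Lemma cpow_cls z s a k : pth F z (act s z) a ->
  exists2 b, cpow z s (cls F a) k = cls F b &
    pth F z (act (s ^+ k)%g z) b /\ qconf \o b = Cpow (qconf z) (qconf \o a) k.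
Proof.
move=> pa; have Fz : F z by case: pa => _ h <- _.
elim: k => [|k [b e [pb eb]]] /=.
  exists (Cconst z) => //; split=> //; first by rewrite expg0 act1; exact: pth_cst.
exists (Cconcat a (act s \o b)).
  rewrite e cact_cls (cmul_cls pa (_ : pth _ _ (act (s ^+ k.+1)%g z) _)) //.
  by rewrite expgS -actM; exact: pth_act.
split.
  by apply: (pth_cat pa); rewrite expgS -actM; exact: pth_act.
rewrite comp_cat -eb; congr Cconcat.
by apply/funext => x /=; rewrite qconf_act.
Qed.

(** Change of base point: [q], then [p], then the inverse of the translate of [q] is the braid [p]
    read from [z0]. In its powers the inner translates of [q] cancel in pairs. *)
Lemma cpow_conj z0 z s p q k : arr F z0 z q -> arr F z (act s z) p ->
  cpow z0 s (cmul F (cmul F q p) (cinv F (cact s q))) k =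
  cmul F (cmul F q (cpow z s p k)) (cinv F (cact (s ^+ k)%g q)).
Proof.
move=> aq ap; have [Fz0 Fz] := arr_ends aq.
have actk x j : act s (act (s ^+ j)%g x) = act (s ^+ j.+1)%g x by rewrite actM expgS.
elim: k => [|k IH] /=.
  have -> : cact (s ^+ 0)%g q = q.
    by case: aq => a pa ->; rewrite cact_cls; congr cls; apply/funext => x /=; rewrite expg0 act1.
  by rewrite (cmulr1 aq) (cmulrV aq).
rewrite IH; have apk := arr_pow k ap.
have asq := arr_act s aq; have aks := arr_act (s ^+ k)%g aq.
rewrite (cact_mul s (arr_mul aq apk) (arr_inv aks)) (cact_mul s aq apk).
rewrite (cact_inv s aks) cactM -expgS.
have apk' := arr_act s apk; rewrite actk in apk'.
have ask := arr_act (s ^+ k.+1)%g aq.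
rewrite -(cmulA _ (cmul F q p)) -(cmulA _ (cact s q)).
rewrite (cmulKr asq (arr_mul apk' (arr_inv ask))).
by rewrite !cmulA.
Qed.

Lemma unique_roots_transport z0 z (t : 'S_n) q : arr F z0 z q -> unique_roots z0 t ->
  unique_roots z t.
Proof.
move=> aq U k i j p p' k0 ap ap' e.
have [Fz0 Fz] := arr_ends aq.
(* Equal powers have equal ends, so both conjugated powers close up with the same translate of
   [q]. *)
have ei : (t ^+ i ^+ k)%g = (t ^+ j ^+ k)%g.
  have := arr_pow k ap'; rewrite -e => /(arr_inj (arr_pow k ap)) [_].
  exact: act_inj.
have aP := arr_mul (arr_mul aq ap) (arr_inv (arr_act (t ^+ i)%g aq)).
have aP' := arr_mul (arr_mul aq ap') (arr_inv (arr_act (t ^+ j)%g aq)).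
have eP := U k i j _ _ k0 aP aP'.
rewrite (cpow_conj k aq ap) (cpow_conj k aq ap') e ei in eP; have {}eP := eP erefl.
have := aP'; rewrite -eP => /(arr_inj aP) [_] /(act_inj Fz0) eij.
have := congr1 (fun r => cmul F (cinv F q) (cmul F r (cact (t ^+ i)%g q))) eP.
rewrite {3}eij.
rewrite (cmulrVK (arr_mul aq ap) (arr_act (t ^+ i)%g aq)).
rewrite (cmulrVK (arr_mul aq ap') (arr_act (t ^+ j)%g aq)).
by rewrite (cmulKr aq ap) (cmulKr aq ap').
Qed.

Lemma cls_Chomotopic z s a b : pth F z (act s z) a -> pth F z (act s z) b ->
  cls F a = cls F b -> Chomotopic n M (qconf z) (qconf \o a) (qconf \o b).
Proof.
move=> pa pb /(clsP pb) h; case: (pa) => _ _ a0 a1.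
rewrite -{1}a0; apply: hpt_Chomotopic => //.
by rewrite a0 a1 qconf_act.
Qed.

(** [t] is the permutation of a lift of the loop [g]; were it trivial, the lift would be closed and
    [g] pure. Strict inequalities pass to positive powers by multiplication on both sides, so two
    elements with a common power cannot be strictly ordered. *)
Lemma biorder_unique_roots z0 (H : set (R -> set M)) : F z0 ->
  braid_subgroup n M (qconf z0) H -> pure_braids z0 `<=` H ->
  (exists2 g, H g & ~ pure_braids z0 g) ->
  biorderable_subgroup n M (qconf z0) H ->
  exists2 t : 'S_n, t != 1%g & unique_roots z0 t.
Proof.
move=> Fz0 [Hloop Hhom H1 Hmul Hinv] pureH [g Hg ng].
move=> [lt [ltE lt_irr lt_tr lt_tot lt_mul]].
have [b [y [pb eb]]] := path_lift (Hloop g Hg) Fz0 erefl.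
have [t et] : exists t, y = act t z0.
  apply: qconf_eq; first by case: pb => _ h _ <-.
  case: (pb) => _ _ _ <-; rewrite eb; last by apply/unit_intervalE; rewrite lexx ler01.
  by case: (Hloop g Hg).
subst y; exists t.
  apply/eqP => t1; apply: ng; split; first exact: Hloop.
  case: (pb) => cb Fb b0 b1; exists b; split=> //.
  - exact: continuous_subspaceT.
  - by rewrite b1 t1 act1.
  - by apply: Chomotopic_eq; [exact: Hloop | move=> x /eb].
have Hb : H (qconf \o b).
  apply: (Hhom g _ Hg); first exact: Cloop_comp pb.
  by apply: Chomotopic_eq; [exact: Hloop | move=> x /eb].
have Hpure a : pth F z0 z0 a -> H (qconf \o a).
  move=> pa; have pa' : pth F z0 (act 1%g z0) a by rewrite act1.
  have la := Cloop_comp pa'; apply: pureH; split=> //.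
  case: (pa) => ca Fa a0 a1; exists a; split=> //; first exact: continuous_subspaceT.
  exact: Chomotopic_eq.
have Hpow i : exists2 c, pth F z0 (act (t ^+ i)%g z0) c & H (qconf \o c).
  elim: i => [|i [c pc Hc]].
    by exists (Cconst z0); [rewrite expg0 act1; exact: pth_cst | exact: H1].
  exists (Cconcat b (act t \o c)).
    by apply: (pth_cat pb); rewrite expgS -actM; exact: pth_act.
  rewrite comp_cat (_ : qconf \o (act t \o c) = qconf \o c); first exact: Hmul.
  by apply/funext => x /=; rewrite qconf_act.
(* Two braids over one power of [t] differ by a pure braid, and pure braids lie in [H]. *)
have Hall i a : pth F z0 (act (t ^+ i)%g z0) a -> H (qconf \o a).
  move=> pa; have [c pc Hc] := Hpow i.
  have Hac := Hpure _ (pth_cat pa (pth_rev pc)).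
  apply: (Hhom _ _ (Hmul _ _ Hac Hc) (Cloop_comp pa)); rewrite -comp_cat.
  have pacc := pth_cat (pth_cat pa (pth_rev pc)) pc.
  apply: (cls_Chomotopic pacc pa).
  rewrite -(cmul_cls (pth_cat pa (pth_rev pc)) pc) -(cmul_cls pa (pth_rev pc)).
  rewrite -(cinv_cls pc); exact: cmulrVK (arr_cls pa) (arr_cls pc).
have HCpow x k : H x -> H (Cpow (qconf z0) x k).
  by move=> Hx; elim: k => [|k IH] /=; [exact: H1 | exact: Hmul].
have lt_pow x y' k : (0 < k)%N -> H x -> H y' -> lt x y' ->
    lt (Cpow (qconf z0) x k) (Cpow (qconf z0) y' k).
  move=> + Hx Hy xy; elim: k => [//|[|k] IH] _ /=; first by have [] := lt_mul _ _ _ Hx Hy H1 xy.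
  have {}IH := IH isT.
  have Hxk := HCpow x k.+1 Hx; have Hyk := HCpow y' k.+1 Hy.
  apply: (lt_tr _ (Cconcat x (Cpow (qconf z0) y' k.+1))); try exact: Hmul.
  - by have [] := lt_mul _ _ _ Hxk Hyk Hx IH.
  - by have [] := lt_mul _ _ _ Hx Hy Hyk xy.
have eqv_refl x : H x -> Chomotopic n M (qconf z0) x x.
  by move=> Hx; apply: Chomotopic_eq => //; exact: Hloop.
move=> k i j p q k0 [a pa ->] [c pc ->] e.
have [a' ea [pa' qa']] := cpow_cls k pa; have [c' ec [pc' qc']] := cpow_cls k pc.
have Ha := Hall _ _ pa; have Hc := Hall _ _ pc.
have {}e : cls F a' = cls F c' by rewrite -ea -ec.
have pc2 : pth F z0 (act (t ^+ i ^+ k)%g z0) c'.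
  by apply: pth_hpt pa' _; exact: clsP pc' e.
have eqv1 : Chomotopic n M (qconf z0) (Cpow (qconf z0) (qconf \o a) k)
    (Cpow (qconf z0) (qconf \o c) k).
  by rewrite -qa' -qc'; exact: cls_Chomotopic pa' pc2 e.
have eqv2 : Chomotopic n M (qconf z0) (Cpow (qconf z0) (qconf \o c) k)
    (Cpow (qconf z0) (qconf \o a) k).
  by rewrite -qa' -qc'; exact: cls_Chomotopic pc2 pa' (esym e).
have HA := HCpow _ k Ha; have HC := HCpow _ k Hc.
have [h|h|h] := lt_tot _ _ Ha Hc.
- case: (lt_irr _ HA); apply: (ltE _ _ _ _ HA HA HC HA (eqv_refl _ HA) eqv2).
  exact: lt_pow.
- by apply: cls_eq; exact: Chomotopic_hpt pa pc h.
- case: (lt_irr _ HA); apply: (ltE _ _ _ _ HC HA HA HA eqv2 (eqv_refl _ HA)).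
  exact: lt_pow.
Qed.

End Braids.

(** * Discs and motions of configurations *)

Lemma cont_within (T X Y : topologicalType) (A : set X) (f : X -> Y) (a : T -> X) :
  {within A, continuous f} -> continuous a -> (forall t, A (a t)) ->
  continuous (fun t => f (a t)).
Proof.
move=> /subspace_continuousP cf ca Aa t U nU.
have h : nbhs t (a @^-1` [set y | A y -> U (f y)]) by apply: ca; exact: cf nU.
by apply: filterS h => y; apply; exact: Aa.
Qed.

(** One model for the neighbourhoods of interior and of boundary points. It is convex but not
    invariant under rotations, so inside discs only straight motions and homotheties are used. *)
Definition hbox (c : R2) (r : R) : set R2 :=
  [set v | [/\ `|v.1 - c.1| < r, `|v.2 - c.2| < r & 0 <= v.2]].

Definition lerp (t : R) (v w : R2) : R2 :=
  ((1 - t) * v.1 + t * w.1, (1 - t) * v.2 + t * w.2).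

Lemma lerp0 v w : lerp 0 v w = v.
Proof. by rewrite /lerp [RHS]surjective_pairing; congr pair; lra. Qed.

Lemma lerp1 v w : lerp 1 v w = w.
Proof. by rewrite /lerp [RHS]surjective_pairing; congr pair; lra. Qed.

Lemma norm_convex (t r x y : R) : 0 <= t <= 1 -> `|x| < r -> `|y| < r ->
  `|(1 - t) * x + t * y| < r.
Proof.
move=> /andP[t0 t1]; rewrite !ltr_norml => /andP[x1 x2] /andP[y1 y2].
by have [->|t1'] := eqVneq t 1; apply/andP; split; nra.
Qed.

Lemma hbox_convex c r v w t : hbox c r v -> hbox c r w -> 0 <= t <= 1 ->
  hbox c r (lerp t v w).
Proof.
move=> [v1 v2 v3] [w1 w2 w3] t01; split=> /=.
- have -> : (1 - t) * v.1 + t * w.1 - c.1 =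
    (1 - t) * (v.1 - c.1) + t * (w.1 - c.1) by ring.
  exact: norm_convex.
- have -> : (1 - t) * v.2 + t * w.2 - c.2 =
    (1 - t) * (v.2 - c.2) + t * (w.2 - c.2) by ring.
  exact: norm_convex.
- by case/andP: t01 => ? ?; nra.
Qed.

Section Charts.
Context {M : topologicalType}.
Implicit Types (U V W : set M) (B : set R2) (f : M -> R2) (g : R2 -> M).

Definition chart U B f g :=
  [/\ open U, B `<=` halfplane, {within U, continuous f},
      {within B, continuous g} &
      [/\ forall x, U x -> B (f x), forall v, B v -> U (g v),
          forall x, U x -> g (f x) = x & forall v, B v -> f (g v) = v]].

Definition disc V := exists f g c r, [/\ 0 < r, halfplane c & chart V (hbox c r) f g].

Lemma chart_shrink U B f g x W : chart U B f g -> rel_open halfplane B ->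
  U x -> open W -> W x -> exists2 r, 0 < r &
    [/\ hbox (f x) r `<=` B, forall v, hbox (f x) r v -> W (g v) &
        chart (U `&` f @^-1` (hbox (f x) r)) (hbox (f x) r) f g].
Proof.
move=> ch [B' [oB' eB']] Ux oW Wx; have [oU BH cf cg [fU gB gf fg]] := ch.
have Bx := fU x Ux.
have B'x : B' (f x).
  by move: eB'; rewrite predeqE => /(_ (f x)) [_ [|//]]; split=> //; exact: BH.
have BB' v : B' v -> halfplane v -> B v.
  by move=> h1 h2; move: eB'; rewrite predeqE => /(_ v) [[|//]].
have nB : nbhs (f x) B' by apply: open_nbhs_nbhs.
have nW : nbhs (f x) [set v | B v -> W (g v)].
  have nW' : nbhs (g (f x)) W by rewrite gf //; apply: open_nbhs_nbhs.
  by have /subspace_continuousP /(_ (f x) Bx) h := cg; exact: (h _ nW').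
have : nbhs (f x) (B' `&` [set v | B v -> W (g v)]) by exact: filterI.
move=> /nbhs_ballP [r /= r0 hr]; exists r => //.
have inball v : hbox (f x) r v -> ball (f x) r v.
  by move=> [h1 h2 _]; split; rewrite /ball /= distrC.
have sB : hbox (f x) r `<=` B.
  by move=> v hv; apply: BB'; [have [] := hr v (inball v hv) | case: hv].
split=> // [v hv|]; first by have [_] := hr v (inball v hv); apply; exact: sB.
split.
- rewrite openE => y [Uy hy].
  have nU : nbhs y U by apply: open_nbhs_nbhs.
  have nb : nbhs (f y) (ball (f x) r).
    apply: open_nbhs_nbhs; split; last exact: inball.
    have -> : ball (f x) r = [set v : R2 | `|(f x).1 - v.1| < r] `&`
        [set v : R2 | `|(f x).2 - v.2| < r] by [].
    by apply: openI; apply: open_sublevel; cont.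
  have := cf; rewrite continuous_open_subspace // => /(_ y).
  rewrite inE => /(_ Uy (ball (f x) r) nb) nf.
  have {}nf : nbhs y (f @^-1` ball (f x) r) := nf.
  apply: filterS2 nU nf => u Uu [b1 b2]; split=> //.
  by split; rewrite 1?distrC //; exact: BH (fU u Uu).
- by move=> v /sB /BH.
- exact: continuous_subspaceW cf.
- exact: continuous_subspaceW cg.
- split=> [y [_]|v hv|y [Uy _]|v /sB hv] //; last by rewrite fg.
  + by split; [exact: gB (sB v hv) | rewrite /= fg //; exact: sB].
  + exact: gf.
Qed.

Lemma hbox_rel_open c r : rel_open halfplane (hbox c r).
Proof.
exists ([set v : R2 | `|v.1 - c.1| < r] `&` [set v : R2 | `|v.2 - c.2| < r]).
split; first by apply: openI; apply: open_sublevel; cont.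
by rewrite predeqE => v; split=> [[[h1 h2] h3]|[[h1 h2 h3] h4]].
Qed.

Lemma disc_nbhs x W : surface_with_boundary M -> open W -> W x ->
  exists2 V, disc V & V x /\ V `<=` W.
Proof.
move=> [_ /(_ x) [U [B [f [oU Ux BH rB [g [cf cg fU gB [gf fg]]]]]]]] oW Wx.
have ch : chart U B f g by [].
have [r r0 [sB hW ch']] := chart_shrink ch rB Ux oW Wx.
exists (U `&` f @^-1` hbox (f x) r).
  by exists f, g, (f x), r; split=> //; exact: BH (fU x Ux).
split; first by split=> //=; split; rewrite ?subrr ?normr0 //; exact: BH (fU x Ux).
by move=> y [Uy hy]; rewrite -(gf y Uy); exact: hW.
Qed.

Lemma disc_open V : disc V -> open V.
Proof. by move=> [f [g [c [r [_ _ []]]]]]. Qed.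

Definition P2 V : set (M * M) := [set y | [/\ V y.1, V y.2 & y.1 <> y.2]].

(* In coordinates, pairs of distinct points are joined by straight motions
   as long as their difference vectors are not opposite. *)
Lemma disc_pairs_line V f g c r y y' : chart V (hbox c r) f g -> P2 V y -> P2 V y' ->
  (forall t, 0 <= t <= 1 ->
     lerp t (f y.1) (f y'.1) <> lerp t (f y.2) (f y'.2)) ->
  exists a, pth (P2 V) y y' a.
Proof.
move=> [oV _ cf cg [fV gV gf fg]] [y1 y2 _] [y1' y2' _] ne.
pose a (t : R) : M * M := (g (lerp (clamp t) (f y.1) (f y'.1)),
                           g (lerp (clamp t) (f y.2) (f y'.2))).
have hb v w t : V v -> V w -> hbox c r (lerp (clamp t) (f v) (f w)).
  by move=> Vv Vw; apply: hbox_convex; [exact: fV | exact: fV | exact: clamp01].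
have ccl := clamp_continuous.
exists a; split.
- apply: cont_pair; apply: (cont_within cg) => [|t]; try exact: hb;
    by rewrite /lerp; cont.
- move=> t; split=> /=; [exact: gV (hb _ _ _ _ _) | exact: gV (hb _ _ _ _ _)|].
  move=> e; apply: (ne (clamp t) (clamp01 t)).
  by rewrite -(fg _ (hb y.1 y'.1 t y1 y1')) e fg //; exact: hb.
- by rewrite /a clamp0 !lerp0 !gf // -surjective_pairing.
- by rewrite /a clamp1 !lerp1 !gf // -surjective_pairing.
Qed.

(** If the straight motion to the horizontal pair [yh] has a collision, the two points have equal
    second coordinates; a collision on the way to the vertical pair [yv] would make the first
    coordinates equal as well. So one of the two motions succeeds, and [yv] is joined to [yh]. *)
Lemma disc_pairs_connected V y y' : disc V -> P2 V y -> P2 V y' ->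
  exists a, pth (P2 V) y y' a.
Proof.
move=> [f [g [c [r [r0 Hc ch]]]]] Py Py'.
have [oV _ cf cg [fV gV gf fg]] := ch.
pose m : R2 := (c.1, c.2).
have c20 : 0 <= c.2 := Hc.
have hm : hbox c r m by split; rewrite ?subrr ?normr0.
have hh : hbox c r (c.1 + r / 2, c.2).
  split=> //=; rewrite ?subrr ?normr0 //.
  by rewrite (_ : c.1 + r / 2 - c.1 = r / 2); [rewrite gtr0_norm; lra | ring].
have hv : hbox c r (c.1, c.2 + r / 2).
  split=> //=; rewrite ?subrr ?normr0 //; last by lra.
  by rewrite (_ : c.2 + r / 2 - c.2 = r / 2); [rewrite gtr0_norm; lra | ring].
pose yh : M * M := (g m, g (c.1 + r / 2, c.2)).
pose yv : M * M := (g m, g (c.1, c.2 + r / 2)).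
have Pyh : P2 V yh.
  split=> /=; [exact: gV | exact: gV | move=> e].
  by have := fg _ hm; rewrite e fg // => -[]; lra.
have Pyv : P2 V yv.
  split=> /=; [exact: gV | exact: gV | move=> e].
  by have := fg _ hm; rewrite e fg // => -[]; lra.
have vh : exists a, pth (P2 V) yv yh a.
  apply: (disc_pairs_line ch) => // t /andP[t0 t1] /=.
  by rewrite !fg // /lerp /= => -[]; nra.
have toh x : P2 V x -> exists a, pth (P2 V) x yh a.
  move=> Px; have [x1 x2 x12] := Px.
  have fx12 : f x.1 <> f x.2.
    by move=> e; apply: x12; rewrite -(gf _ x1) e gf.
  have [h|h] := pselect (forall t, 0 <= t <= 1 ->
      lerp t (f x.1) (f yh.1) <> lerp t (f x.2) (f yh.2)).
    exact: (disc_pairs_line ch).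
  have [a pa] : exists a, pth (P2 V) x yv a.
    apply: (disc_pairs_line ch) => // t /andP[t0 t1] /=.
    rewrite !fg // /lerp /= => -[e1 e2]; apply: h => t' /andP[t0' t1'] /=.
    rewrite !fg // /lerp /= => -[e1' e2']; apply: fx12.
    rewrite [LHS]surjective_pairing [RHS]surjective_pairing.
    have [t1e|t1n] := eqVneq t 1; first by exfalso; nra.
    have [t1e'|t1n'] := eqVneq t' 1; first by exfalso; nra.
    congr pair.
    - apply: (mulfI (_ : 1 - t != 0)); last by lra.
      by rewrite subr_eq0 eq_sym.
    - apply: (mulfI (_ : 1 - t' != 0)); last by lra.
      by rewrite subr_eq0 eq_sym.
  by have [b pb] := vh; exists (Cconcat a b); exact: pth_cat pa pb.
have [a pa] := toh y Py; have [b pb] := toh y' Py'.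
by exists (Cconcat a (Creverse b)); exact: pth_cat pa (pth_rev pb).
Qed.

(** A homothety contracts [V] towards [k] into [V'], injectively at each time, so it moves a path of
    pairs into [V']. The tracks of the ends stay in [V'] because its image in the chart is convex
    and contains [f k]. *)
Lemma disc_pairs_shrink V k W : disc V -> V k -> open W -> W k ->
  exists2 V', disc V' & [/\ V' k, V' `<=` V, V' `<=` W &
    forall y y' a, P2 V' y -> P2 V' y' -> pth (P2 V) y y' a ->
      exists2 a', pth (P2 V') y y' a' & hpt (P2 V) a a'].
Proof.
move=> [f [g [c [r [r0 Hc ch]]]]] Vk oW Wk.
have [oV _ cf cg [fV gV gf fg]] := ch.
have [s s0 [sB hW ch']] := chart_shrink ch (@hbox_rel_open c r) Vk oW Wk.
set V' := V `&` f @^-1` hbox (f k) s in ch'.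
have fk2 : 0 <= (f k).2 by case: (fV k Vk).
exists V'; first by exists f, g, (f k), s.
have V'k : V' k by split=> //=; split; rewrite ?subrr ?normr0.
split=> //.
- by move=> x [].
- by move=> x [Vx hx]; rewrite -(gf x Vx); exact: hW.
move=> y y' a Py Py' [ca Pa a0 a1].
(* The final ratio of the homothety: coordinates of points of [V] differ from those of [k] by less
   than [2 * r], hence by less than [s] after contraction. Its positivity keeps the contraction
   injective. *)
pose e := Num.min 1 (s / (2 * r)).
have e0 : 0 < e by rewrite lt_min ltr01 divr_gt0 //; lra.
have e1 : e <= 1 by rewrite ge_min lexx.
have es : e * (2 * r) <= s by rewrite -ler_pdivlMr ?ge_min ?lexx ?orbT //; lra.
pose l (t : R) := (1 - e) * clamp t.
have l01 t : 0 <= l t <= 1.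
  by have /andP[? ?] := clamp01 t; rewrite /l; apply/andP; split; nra.
have l1e t : l t <= 1 - e by have /andP[? ?] := clamp01 t; rewrite /l; nra.
have ccl := clamp_continuous.
have ccll : continuous l by rewrite /l; cont.
pose S (t : R) (x : M) : M := g (lerp (l t) (f x) (f k)).
have hS t x : V x -> hbox c r (lerp (l t) (f x) (f k)).
  by move=> Vx; apply: hbox_convex; [exact: fV | exact: fV | exact: l01].
have hS' t x : V' x -> V' (S t x).
  move=> [Vx hx]; split; first exact: gV (hS t x Vx).
  rewrite /S /= fg; last exact: hS.
  by apply: hbox_convex; [exact: hx | exact: V'k.2 | exact: l01].
have hS1 x : V x -> V' (S 1 x).
  move=> Vx; split; first exact: gV (hS _ x Vx).
  rewrite /S /= fg; last exact: hS.
  have [x1 x2 x3] := fV x Vx; have [k1 k2 k3] := fV k Vk.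
  have -> : l 1 = 1 - e by rewrite /l clamp1 mulr1.
  move: x1 x2 k1 k2; rewrite !ltr_norml => /andP[? ?] /andP[? ?] /andP[? ?] /andP[? ?].
  by split; rewrite /lerp /= ?ltr_norml; [apply/andP; split; nra | apply/andP; split; nra | nra].
have Sinj t x x' : V x -> V x' -> S t x = S t x' -> x = x'.
  move=> Vx Vx' E; rewrite -(gf _ Vx) -(gf _ Vx'); congr g.
  have : lerp (l t) (f x) (f k) = lerp (l t) (f x') (f k).
    by rewrite -(fg _ (hS t x Vx)) -(fg _ (hS t x' Vx')); congr f.
  have lt1 := l1e t.
  rewrite /lerp => -[E1 E2]; rewrite [LHS]surjective_pairing [RHS]surjective_pairing.
  by congr pair; apply: (mulfI (_ : 1 - l t != 0)); rewrite ?subr_eq0; lra.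
pose H (u : R2) : M * M := (S u.2 (a u.1).1, S u.2 (a u.1).2).
have Va1 t : V (a t).1 by case: (Pa t).
have Va2 t : V (a t).2 by case: (Pa t).
have cH : continuous H.
  apply: cont_pair; apply: (cont_within cg) => [|u]; try exact: hS; rewrite /lerp.
    have cfa : continuous (fun u : R2 => f (a u.1).1).
      by apply: (cont_within cf) => [|u //]; cont.
    by cont.
  have cfa : continuous (fun u : R2 => f (a u.1).2).
    by apply: (cont_within cf) => [|u //]; cont.
  by cont.
have HP u : P2 V (H u).
  split=> /=; [exact: gV (hS _ _ (Va1 _)) | exact: gV (hS _ _ (Va2 _))|].
  by move/(Sinj _ _ _ (Va1 _) (Va2 _)); case: (Pa u.1).
have S0 x : V x -> S 0 x = x by move=> Vx; rewrite /S /l clamp0 mulr0 lerp0 gf.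
have H0 : (fun t => H (t, 0)) = a.
  by apply/funext => t; rewrite /H /= !S0 // -surjective_pairing.
have Hy x : P2 V' x -> forall t, P2 V' (S t x.1, S t x.2).
  move=> [h1 h2 h3] t; split=> /=; [exact: hS' | exact: hS' |].
  by move/Sinj => /(_ h1.1 h2.1).
have p1 : pth (P2 V') y (H (0, 1)) (fun t => H (0, t)).
  split=> //; [by cont | by move=> t; rewrite /H /= a0; exact: Hy |].
  by rewrite -a0; exact: (congr1 (fun b => b 0) H0).
have p2 : pth (P2 V') (H (0, 1)) (H (1, 1)) (fun t => H (t, 1)).
  split=> //; first by cont.
  move=> t; have [h1 h2 h3] := HP (t, 1).
  by split=> //=; [exact: hS1 | exact: hS1].
have p3 : pth (P2 V') y' (H (1, 1)) (fun t => H (1, t)).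
  split=> //; [by cont | by move=> t; rewrite /H /= a1; exact: Hy |].
  by rewrite -a1; exact: (congr1 (fun b => b 1) H0).
have sub x z b : pth (P2 V') x z b -> pth (P2 V) x z b.
  by move=> [h1 h2 h3 h4]; split=> // t; have [[k1 _] [k2 _] k3] := h2 t.
have p12 := pth_cat p1 p2; have p123 := pth_cat p12 (pth_rev p3).
exists (Cconcat (Cconcat (fun t => H (0, t)) (fun t => H (t, 1)))
                (Creverse (fun t => H (1, t)))) => //.
apply: (clsP (sub _ _ _ p123)); rewrite -{1}H0 (cls_free cH HP).
rewrite (cmul_cls (sub _ _ _ p1) (sub _ _ _ p2)) (cinv_cls (sub _ _ _ p3)).
exact: cmul_cls (sub _ _ _ p12) (pth_rev (sub _ _ _ p3)).
Qed.

End Charts.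

(** * Path-connectedness of the configurations of a connected surface *)

Section Connectivity.
Context {M : topologicalType}.
Implicit Types (V W : set M).

(** [k] is an optional point to be avoided; [None] asks only for a path in the disc. *)
Lemma disc_line V f g c r x y (k : option M) : chart V (hbox c r) f g ->
  V x -> V y ->
  (forall l t, k = Some l -> V l -> 0 <= t <= 1 -> lerp t (f x) (f y) <> f l) ->
  exists a, pth [set z | V z /\ Some z <> k] x y a.
Proof.
move=> [oV _ cf cg [fV gV gf fg]] Vx Vy ne.
have hb t : hbox c r (lerp (clamp t) (f x) (f y)).
  by apply: hbox_convex; [exact: fV | exact: fV | exact: clamp01].
have ccl := clamp_continuous.
exists (fun t => g (lerp (clamp t) (f x) (f y))); split.
- by apply: (cont_within cg) => // ; rewrite /lerp; cont.
- move=> t; split=> [|ek]; first exact: gV.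
  apply: (ne _ (clamp t) (esym ek)); [exact: gV | exact: clamp01 | by rewrite fg].
- by rewrite clamp0 lerp0 gf.
- by rewrite clamp1 lerp1 gf.
Qed.

Lemma disc_connected V (k : option M) x y : disc V -> V x -> V y ->
  Some x <> k -> Some y <> k -> exists a, pth [set z | V z /\ Some z <> k] x y a.
Proof.
move=> [f [g [c [r [r0 Hc ch]]]]] Vx Vy xk yk.
have [oV _ cf cg [fV gV gf fg]] := ch.
have [h|h] := pselect (forall l t, k = Some l -> V l -> 0 <= t <= 1 ->
    lerp t (f x) (f y) <> f l); first exact: (disc_line ch).
have [l [t [kl Vl t01 el]]] : exists l t, [/\ k = Some l, V l, 0 <= t <= 1
    & lerp t (f x) (f y) = f l].
  apply: contrapT => h2; apply: h => l t kl Vl t01 el.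
  by apply: h2; exists l, t.
have fxl : f x <> f l by move=> e; apply: xk; rewrite kl -(gf _ Vx) e gf.
have fyl : f y <> f l by move=> e; apply: yk; rewrite kl -(gf _ Vy) e gf.
(* a detour perpendicular to the segment, on the side where the second
   coordinate does not decrease *)
set X := f x in fxl el *; set Y := f y in fyl el *; set L := f l in fxl fyl el *.
have [L1 L2 L3] := fV l Vl; rewrite -/L in L1 L2 L3.
pose a := X.1 - L.1; pose b := X.2 - L.2.
pose a' := Y.1 - L.1; pose b' := Y.2 - L.2.
have e1 : (1 - t) * a + t * a' = 0.
  by move: el; rewrite /lerp [L in _ = L]surjective_pairing /a /a' => -[<- _]; ring.
have e2 : (1 - t) * b + t * b' = 0.
  by move: el; rewrite /lerp [L in _ = L]surjective_pairing /b /b' => -[_ <-]; ring.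
have ab : 0 < a ^+ 2 + b ^+ 2.
  rewrite lt_neqAle addr_ge0 ?sqr_ge0 // andbT eq_sym paddr_eq0 ?sqr_ge0 //.
  rewrite !sqrf_eq0; apply/andP => -[/eqP ha /eqP hb]; apply: fxl.
  by rewrite [LHS]surjective_pairing [RHS]surjective_pairing; congr pair;
    move: ha hb; rewrite /a /b; lra.
have ab' : 0 < a' ^+ 2 + b' ^+ 2.
  rewrite lt_neqAle addr_ge0 ?sqr_ge0 // andbT eq_sym paddr_eq0 ?sqr_ge0 //.
  rewrite !sqrf_eq0; apply/andP => -[/eqP ha /eqP hb]; apply: fyl.
  by rewrite [LHS]surjective_pairing [RHS]surjective_pairing; congr pair;
    move: ha hb; rewrite /a' /b'; lra.
pose sg : R := if 0 <= a then 1 else -1.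
have sga : 0 <= sg * a by rewrite /sg; case: ifPn => h3; lra.
have sg1 : sg ^+ 2 = 1 by rewrite /sg; case: ifPn => h3; rewrite ?expr1n ?sqrrN ?expr1n.
pose m := Num.min (r - `|L.1 - c.1|) (r - `|L.2 - c.2|).
have m0 : 0 < m by rewrite lt_min; apply/andP; split; lra.
have m1 : m <= r - `|L.1 - c.1| by rewrite ge_min lexx.
have m2 : m <= r - `|L.2 - c.2| by rewrite ge_min lexx orbT.
(* [m] is the margin that the box leaves around [L], and [e * D = m] makes both coordinates of the
   displacement from [L] to [q] smaller than it. *)
pose D := `|a| + `|b| + 1.
have D0 : 0 < D by rewrite /D; have := normr_ge0 a; have := normr_ge0 b; lra.
have [e e0 eD] : exists2 e, 0 < e & e * D = m.
  by exists (m / D); [rewrite divr_gt0 | rewrite divfK // gt_eqF].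
pose q : R2 := (L.1 - e * (sg * b), L.2 + e * (sg * a)).
have sgn : `|sg| = 1 by rewrite /sg; case: ifP => _; rewrite ?normrN normr1.
have hq : hbox c r q.
  split=> /=.
  - have -> : L.1 - e * (sg * b) - c.1 = (L.1 - c.1) - e * (sg * b) by ring.
    apply: le_lt_trans (ler_normB _ _) _; rewrite !normrM sgn mul1r (gtr0_norm e0).
    by have := normr_ge0 a; rewrite /D in eD; nra.
  - have -> : L.2 + e * (sg * a) - c.2 = (L.2 - c.2) + e * (sg * a) by ring.
    apply: le_lt_trans (ler_normD _ _) _; rewrite !normrM sgn mul1r (gtr0_norm e0).
    by have := normr_ge0 b; rewrite /D in eD; nra.
  - by nra.
(* A segment to [q] starting at [L + w], with [w] parallel to [(a, b)], misses [L]: the displacement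
   of [q] is orthogonal to [w], so the scalar product with [w] forces [s = 1], where the point is
   [q] itself. *)
have far w1 w2 s : 0 < w1 ^+ 2 + w2 ^+ 2 -> w1 * b = w2 * a ->
    (1 - s) * w1 - s * (e * (sg * b)) = 0 -> (1 - s) * w2 + s * (e * (sg * a)) = 0 -> False.
  move=> w0 wab h1 h2.
  have h3 : (1 - s) * (w1 ^+ 2 + w2 ^+ 2) = 0.
    have -> : (1 - s) * (w1 ^+ 2 + w2 ^+ 2) =
      w1 * ((1 - s) * w1 - s * (e * (sg * b))) +
      w2 * ((1 - s) * w2 + s * (e * (sg * a))) + s * e * sg * (w1 * b - w2 * a) by ring.
    by rewrite h1 h2 wab; ring.
  have s1 : s = 1.
    by move/eqP: h3; rewrite mulf_eq0 (gt_eqF w0) orbF => /eqP; lra.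
  move: h1 h2; rewrite s1 => h1 h2.
  have : e ^+ 2 * (a ^+ 2 + b ^+ 2) = 0.
    have -> : e ^+ 2 * (a ^+ 2 + b ^+ 2) = (e * (sg * b)) ^+ 2 + (e * (sg * a)) ^+ 2.
      by rewrite !exprMn sg1; ring.
    have -> : e * (sg * b) = 0 by lra.
    have -> : e * (sg * a) = 0 by lra.
    ring.
  by apply/eqP; rewrite mulf_neq0 ?gt_eqF // exprn_gt0.
have par : a' * b = b' * a.
  have [t0|t0] := eqVneq t 0.
    have : a = 0 /\ b = 0 by move: e1 e2; rewrite t0; lra.
    by move=> [? ?]; nra.
  apply: (mulfI t0); rewrite !mulrA.
  have -> : t * a' = - ((1 - t) * a) by lra.
  have -> : t * b' = - ((1 - t) * b) by lra.
  ring.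
have Vgq : V (g q) by exact: gV.
have kq : Some (g q) <> k.
  rewrite kl => -[E]; have : q = L by rewrite -(fg _ hq) E.
  rewrite /q [L in _ = L]surjective_pairing => -[q1 q2].
  by apply: (far a b 1) => //; [exact: mulrC | lra | lra].
have [b1 pb1] : exists a, pth [set z | V z /\ Some z <> k] x (g q) a.
  apply: (disc_line ch) => // l' s; rewrite kl => -[<-] _ _.
  rewrite fg // -/X -/L /lerp [L in _ = L]surjective_pairing /q /= => -[q1 q2].
  apply: (far a b s) => //; [exact: mulrC | rewrite /a; lra | rewrite /b; lra].
have [b2 pb2] : exists a, pth [set z | V z /\ Some z <> k] y (g q) a.
  apply: (disc_line ch) => // l' s; rewrite kl => -[<-] _ _.
  rewrite fg // -/Y -/L /lerp [L in _ = L]surjective_pairing /q /= => -[q1 q2].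
  apply: (far a' b' s) => //; [rewrite /a'; lra | rewrite /b'; lra].
by exists (Cconcat b1 (Creverse b2)); exact: pth_cat pb1 (pth_rev pb2).
Qed.

Lemma disc_points V : disc V ->
  exists2 f : nat -> M, injective f & forall i, V (f i).
Proof.
move=> [f [g [c [r [r0 Hc [oV _ cf cg [fV gV gf fg]]]]]]].
have h2 i : 0 < (i.+2%:R : R) by rewrite ltr0n.
have hb i : hbox c r (c.1 + r / i.+2%:R, c.2).
  split=> //=; rewrite ?subrr ?normr0 //.
  rewrite (_ : c.1 + r / i.+2%:R - c.1 = r / i.+2%:R); last by ring.
  rewrite gtr0_norm ?divr_gt0 // ltr_pdivrMr // ltr_pMr // ltr1n //.
exists (fun i => g (c.1 + r / i.+2%:R, c.2)) => [i j e|i]; last exact: gV.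
have : (c.1 + r / i.+2%:R, c.2) = (c.1 + r / j.+2%:R, c.2).
  by rewrite -(fg _ (hb i)) e fg.
move=> [] /addrI /(mulfI (lt0r_neq0 r0)) /invr_inj /eqP.
by rewrite eqr_nat => /eqP [].
Qed.

Definition avoiding n (z : 'I_n -> M) (L : pred 'I_n) : set M :=
  [set x | forall j, L j -> z j <> x].

(** The open-closed argument runs on [M] itself, removed points included: [O] gathers the points
    near which every allowed point is reachable. A removed point does not disconnect its disc, by
    [disc_connected]. *)
Lemma avoiding_path n (z : 'I_n -> M) (L : pred 'I_n) a b :
  surface_with_boundary M -> connected [set: M] ->
  avoiding z L a -> avoiding z L b -> exists c, pth (avoiding z L) a b c.
Proof.
move=> sM cM Ca Cb; set C := avoiding z L in Ca Cb *.
pose reach x := exists c, pth C a x c.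
have isolated x : exists2 W, open W /\ W x & forall y, W y -> y <> x -> C y.
  have h j : nbhs x [set y | z j <> x -> z j <> y].
    have [e|ne] := pselect (z j = x); first by apply: filterE => y.
    have cl : closed [set z j].
      exact: accessible_closed_set1 (hausdorff_accessible sM.1) _.
    have : nbhs x (~` [set z j]).
      by apply: open_nbhs_nbhs; split; [exact: closed_openC | move=> e; exact: ne].
    by apply: filterS => y ny _ e; apply: ny.
  have := nbhs_forall h; rewrite nbhsE => -[W [oW Wx] sW].
  exists W => // y Wy yx j Lj e.
  have [ex|nx] := pselect (z j = x); first by apply: yx; rewrite -e.
  exact: (sW y Wy j nx).
have local x : exists2 V, disc V /\ V x & (forall y, V y -> y <> x -> C y) /\
    forall y y', V y -> V y' -> C y -> C y' -> reach y -> reach y'.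
  have [W [oW Wx] hW] := isolated x.
  have [V dV [Vx VW]] := disc_nbhs sM oW Wx; exists V => //.
  split=> [y /VW/hW //|y y' Vy Vy' Cy Cy' [c pc]].
  have [Cx|nCx] := pselect (C x).
    have [//|//|b' [c1 c2 c3 c4]] := @disc_connected V None y y' dV Vy Vy'.
    exists (Cconcat c b'); apply: (pth_cat pc); split=> // t.
    have [Vt _] := c2 t; have [->//|nt] := pselect (b' t = x).
    exact: hW (VW _ Vt) nt.
  have [||b' [c1 c2 c3 c4]] := @disc_connected V (Some x) y y' dV Vy Vy'.
  - by move=> [e]; apply: nCx; rewrite -e.
  - by move=> [e]; apply: nCx; rewrite -e.
  exists (Cconcat c b'); apply: (pth_cat pc); split=> // t.
  have [Vt nt] := c2 t; apply: hW (VW _ Vt) _.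
  by move=> e; apply: nt; rewrite e.
(* There are no isolated points. This is used for closedness of [O], when the point [w] of [O] found
   near [x] is [x] itself. *)
have other W x : open W -> W x -> exists2 y, W y & y <> x.
  move=> oW Wx; have [V dV [Vx VW]] := disc_nbhs sM oW Wx.
  have [f fi fV] := disc_points dV.
  have [e|ne] := pselect (f 0%N = x); last by exists (f 0%N) => //; exact: VW.
  by exists (f 1%N); [exact: VW | rewrite -e => /fi].
pose O := [set x | exists N, [/\ open N, N x & forall y, N y -> C y -> reach y]].
have oO : open O.
  rewrite openE => x [N [oN Nx hN]].
  have : nbhs x N by apply: open_nbhs_nbhs.
  by apply: filterS => y Ny; exists N.
have cO : closed O.
  rewrite -openC openE => x nOx.
  have [V [dV Vx] [h1 h2]] := local x.
  have : nbhs x V by apply: open_nbhs_nbhs; split=> //; exact: disc_open.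
  apply: filterS => w Vw [N [oN Nw hN]]; apply: nOx.
  have oNV : open (N `&` V) by apply: openI => //; exact: disc_open.
  have [p [Np Vp] px] : exists2 p, (N `&` V) p & p <> x.
    have [e|nwx] := pselect (w = x); last by exists w.
    by subst w; exact: (other _ _ oNV (conj Nw Vw)).
  have Cp := h1 p Vp px.
  exists V; split=> //; first exact: disc_open.
  by move=> y Vy Cy; exact: (h2 p y Vp Vy Cp Cy (hN p Np Cp)).
have Oa : O a.
  have [V [dV Va] [h1 h2]] := local a; exists V; split=> //; first exact: disc_open.
  move=> y Vy Cy; apply: (h2 a y) => //; exists (Cconst a); exact: pth_cst.
have OT : O = setT.
  apply: cM; [by exists a | by exists O; rewrite ?setTI | by exists O; rewrite ?setTI].
have [N [_ Nb hN]] : O b by rewrite OT.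
exact: hN.
Qed.

(** Restricting injectivity to [L] lets some labels be moved with no regard to the others, as when
    the anchors of satellites are carried before the satellites are placed. *)
Definition inj_on n (L : pred 'I_n) : set (Mpow n M) :=
  [set z | forall i j, L i -> L j -> z i = z j -> i = j].

Definition upd n (z : Mpow n M) (i : 'I_n) (x : M) : Mpow n M :=
  fun j => if j == i then x else z j.

Lemma upd_continuous (T : topologicalType) n (z : Mpow n M) i (f : T -> M) :
  continuous f -> continuous (fun t => upd z i (f t)).
Proof.
by move=> cf; apply: cont_Mpow => j; rewrite /upd; case: (j == i); cont.
Qed.

Lemma move_one n (L : pred 'I_n) (z : Mpow n M) i x :
  surface_with_boundary M -> connected [set: M] -> inj_on L z ->
  (L i -> forall j, L j -> j != i -> z j <> x) ->
  exists c, pth (inj_on L) z (upd z i x) c.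
Proof.
move=> sM cM iz hx.
pose L' : pred 'I_n := fun j => [&& L i, L j & j != i].
have [||c [cc Cc c0 c1]] := @avoiding_path n z L' (z i) x sM cM.
- by move=> j /and3P[Li Lj ji] /iz e; move: ji; rewrite e ?eqxx.
- by move=> j /and3P[Li Lj ji]; exact: hx.
exists (fun t => upd z i (c t)); split.
- exact: upd_continuous.
- move=> t j k; rewrite /upd; case: eqP => [->|/eqP ji]; case: eqP => [->|/eqP ki] // Lj Lk e.
  + by case: (Cc t k) => //; apply/and3P.
  + by case: (Cc t j) => //; apply/and3P.
  + exact: iz.
- by apply/funext => j; rewrite /upd c0; case: eqP => [->|].
- by rewrite c1.
Qed.

(** Both configurations are moved, one label at a time, to a third one [w] whose points are distinct
    from all points of [z] and [z']; no intermediate configuration then has a collision. *)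
Lemma configurations_connected n (L : pred 'I_n) (z z' : Mpow n M) :
  surface_with_boundary M -> connected [set: M] -> inj_on L z -> inj_on L z' ->
  exists c, pth (inj_on L) z z' c.
Proof.
move=> sM cM iz iz'.
case: n L z z' iz iz' => [|n] L z z' iz iz'.
  have -> : z' = z by apply/funext => -[].
  by exists (Cconst z); exact: pth_cst.
have [V dV _] := disc_nbhs sM openT (I : [set: M] (z ord0)).
have [f fi _] := disc_points dV.
have bound (x : M) : exists N : nat, forall i, (N <= i)%N -> f i <> x.
  have [[k e]|h] := pselect (exists k, f k = x).
    by exists k.+1 => i ki ei; move: ki; rewrite (fi i k) ?ltnn // ei e.
  by exists 0%N => i _ e; apply: h; exists i.
have [Nz hz] := choice (fun j => bound (z j)).
have [Nz' hz'] := choice (fun j => bound (z' j)).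
pose N := (\max_j Nz j + \max_j Nz' j)%N.
pose w : Mpow n.+1 M := fun i => f (N + i)%N.
have fresh i j : w i <> z j.
  apply: hz; apply: leq_trans (leq_addr _ _); apply: leq_trans (leq_addr _ _).
  exact: leq_bigmax.
have fresh' i j : w i <> z' j.
  apply: hz'; apply: leq_trans (leq_addr _ _); apply: leq_trans (leq_addl _ _).
  exact: leq_bigmax.
have winj i j : w i = w j -> i = j by move=> /fi /addnI /ord_inj.
have reach (y : Mpow n.+1 M) : inj_on L y -> (forall i j, w i <> y j) ->
    exists c, pth (inj_on L) y w c.
  move=> iy wy.
  pose mix k : Mpow n.+1 M := fun j => if (j < k)%N then w j else y j.
  have imix k : inj_on L (mix k).
    move=> i j Li Lj; rewrite /mix; case: ifP => _; case: ifP => _ e.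
    - exact: winj.
    - by case: (wy i j).
    - by case: (wy j i).
    - exact: iy.
  have step k : (k <= n.+1)%N -> exists c, pth (inj_on L) y (mix k) c.
    elim: k => [_|k IH kn].
      by exists (Cconst y); apply: pth_cst.
    have [c pc] := IH (ltnW kn); pose i := Ordinal kn.
    have [|d pd] := @move_one n.+1 L (mix k) i (w i) sM cM (imix k).
      move=> _ j _ ji; rewrite /mix; case: ifP => _; last by move=> e; case: (wy i j).
      by move=> /winj e; rewrite e eqxx in ji.
    exists (Cconcat c d); apply: (pth_cat pc).
    rewrite (_ : mix k.+1 = upd (mix k) i (w i)) //.
    apply/funext => j; rewrite /mix /upd ltnS leq_eqVlt.
    have -> : (j == i) = (j == k :> nat) by [].
    by case: eqP => [e|//]; congr w; exact: ord_inj.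
  have [c pc] := step n.+1 (leqnn _).
  by exists c; rewrite (_ : w = mix n.+1) //; apply/funext => j; rewrite /mix ltn_ord.
have [c pc] := reach z iz fresh; have [d pd] := reach z' iz' fresh'.
by exists (Cconcat c (Creverse d)); exact: pth_cat pc (pth_rev pd).
Qed.

End Connectivity.

(** * The plane as a connected surface *)

Lemma surface_plane : surface_with_boundary R2.
Proof.
split.
  move=> v w cl.
  have h1 : v.1 = w.1.
    apply: (@Rhausdorff R) => A B nA nB.
    have [||u [Au Bu]] := cl (fst @^-1` A) (fst @^-1` B).
    - exact: (@continuous_fst R R v A nA).
    - exact: (@continuous_fst R R w B nB).
    by exists u.1.
  have h2 : v.2 = w.2.
    apply: (@Rhausdorff R) => A B nA nB.
    have [||u [Au Bu]] := cl (snd @^-1` A) (snd @^-1` B).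
    - exact: (@continuous_snd R R v A nA).
    - exact: (@continuous_snd R R w B nB).
    by exists u.2.
  by rewrite [v]surjective_pairing h1 h2 -surjective_pairing.
move=> x.
(* A horizontal strip about [x] is translated to the heights between 1 and 3, inside the
   half-plane. *)
exists [set v : R2 | `|v.2 - x.2| < 1], [set v : R2 | `|v.2 - 2| < 1],
  (fun v => (v.1, v.2 - x.2 + 2)).
have op (c : R) : open [set v : R2 | `|v.2 - c| < 1] by apply: open_sublevel; cont.
split.
- exact: op.
- by rewrite /= subrr normr0.
- by move=> v; rewrite /halfplane /= ltr_norml => /andP[]; lra.
- by exists [set v : R2 | `|v.2 - 2| < 1]; split=> //; exact: op.
exists (fun v => (v.1, v.2 - 2 + x.2)); split.
- by apply: continuous_subspaceT; cont.
- by apply: continuous_subspaceT; cont.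
- by move=> v /=; rewrite addrK.
- by move=> v /=; rewrite addrK.
- by split=> v _; rewrite [RHS]surjective_pairing /=; congr pair; lra.
Qed.

Lemma connected_plane : connected [set: R2].
Proof.
have -> : [set: R2] = \bigcup_(v in [set: R2])
    ((fun t : R => (t * v.1, t * v.2)) @` `[0, 1]%classic).
  rewrite predeqE => v; split=> // _; exists v => //; exists 1.
    by rewrite /= in_itv /= lexx ler01.
  by rewrite !mul1r -surjective_pairing.
apply: bigcup_connected.
  exists (0, 0) => v _; exists 0; first by rewrite /= in_itv /= lexx ler01.
  by rewrite !mul0r.
move=> v _; apply: connected_continuous_connected.
  exact: segment_connected.
by apply: continuous_subspaceT; cont.
Qed.

(** * Doubling a strand *)

Definition box (c : R2) (r : R) : set R2 :=
  [set v | `|v.1 - c.1| < r /\ `|v.2 - c.2| < r].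

Lemma box_open c r : open (box c r).
Proof.
rewrite (_ : box c r = [set v : R2 | `|v.1 - c.1| < r] `&`
  [set v : R2 | `|v.2 - c.2| < r]) //.
by apply: openI; apply: open_sublevel; cont.
Qed.

Lemma box_center c r : 0 < r -> box c r c.
Proof. by move=> r0; split; rewrite subrr normr0. Qed.

Lemma box_convex c r v w t : box c r v -> box c r w -> 0 <= t <= 1 ->
  box c r (lerp t v w).
Proof.
move=> [v1 v2] [w1 w2] t01; split=> /=.
- have -> : (1 - t) * v.1 + t * w.1 - c.1 =
    (1 - t) * (v.1 - c.1) + t * (w.1 - c.1) by ring.
  exact: norm_convex.
- have -> : (1 - t) * v.2 + t * w.2 - c.2 =
    (1 - t) * (v.2 - c.2) + t * (w.2 - c.2) by ring.
  exact: norm_convex.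
Qed.

Lemma box_nbhs u (W : set R2) : nbhs u W -> exists2 r, 0 < r & box u r `<=` W.
Proof.
move=> /nbhs_ballP [r /= r0 hr]; exists r => // v [h1 h2].
by apply: hr; split; rewrite /ball /= distrC.
Qed.

Lemma cont_lerp (T : topologicalType) (t : T -> R) (v w : T -> R2) :
  continuous t -> continuous v -> continuous w ->
  continuous (fun x => lerp (t x) (v x) (w x)).
Proof. by move=> ct cv cw; rewrite /lerp; cont. Qed.

Lemma hpt_convex (X : topologicalType) (A : set X) (B : set R2) (H : R2 -> X)
    (p q : R -> R2) :
  (forall v w t, B v -> B w -> 0 <= t <= 1 -> B (lerp t v w)) ->
  continuous H -> (forall v, B v -> A (H v)) ->
  continuous p -> continuous q -> (forall t, B (p t)) -> (forall t, B (q t)) ->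
  p 0 = q 0 -> p 1 = q 1 -> hpt A (H \o p) (H \o q).
Proof.
move=> cvx cH AH cp cq Bp Bq e0 e1.
have ccl := clamp_continuous.
have lvv t v : lerp t v v = v.
  by rewrite /lerp [RHS]surjective_pairing; congr pair; ring.
exists (fun u => H (lerp (clamp u.2) (p u.1) (q u.1))); split=> /= [|u|s|s|t].
- by apply: cont_comp => //; apply: cont_lerp; cont.
- by apply: AH; apply: cvx => //; exact: clamp01.
- by rewrite clamp0 lerp0.
- by rewrite clamp1 lerp1.
- by rewrite e0 e1 !lvv.
Qed.

Section Doubling.
Context {n : nat} {M : topologicalType}.
Hypothesis sM : surface_with_boundary M.
Variables (i1 i2 i3 : 'I_n).
Hypotheses (i12 : i1 != i2) (i13 : i1 != i3).
Variable K : R2 -> Mpow n M.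
Hypotheses (cK : continuous K) (FK : forall u, Fconf n M (K u)).
Local Notation F := (Fconf n M).
Implicit Types (V W : set M) (y : M * M) (u : R2).

(** A doubled configuration over [u]: labels [i1] and [i3] occupy the two close points [y], and [i2]
    stands at the point [K u m]. With [m = i2] strand [i3] of [K] is forgotten, with [m = i3] strand
    [i2] is; [zz] records both, so that the same motion of [y] is seen by the two. *)
Definition twocfg (m : 'I_n) (u : R2) (y : M * M) : Mpow n M :=
  fun j => if j == i1 then y.1 else if j == i3 then y.2
           else K u (if j == i2 then m else j).

Definition clear (V : set M) u := forall m, m != i1 -> ~ V (K u m).

Definition FF : set (Mpow n M * Mpow n M) := [set x | F x.1 /\ F x.2].

Definition zz u y : Mpow n M * Mpow n M := (twocfg i2 u y, twocfg i3 u y).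

Lemma twocfg_continuous (T : topologicalType) m (u : T -> R2) (y : T -> M * M) :
  continuous u -> continuous y -> continuous (fun t => twocfg m (u t) (y t)).
Proof.
move=> cu cy; apply: cont_Mpow => j; rewrite /twocfg.
case: (j == i1); first by cont.
case: (j == i3); first by cont.
by apply: (@cont_proj _ _ _ (fun t => K (u t))); cont.
Qed.

Lemma zz_continuous (T : topologicalType) (u : T -> R2) (y : T -> M * M) :
  continuous u -> continuous y -> continuous (fun t => zz (u t) (y t)).
Proof. by move=> cu cy; apply: cont_pair; exact: twocfg_continuous. Qed.

Lemma zz_FF V u y : clear V u -> P2 V y -> FF (zz u y).
Proof.
move=> cl [y1 y2 y12].
have ne m x : V x -> m != i1 -> x <> K u m by move=> Vx mi e; apply: (cl m mi); rewrite -e.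
have main m : m \in [:: i2; i3] -> F (twocfg m u y).
  move=> hm; have mi1 : m != i1.
    by move: hm; rewrite !inE => /orP[] /eqP ->; rewrite eq_sym.
  pose g j := if j == i2 then m else j.
  have gi1 j : j != i1 -> j != i3 -> g j != i1.
    by move=> h1 h2; rewrite /g; case: ifP.
  have ginj j j' : j != i3 -> j' != i3 -> g j = g j' -> j = j'.
    move=> h1 h2; rewrite /g; case: eqP => [->|/eqP n1]; case: eqP => [->|/eqP n2] // e.
    - by move: hm; rewrite !inE e (negbTE n2) (negbTE h2).
    - by move: hm; rewrite !inE -e (negbTE n1) (negbTE h1).
  move=> j j'; rewrite /twocfg -/(g j) -/(g j').
  case: (eqVneq j i1) => [->|a1]; case: (eqVneq j' i1) => [->|b1] //.
  - by case: (eqVneq j' i3) => [->|b3] e; [case: y12 | case: (ne (g j') y.1 y1 (gi1 _ b1 b3))].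
  - by case: (eqVneq j i3) => [->|a3] e; [case: y12 | case: (ne (g j) y.1 y1 (gi1 _ a1 a3))].
  - case: (eqVneq j i3) => [->|a3]; case: (eqVneq j' i3) => [->|b3] // e.
    + by case: (ne (g j') y.2 y2 (gi1 _ b1 b3)).
    + by case: (ne (g j) y.2 y2 (gi1 _ a1 a3)).
    + by apply: ginj => //; exact: FK e.
by split; apply: main; rewrite !inE eqxx ?orbT.
Qed.

(** Two kinds of arrows: [loc] moves the close pair over a fixed parameter, [hor] moves the
    parameter along a segment with the pair held fixed. They commute by [hor_loc]. *)
Definition loc u (d : R -> M * M) := cls FF (fun t => zz u (d t)).

Definition hor u u' y := cls FF (fun t => zz (lerp (clamp t) u u') y).

Lemma loc_pth V u y y' d : clear V u -> pth (P2 V) y y' d ->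
  pth FF (zz u y) (zz u y') (fun t => zz u (d t)).
Proof.
move=> cl [cd Pd <- <-]; split=> //; last by move=> t; exact: zz_FF cl (Pd t).
by apply: zz_continuous => //; cont.
Qed.

Lemma loc_hpt V u d d' : clear V u -> hpt (P2 V) d d' -> loc u d = loc u d'.
Proof.
move=> cl h; apply: cls_eq.
apply: (@hpt_comp _ _ (P2 V) FF (zz u)) => //; last by move=> y; exact: zz_FF.
by apply: zz_continuous; cont.
Qed.

Lemma loc_cat V u y y' y'' d d' : clear V u -> pth (P2 V) y y' d ->
  pth (P2 V) y' y'' d' -> loc u (Cconcat d d') = cmul FF (loc u d) (loc u d').
Proof.
move=> cl pd pd'; rewrite /loc (cmul_cls (loc_pth cl pd) (loc_pth cl pd')).
by congr cls; exact: (comp_cat (zz u)).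
Qed.

Lemma loc_arr V u y y' d : clear V u -> pth (P2 V) y y' d ->
  arr FF (zz u y) (zz u y') (loc u d).
Proof. by move=> cl pd; apply: arr_cls; exact: loc_pth cl pd. Qed.

Lemma loc_rev V u y y' d : clear V u -> pth (P2 V) y y' d ->
  loc u (Creverse d) = cinv FF (loc u d).
Proof. by move=> cl pd; rewrite /loc (cinv_cls (loc_pth cl pd)). Qed.

Lemma clearS V V' u : V' `<=` V -> clear V u -> clear V' u.
Proof. by move=> s cl m /cl nV /s. Qed.

Lemma pthS V V' y y' d : V' `<=` V -> pth (P2 V') y y' d -> pth (P2 V) y y' d.
Proof.
move=> s [h1 h2 h3 h4]; split=> // t; have [k1 k2 k3] := h2 t.
by split=> //; exact: s.
Qed.

Lemma P2S V V' y : V' `<=` V -> P2 V' y -> P2 V y.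
Proof. by move=> s [h1 h2 h3]; split=> //; exact: s. Qed.

Lemma P2_nonempty V : disc V -> exists y, P2 V y.
Proof.
move=> /disc_points [f fi fV]; exists (f 0%N, f 1%N); split=> //=.
by move/fi.
Qed.

(* A link joins two pairs near [K u i1] lying in discs [V] and [V'], passing
   through an arbitrarily small common disc around [K u i1]. *)
Definition link u V y V' y' l :=
  exists V'' y'' d d', [/\ disc V'', V'' (K u i1) & V'' `<=` V `&` V'] /\
    [/\ P2 V'' y'', pth (P2 V) y y'' d, pth (P2 V') y'' y' d'
      & l = cmul FF (loc u d) (loc u d')].

Definition good V u := [/\ disc V, V (K u i1) & clear V u].

Lemma link_arr u V y V' y' l : good V u -> good V' u -> link u V y V' y' l ->
  arr FF (zz u y) (zz u y') l.
Proof.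
move=> [_ _ c1] [_ _ c2] [V'' [y'' [d [d' [_ [_ pd pd' ->]]]]]].
by apply: arr_mul; [exact: loc_arr c1 pd | exact: loc_arr c2 pd'].
Qed.

Lemma link_ex u V y V' y' : good V u -> good V' u -> P2 V y -> P2 V' y' ->
  exists l, link u V y V' y' l.
Proof.
move=> [dV Vk cl] [dV' Vk' cl'] Py Py'.
have oVV : open (V `&` V') by apply: openI; exact: disc_open.
have [V'' dV'' [kV'' sV'']] := disc_nbhs sM oVV (conj Vk Vk').
have [y'' Py''] := P2_nonempty dV''.
have s1 : V'' `<=` V by move=> x /sV'' [].
have s2 : V'' `<=` V' by move=> x /sV'' [].
have [d pd] := disc_pairs_connected dV Py (P2S s1 Py'').
have [d' pd'] := disc_pairs_connected dV' (P2S s2 Py'') Py'.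
by exists (cmul FF (loc u d) (loc u d')), V'', y'', d, d'.
Qed.

Lemma link_inv u V y V' y' l : good V u -> good V' u -> link u V y V' y' l ->
  link u V' y' V y (cinv FF l).
Proof.
move=> [_ _ c1] [_ _ c2] [V'' [y'' [d [d' [[h1 h2 h3] [h4 pd pd' ->]]]]]].
exists V'', y'', (Creverse d'), (Creverse d); split.
  by split=> // x /h3 [].
split=> //; [exact: pth_rev | exact: pth_rev |].
rewrite (loc_rev c1 pd) (loc_rev c2 pd').
have a1 := loc_arr c1 pd; have a2 := loc_arr c2 pd'.
have a12 := arr_mul a1 a2.
have := cmulKr a12 (arr_mul (arr_inv a2) (arr_inv a1)).
rewrite -[X in cmul FF _ X = _]cmulA (cmulVKr a2 (arr_inv a1)) (cmulrV a1).
by rewrite (cmulr1 (arr_inv a12)).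
Qed.

(** The middle part of the composite runs in [V'], which neither [V] nor [V3] need contain.
    [disc_pairs_shrink] deforms it into a disc [W] inside all three. *)
Lemma link_comp u V y V' y' V3 y3 l l' : good V u -> good V' u -> good V3 u ->
  link u V y V' y' l -> link u V' y' V3 y3 l' -> link u V y V3 y3 (cmul FF l l').
Proof.
move=> [dV Vk cl] [dV' Vk' cl'] [dV3 Vk3 cl3].
move=> [V1 [y1 [d1 [d1' [[dV1 V1k s1] [Py1 p1 p1' ->]]]]]].
move=> [V2 [y2 [d2 [d2' [[dV2 V2k s2] [Py2 p2 p2' ->]]]]]].
have o12 : open (V1 `&` V2) by apply: openI; exact: disc_open.
have [W dW [Wk WV' W12 shrink]] := disc_pairs_shrink dV' Vk' o12 (conj V1k V2k).
have [yw Pw] := P2_nonempty dW.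
have W1 : W `<=` V1 by move=> x /W12 [].
have W2 : W `<=` V2 by move=> x /W12 [].
have V1V : V1 `<=` V by move=> x /s1 [].
have V1V' : V1 `<=` V' by move=> x /s1 [].
have V2V' : V2 `<=` V' by move=> x /s2 [].
have V2V3 : V2 `<=` V3 by move=> x /s2 [].
have [e1 pe1] := disc_pairs_connected dV1 Py1 (P2S W1 Pw).
have [e2 pe2] := disc_pairs_connected dV2 (P2S W2 Pw) Py2.
have q1 := pthS V1V' pe1; have q2 := pthS V2V' pe2.
have pm := pth_cat p1' p2.
have pl := pth_cat (pth_cat (pth_rev q1) pm) (pth_rev q2).
have [lam plam hlam] := shrink _ _ _ Pw Pw pl.
have WV : W `<=` V by move=> x /W1 /V1V.
exists W, yw, (Cconcat (Cconcat d1 e1) lam), (Cconcat e2 d2'); split.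
  by split=> // x Wx; split; [exact: WV | exact: V2V3 (W2 _ Wx)].
have pd1e1 := pth_cat p1 (pthS V1V pe1).
have plV := pthS WV plam.
split=> //; [exact: pth_cat pd1e1 plV | exact: pth_cat (pthS V2V3 pe2) p2' |].
rewrite (loc_cat cl pd1e1 plV) (loc_cat cl p1 (pthS V1V pe1)).
rewrite (loc_cat cl3 (pthS V2V3 pe2) p2').
rewrite -(loc_hpt cl' hlam) (loc_cat cl' (pth_cat (pth_rev q1) pm) (pth_rev q2)).
rewrite (loc_cat cl' (pth_rev q1) pm) (loc_cat cl' p1' p2).
rewrite (loc_rev cl' q1) (loc_rev cl' q2).
have a1' := loc_arr cl' p1'; have a2 := loc_arr cl' p2.
have ae1 := loc_arr cl' q1; have ae2 := loc_arr cl' q2.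
have am := arr_mul a1' a2.
have a2' := loc_arr cl3 p2'.
rewrite -!cmulA (cmulKr ae2 a2') (cmulVKr ae1 (arr_mul a1' (arr_mul a2 a2'))).
by [].
Qed.

Lemma link_monoR u V y V' y' V3 l : V' `<=` V3 -> link u V y V' y' l ->
  link u V y V3 y' l.
Proof.
move=> s [V'' [y'' [d [d' [[h1 h2 h3] [h4 pd pd' ->]]]]]].
exists V'', y'', d, d'; split; first by split=> // x /h3 [? /s].
by split=> //; exact: pthS s pd'.
Qed.

Lemma link_monoL u V y V' y' V3 l : V `<=` V3 -> link u V y V' y' l ->
  link u V3 y V' y' l.
Proof.
move=> s [V'' [y'' [d [d' [[h1 h2 h3] [h4 pd pd' ->]]]]]].
exists V'', y'', d, d'; split; first by split=> // x /h3 [/s].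
by split=> //; exact: pthS s pd.
Qed.

Lemma link_loc u V y y' d : good V u -> pth (P2 V) y y' d ->
  link u V y V y' (loc u d).
Proof.
move=> gV pd; have [dV Vk cl] := gV.
have Py : P2 V y by case: (pd) => _ h <- _.
have [l0 l] := link_ex gV gV Py Py.
have [V'' [y'' [d1 [d2 [h1 [h2 p1 p2 _]]]]]] := l.
exists V'', y'', d1, (Cconcat (Creverse d1) d); split=> //; split=> //.
  exact: pth_cat (pth_rev p1) pd.
rewrite (loc_cat cl (pth_rev p1) pd) (loc_rev cl p1).
by rewrite (cmulVKr (loc_arr cl p1) (loc_arr cl pd)).
Qed.

Lemma link_self u V y y' l : good V u -> link u V y V y' l ->
  exists2 d, pth (P2 V) y y' d & l = loc u d.
Proof.
move=> [dV Vk cl] [V'' [y'' [d1 [d2 [h1 [h2 p1 p2 ->]]]]]].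
exists (Cconcat d1 d2); first exact: pth_cat p1 p2.
by rewrite (loc_cat cl p1 p2).
Qed.

Lemma link_into u V V' y y' d : good V u -> good V' u -> V' `<=` V ->
  P2 V' y' -> pth (P2 V) y y' d -> link u V y V' y' (loc u d).
Proof.
move=> [dV Vk cl] [dV' Vk' cl'] s Py' pd.
exists V', y', d, (Cconst y'); split; first by split=> // x; split=> //; exact: s.
split=> //; first exact: pth_cst.
rewrite (_ : loc u (Cconst y') = cls FF (Cconst (zz u y'))) //.
by rewrite (cmulr1 (loc_arr cl pd)).
Qed.

Lemma hor_pth V u u' y : (forall t, 0 <= t <= 1 -> clear V (lerp t u u')) ->
  P2 V y -> pth FF (zz u y) (zz u' y) (fun t => zz (lerp (clamp t) u u') y).
Proof.
move=> cl Py; have ccl := clamp_continuous.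
split=> [|t||].
- by apply: zz_continuous; [apply: cont_lerp|]; cont.
- by apply: zz_FF Py; apply: cl; exact: clamp01.
- by rewrite clamp0 lerp0.
- by rewrite clamp1 lerp1.
Qed.

Lemma hor_loc V u u' y y' d : (forall t, 0 <= t <= 1 -> clear V (lerp t u u')) ->
  pth (P2 V) y y' d ->
  cmul FF (hor u u' y) (loc u' d) = cmul FF (loc u d) (hor u u' y').
Proof.
move=> cl pd; have [cd Pd d0 d1] := pd; have ccl := clamp_continuous.
have := @cls_square _ FF (fun v => zz (lerp (clamp v.1) u u') (d v.2)).
rewrite /= clamp0 clamp1 lerp0 lerp1 d0 d1; apply.
- by apply: zz_continuous; [apply: cont_lerp|]; cont.
- by move=> v; apply: zz_FF (Pd _); apply: cl; exact: clamp01.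
Qed.

Lemma hor_const u y : hor u u y = cls FF (Cconst (zz u y)).
Proof.
congr cls; apply/funext => t; rewrite /Cconst; congr zz.
by rewrite /lerp [RHS]surjective_pairing; congr pair; ring.
Qed.

Lemma hor_arr V c r u u' y : (forall v, box c r v -> good V v) ->
  box c r u -> box c r u' -> P2 V y -> arr FF (zz u y) (zz u' y) (hor u u' y).
Proof.
move=> gV bu bu' Py; apply: arr_cls; apply: (hor_pth (V := V)) => // t t01.
by have [] := gV _ (box_convex bu bu' t01).
Qed.

Lemma hor_trans V c r u u' u'' y : (forall v, box c r v -> good V v) ->
  box c r u -> box c r u' -> box c r u'' -> P2 V y ->
  cmul FF (hor u u' y) (hor u' u'' y) = hor u u'' y.
Proof.
move=> gV b b' b'' Py.
have clr v w : box c r v -> box c r w -> forall t, 0 <= t <= 1 -> clear V (lerp t v w).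
  by move=> bv bw t t01; have [] := gV _ (box_convex bv bw t01).
have p1 := hor_pth (clr _ _ b b') Py; have p2 := hor_pth (clr _ _ b' b'') Py.
rewrite /hor (cmul_cls p1 p2); apply: cls_eq.
have ccl := clamp_continuous.
pose seg (v w : R2) (t : R) := lerp (clamp t) v w.
have segp v w : box c r v -> box c r w -> pth (box c r) v w (seg v w).
  move=> bv bw; split=> [|t||]; rewrite /seg.
  - by apply: cont_lerp; cont.
  - by apply: box_convex => //; exact: clamp01.
  - by rewrite clamp0 lerp0.
  - by rewrite clamp1 lerp1.
have -> : Cconcat (fun t => zz (lerp (clamp t) u u') y)
    (fun t => zz (lerp (clamp t) u' u'') y) =
    (fun v => zz v y) \o Cconcat (seg u u') (seg u' u'') by rewrite comp_cat.
have [q1 q2 q3 q4] := pth_cat (segp _ _ b b') (segp _ _ b' b'').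
have [q5 q6 q7 q8] := segp _ _ b b''.
apply: (@hpt_convex _ FF (box c r) (fun v => zz v y)) => //.
- by move=> v w t; exact: box_convex.
- by apply: zz_continuous; cont.
- by move=> v /gV [_ _ cl]; exact: zz_FF cl Py.
- by rewrite q3 clamp0 lerp0.
- by rewrite q4 clamp1 lerp1.
Qed.

Lemma hor_inv V c r u u' y : (forall v, box c r v -> good V v) ->
  box c r u -> box c r u' -> P2 V y -> cinv FF (hor u u' y) = hor u' u y.
Proof.
move=> gV bu bu' Py.
have a1 := hor_arr gV bu bu' Py; have a2 := hor_arr gV bu' bu Py.
have := cmulKr a1 a2; rewrite (hor_trans gV) // hor_const.
by rewrite (cmulr1 (arr_inv a1)).
Qed.

(** * The local system of doubled configurations *)

Section States.
Variables (u0 : R2) (y0 : M * M).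

(** Over a cell a single disc is good for all parameters, so a pair in this disc can be held fixed
    while the parameter moves. *)
Definition cell := {C : set M * (R2 * R) | forall u, box C.2.1 C.2.2 u -> good C.1 u}.
Definition cV (C : cell) := (sval C).1.
Definition cO (C : cell) := box (sval C).2.1 (sval C).2.2.

(** A point of the fibre over [u] is a way, up to homotopy, of reaching from the base a doubled
    configuration over [u]. The good disc containing the pair is kept as data because links refer to
    it. *)
Definition state := {e : (R2 * set M) * ((M * M) * set (R -> Mpow n M * Mpow n M)) |
  [/\ good e.1.2 e.1.1, P2 e.1.2 e.2.1 & arr FF (zz u0 y0) (zz e.1.1 e.2.1) e.2.2]}.
Definition su (e : state) := (sval e).1.1.
Definition sV (e : state) := (sval e).1.2.
Definition sy (e : state) := (sval e).2.1.
Definition sp (e : state) := (sval e).2.2.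

(** Parallel transport in a cell: pass by a link to a pair in the disc of the cell, move the
    parameter straight, and link back. *)
Definition sheet (C : cell) (e e' : state) :=
  [/\ cO C (su e), cO C (su e') & exists y1 l l',
    [/\ P2 (cV C) y1, link (su e) (sV e) (sy e) (cV C) y1 l,
        link (su e') (cV C) y1 (sV e') (sy e') l' &
        sp e' = cmul FF (sp e) (cmul FF l (cmul FF (hor (su e) (su e') y1) l'))]].

Lemma cell_good C u : cO C u -> good (cV C) u.
Proof. by move=> h; exact: (svalP C). Qed.

Lemma state_good e : good (sV e) (su e). Proof. by case: (svalP e). Qed.
Lemma state_P2 e : P2 (sV e) (sy e). Proof. by case: (svalP e). Qed.
Lemma state_arr e : arr FF (zz u0 y0) (zz (su e) (sy e)) (sp e).
Proof. by case: (svalP e). Qed.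

Lemma cell_open C : open (cO C).
Proof. exact: box_open. Qed.

Lemma cell_cover u : exists C, cO C u.
Proof.
have [U sU hU] := @separate n M (K u) (fun=> setT) sM.1 (@FK u) (fun _ => conj openT I).
have [V dV [Vk VU]] := disc_nbhs sM (sU.1 i1) (hU i1).1.
have nV : nbhs u [set v | V (K v i1)].
  have ck : continuous (fun v => K v i1) by exact: cont_proj.
  by apply: (ck u); apply: open_nbhs_nbhs; split=> //; exact: disc_open.
have nU : nbhs u [set v | forall m, U m (K v m)].
  apply: nbhs_forall => m; have ck : continuous (fun v => K v m) by exact: cont_proj.
  by apply: (ck u); apply: open_nbhs_nbhs; split; [exact: sU.1 | exact: (hU m).1].
have : nbhs u ([set v | V (K v i1)] `&` [set v | forall m, U m (K v m)]) by exact: filterI.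
move=> /box_nbhs [r r0 hr].
have gC v : box u r v -> good V v.
  move=> /hr [h1 h2]; split=> // m mi Vm; move/eqP: mi; apply.
  exact: (sU.2 _ _ (K v m)) (h2 m) (VU _ Vm).
by exists (exist _ (V, (u, r)) gC); exact: box_center.
Qed.

Lemma sheet_sym C e e' : sheet C e e' -> sheet C e' e.
Proof.
move=> [Oe Oe' [y1 [l [l' [Py1 kl kl' ee]]]]]; split=> //.
have ge := state_good e; have ge' := state_good e'.
have gC := cell_good Oe; have gC' := cell_good Oe'.
have al := link_arr ge gC kl; have al' := link_arr gC' ge' kl'.
have ah := hor_arr (@cell_good C) Oe Oe' Py1.
have ae := state_arr e.
exists y1, (cinv FF l'), (cinv FF l); split=> //.
- exact: link_inv.
- exact: link_inv.
rewrite ee -(hor_inv (@cell_good C) Oe Oe' Py1).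
rewrite !cmulA (cmulrK (arr_mul (arr_mul ae al) ah) al').
by rewrite (cmulrK (arr_mul ae al) ah) (cmulrK ae al).
Qed.

Lemma sheet_trans C e' e e'' : sheet C e e' -> sheet C e' e'' -> sheet C e e''.
Proof.
move=> [Oe Oe' [y1 [l [l' [Py1 kl kl' ee]]]]] [_ Oe'' [y2 [m [m' [Py2 km km' ee']]]]].
split=> //.
have ge := state_good e; have ge' := state_good e'; have ge'' := state_good e''.
have gC := cell_good Oe; have gC' := cell_good Oe'; have gC'' := cell_good Oe''.
(* Leaving the disc of the cell for that of [e'] and coming back amounts to a path [d] inside the
   disc of the cell, which [hor_loc] slides to the parameter of [e]. *)
have [d pd ed] := link_self gC' (link_comp gC' ge' gC' kl' km).
exists y2, (cmul FF l (loc (su e) d)), m'; split=> //.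
  exact: (link_comp ge gC gC kl (link_loc gC pd)).
rewrite ee' ee -(hor_trans (@cell_good C) Oe Oe' Oe'' Py2).
have clr t : 0 <= t <= 1 -> clear (cV C) (lerp t (su e) (su e')).
  by move=> t01; have [] := cell_good (box_convex Oe Oe' t01 : cO C _).
rewrite -!cmulA (cmulA _ l') ed (cmulA _ (hor _ _ y1)) (hor_loc clr pd).
by rewrite -!cmulA.
Qed.

Lemma link_const u V y : good V u -> P2 V y ->
  link u V y V y (cls FF (Cconst (zz u y))).
Proof. by move=> gV Py; apply: (link_loc gV (pth_cst Py)). Qed.

Lemma sheet_lift C e u : cO C (su e) -> cO C u ->
  exists2 e', su e' = u & sheet C e e'.
Proof.
move=> Oe Ou; have gC := cell_good Oe; have gu := cell_good Ou.
have [y1 Py1] := P2_nonempty (let: And3 h _ _ := gC in h).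
have ge := state_good e.
have [l kl] := link_ex ge gC (state_P2 e) Py1.
have al := link_arr ge gC kl; have ah := hor_arr (@cell_good C) Oe Ou Py1.
have a := arr_mul (state_arr e) (arr_mul al ah).
exists (exist _ ((u, cV C), (y1, cmul FF (sp e) (cmul FF l (hor (su e) u y1))))
  (And3 gu Py1 a)) => //.
split=> //; exists y1, l, (cls FF (Cconst (zz u y1))); split=> //.
  exact: link_const.
by rewrite /sp /= (cmulr1 ah).
Qed.

Lemma sheet_sub C C' : (forall u, cO C' u -> cO C u) -> cV C' `<=` cV C ->
  forall e e', cO C' (su e) -> cO C' (su e') -> sheet C e e' <-> sheet C' e e'.
Proof.
move=> sO sVV e e' Oe Oe'.
have ge := state_good e; have ge' := state_good e'.
have gC := cell_good (sO _ Oe); have gC' := cell_good (sO _ Oe').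
have gD := cell_good Oe; have gD' := cell_good Oe'.
split=> -[_ _ [y1 [l [l' [Py1 kl kl' ee]]]]].
- split=> //.
  have [y2 Py2] := P2_nonempty (let: And3 h _ _ := gD in h).
  have [dC _ _] := gC.
  have [d pd] := disc_pairs_connected dC Py1 (P2S sVV Py2).
  have k1 := link_into gC gD sVV Py2 pd.
  have k2 := link_into gC' gD' sVV Py2 pd.
  exists y2, (cmul FF l (loc (su e) d)), (cmul FF (cinv FF (loc (su e') d)) l'); split=> //.
  + exact: (link_comp ge gC gD kl k1).
  + exact: (link_comp gD' gC' ge' (link_inv gC' gD' k2) kl').
  have clr t : 0 <= t <= 1 -> clear (cV C) (lerp t (su e) (su e')).
    by move=> t01; have [] := cell_good (box_convex (sO _ Oe) (sO _ Oe') t01 : cO C _).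
  rewrite ee -!cmulA (cmulA _ (loc _ d)) -(hor_loc clr pd) -!cmulA.
  have al' := link_arr gC' ge' kl'.
  have [_ _ cl'] := gC'.
  by rewrite (cmulVKr (loc_arr cl' pd) al').
- split; [exact: sO | exact: sO|].
  exists y1, l, l'; split=> //; first exact: P2S sVV Py1.
  + exact: link_monoR sVV kl.
  + exact: link_monoL sVV kl'.
Qed.

(** Both cells contain a smaller cell [D] about [u] whose disc lies in both discs; [sheet_sub]
    compares the sheets of each with those of [D]. *)
Lemma sheet_compat C C' u : cO C u -> cO C' u ->
  exists W : set R2, [/\ open W, W u &
    forall e e', W (su e) -> W (su e') -> sheet C e e' -> sheet C' e e'].
Proof.
move=> Ou Ou'.
have [dV Vk _] := cell_good Ou; have [dV' Vk' _] := cell_good Ou'.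
have oVV : open (cV C `&` cV C') by apply: openI; exact: disc_open.
have [V2 dV2 [V2k sV2]] := disc_nbhs sM oVV (conj Vk Vk').
have nV : nbhs u [set v | V2 (K v i1)].
  have ck : continuous (fun v => K v i1) by exact: cont_proj.
  by apply: (ck u); apply: open_nbhs_nbhs; split=> //; exact: disc_open.
have nO : nbhs u (cO C `&` cO C').
  by apply: open_nbhs_nbhs; split=> //; apply: openI; exact: cell_open.
have : nbhs u ((cO C `&` cO C') `&` [set v | V2 (K v i1)]) by exact: filterI.
move=> /box_nbhs [r r0 hr].
have s1 : V2 `<=` cV C by move=> x /sV2 [].
have s2 : V2 `<=` cV C' by move=> x /sV2 [].
have gD v : box u r v -> good V2 v.
  move=> /hr [[h1 h2] h3]; split=> //.
  by have [_ _ h] := cell_good h1; exact: clearS s1 h.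
pose D : cell := exist _ (V2, (u, r)) gD.
exists (box u r); split; [exact: box_open | exact: box_center |].
move=> e e' We We' h.
have b1 v : cO D v -> cO C v by move=> /hr [[]].
have b2 v : cO D v -> cO C' v by move=> /hr [[]].
have hD : sheet D e e' by apply/(@sheet_sub C D b1 s1).
by apply/(@sheet_sub C' D b2 s2).
Qed.

End States.

Lemma cls_segments (X : topologicalType) (A : set X) (G : R -> X) (t t' : R) :
  continuous G -> (forall s, A (G s)) ->
  cls A (fun s => G (t' * s)) =
  cmul A (cls A (fun s => G (t * s))) (cls A (fun s => G (t + (t' - t) * s))).
Proof.
move=> cG AG.
have p1 : pth A (G 0) (G t) (fun s => G (t * s)).
  by split=> //; rewrite ?mulr0 ?mulr1 //; cont.
have p2 : pth A (G t) (G t') (fun s => G (t + (t' - t) * s)).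
  split=> //; [by cont | by rewrite mulr0 addr0 | by congr G; ring].
rewrite (cmul_cls p1 p2); apply: cls_eq.
pose p (s : R) := if s <= 2^-1 then t * (2 * s) else t + (t' - t) * (2 * s - 1).
have -> : Cconcat (fun s => G (t * s)) (fun s => G (t + (t' - t) * s)) = G \o p.
  by apply/funext => s; rewrite /Cconcat /p /=; case: ifP.
apply: (@hpt_repar _ _ G (fun s => t' * s) p) => //.
- by cont.
- by apply: cont_if; [cont | cont | cont | move=> s ->; lra].
- by rewrite /p ifT; [rewrite !mulr0 | lra].
- by rewrite /p ifF; [ring | apply/negbTE; lra].
Qed.

(** Along [c1] and along [c2] the pair [y] can be held fixed, which gives two flat sections with the
    same start. By triviality over the square they end on one sheet, so their ends differ by a link
    from [V] to itself, which is a loop of pairs in [V]. *)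
Lemma doubling_paths V y (W : set R2) (c1 c2 : R -> R2) : open W ->
  (forall u, W u -> good V u) -> P2 V y -> continuous c1 -> continuous c2 ->
  (forall t, unit_square (c1 t) /\ W (c1 t)) ->
  (forall t, unit_square (c2 t) /\ W (c2 t)) ->
  c1 0 = c2 0 -> c1 1 = c2 1 ->
  exists2 lam, pth (P2 V) y y lam &
    cls FF (fun t => zz (c2 t) y) =
    cmul FF (cls FF (fun t => zz (c1 t) y)) (loc (c1 1) lam).
Proof.
move=> oW gW Py cc1 cc2 h1 h2 e0 e1.
pose u0 := c1 0.
have FFc (c : R -> R2) : (forall t, W (c t)) -> forall t : R, FF (zz (c t) y).
  by move=> Wc t; have [_ _ cl] := gW _ (Wc t); exact: zz_FF cl Py.
have valid (c : R -> R2) : continuous c -> (forall t, W (c t)) -> c 0 = u0 -> forall t : R,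
    [/\ good V (c t), P2 V y &
      arr FF (zz u0 y) (zz (c t) y) (cls FF (fun s => zz (c (t * s)) y))].
  move=> cc Wc c0 t; split=> //; first exact: gW.
  apply: arr_cls; split; [by apply: zz_continuous; cont | by move=> s; exact: FFc | |].
  - by rewrite mulr0 c0.
  - by rewrite mulr1.
pose fam c cc Wc c0 (t : R) : state u0 y :=
  exist _ ((c t, V), (y, cls FF (fun s => zz (c (t * s)) y))) (@valid c cc Wc c0 t).
have triv := @local_system_trivial (state u0 y) cell (@su u0 y) cO (@sheet u0 y)
  cell_open cell_cover (@sheet_sym u0 y) (fun C e' e e'' _ _ _ => @sheet_trans u0 y C e' e e'')
  (@sheet_lift u0 y) (@sheet_compat u0 y).
have flat c cc Wc c0 : flat_along (@su u0 y) cO (@sheet u0 y) c (@fam c cc Wc c0).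
  split=> // t C t01 Ot.
  have nW : nbhs (c t) W by apply: open_nbhs_nbhs.
  have [r r0 hr] := box_nbhs nW.
  have gC0 v : box (c t) r v -> good V v by move=> /hr; exact: gW.
  pose C0 : cell := exist _ (V, (c t, r)) gC0.
  have OC0 : cO C0 (c t) by exact: box_center.
  have [W' [oW' W't hW']] := @sheet_compat u0 y C0 C (c t) OC0 Ot.
  have : nbhs t (c @^-1` (box (c t) r `&` W')).
    by apply: cc; apply: open_nbhs_nbhs; split=> //; apply: openI => //; exact: box_open.
  move=> /nbhs_ballP [d /= d0 hd].
  have hd' s : t - d < s -> s < t + d -> box (c t) r (c s) /\ W' (c s).
    by move=> ? ?; apply: hd; rewrite /ball /= ltr_norml; apply/andP; split; lra.
  exists d => // t' t'01 l1 l2; apply: hW'; [exact: W't | by have [] := hd' t' l1 l2 |].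
  have Ot' : box (c t) r (c t') by have [] := hd' t' l1 l2.
  split=> //; exists y, (cls FF (Cconst (zz (c t) y))), (cls FF (Cconst (zz (c t') y))).
  split=> //.
  - exact: (link_const (gW _ (Wc t)) Py).
  - exact: (link_const (gW _ (Wc t')) Py).
  have ah : arr FF (zz (c t) y) (zz (c t') y) (hor (c t) (c t') y).
    exact: hor_arr gC0 OC0 Ot' Py.
  rewrite /su /sp /= (cmulr1 ah) (cmul1r ah).
  rewrite (@cls_segments _ FF (fun s => zz (c s) y) t t'); last first.
  - by move=> s; exact: FFc.
  - by apply: zz_continuous; cont.
  (* A short piece of [c] and the straight segment with the same ends lie in one box over which [V]
     is good, so convexity makes them homotopic. *)
  congr cmul; rewrite /hor; apply: cls_eq.
  have ccl := clamp_continuous.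
  apply: (@hpt_trans _ _ (fun s => zz (c (t + (t' - t) * clamp s)) y)).
    apply: (@hpt_repar _ FF (fun s => zz (c s) y) (fun s => t + (t' - t) * s)
      (fun s => t + (t' - t) * clamp s)).
    - by apply: zz_continuous; cont.
    - by move=> s; exact: FFc.
    - by cont.
    - by cont.
    - by rewrite clamp0.
    - by rewrite clamp1.
  apply: (@hpt_convex _ FF (box (c t) r) (fun v => zz v y)
    (fun s => c (t + (t' - t) * clamp s)) (fun s => lerp (clamp s) (c t) (c t'))).
  - by move=> v w s; exact: box_convex.
  - by apply: zz_continuous; cont.
  - by move=> v /gC0 [_ _ cl]; exact: zz_FF cl Py.
  - by cont.
  - by apply: cont_lerp; cont.
  - move=> s; have /andP[s0 s1] := clamp01 s.
    by have [] := hd' (t + (t' - t) * clamp s) ltac:(nra) ltac:(nra).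
  - by move=> s; apply: box_convex => //; exact: clamp01.
  - by rewrite clamp0 lerp0 mulr0 addr0.
  - by rewrite clamp1 lerp1; congr c; ring.
have W1 t : W (c1 t) by case: (h1 t).
have W2 t : W (c2 t) by case: (h2 t).
pose f1 := fam c1 cc1 W1 erefl; pose f2 := fam c2 cc2 W2 (esym e0).
have [|s fs gs] := triv (f1 0); first exact: (h1 0).1.
have fl1 := flat c1 cc1 W1 erefl; have fl2 := flat c2 cc2 W2 (esym e0).
have uniq := @flat_along_unique (state u0 y) cell (@su u0 y) cO (@sheet u0 y)
  cell_open cell_cover (@sheet_sym u0 y) (fun C e' e e'' _ _ _ => @sheet_trans u0 y C e' e e'')
  (@sheet_compat u0 y).
have fs1 := @flat_on_along _ _ (@su u0 y) cO (@sheet u0 y) _ s c1 cc1 fs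
  (fun t _ => (h1 t).1).
have fs2 := @flat_on_along _ _ (@su u0 y) cO (@sheet u0 y) _ s c2 cc2 fs
  (fun t _ => (h2 t).1).
have sg1 := uniq c1 _ _ cc1 fl1 fs1 gs.
have sg2 : same_germ (@su u0 y) cO (@sheet u0 y) (f2 1) ((s \o c2) 1).
  apply: (uniq c2 _ _ cc2 fl2 fs2).
  have -> : fam c2 cc2 W2 (esym e0) 0 = f1 0.
    apply: eq_exist; rewrite /= -e0; congr (_, (_, cls FF _)).
    by apply/funext => x; rewrite !mul0r e0.
  by rewrite /= -e0; exact: gs.
have [C OC] := cell_cover (c1 1).
have k1 := sg1.2 C OC.
have k2 : sheet C (f2 1) ((s \o c2) 1) by apply: sg2.2; rewrite /su /= -e1.
rewrite /= -e1 in k2.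
have [_ _ [y1 [l [l' [Py1 kl kl' ee]]]]] := sheet_trans k1 (sheet_sym k2).
have gC := cell_good OC; have gV : good V (c1 1) by exact: gW.
rewrite /su /sV /sy /= -e1 in kl kl'.
have [lam plam elam] := link_self gV (link_comp gV gC gV kl kl').
exists lam => //; rewrite -elam.
move: ee; rewrite /sp /su /= -e1 hor_const (cmul1r (link_arr gC gV kl')).
have q (c : R -> R2) : (fun s => zz (c (1 * s)) y) = (fun s => zz (c s) y).
  by apply/funext => x; rewrite mul1r.
by rewrite (q c1) (q c2).
Qed.

End Doubling.

(* Both halves of the doubled configuration space see the same local loop [lam]:
   the first one shows that it is trivial, and [eta] carries this to the second. *)
Lemma doubling n (M : topologicalType) (i1 i2 i3 : 'I_n) (z : Mpow n M)
    (f g eta : R -> M) (T W : set M) :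
  surface_with_boundary M -> i1 != i2 -> i1 != i3 -> i2 != i3 ->
  hpt (Fconf n M) (fun t => upd z i3 (f t)) (fun t => upd z i3 (g t)) ->
  continuous f -> continuous g -> f 0 = z i3 -> f 1 = z i3 ->
  open T -> open W -> (forall x, T x -> W x -> False) -> T (z i1) ->
  (forall j, j != i1 -> W (z j)) -> (forall t, W (f t)) -> (forall t, W (g t)) ->
  pth [set x | W x /\ forall j, j != i2 -> j != i3 -> z j <> x] (z i2) (z i3) eta ->
  exists2 V, disc V & V (z i1) /\ forall w, V w -> w <> z i1 ->
    hpt (Fconf n M) (fun t => upd (upd z i3 w) i2 (f t))
                    (fun t => upd (upd z i3 w) i2 (g t)).
Proof.
move=> sM i12 i13 i23 [K [cK FK K0 K1 Ke]] cf cg f0 f1 oT oW dTW Tz Wz Wf Wg peta.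
have upz : upd z i3 (z i3) = z.
  by apply/funext => j; rewrite /upd; case: eqP => [->|].
have Kl t : K (0, t) = z by rewrite (Ke t).1 f0 upz.
have Kr t : K (1, t) = z by rewrite (Ke t).2 f1 upz.
have [V dV [Vz VT]] := disc_nbhs sM oT Tz.
exists V => //; split=> // w Vw wz.
pose y := (z i1, w).
have Py : P2 V y by split=> //= e; apply: wz.
pose O := [set u | V (K u i1)] `&` [set u | forall m, m != i1 -> W (K u m)].
have ck m : continuous (fun v => K v m) by exact: cont_proj.
have oO : open O.
  apply: openI; first by apply: (open_comp _ (disc_open dV)) => v _; exact: ck.
  rewrite openE => u /= hu; apply: nbhs_forall => m.
  have [e|mi] := eqVneq m i1; first exact: filterS filterT.
  have nW : nbhs u [set v | W (K v m)].
    by apply: (ck m); apply: open_nbhs_nbhs; split=> //; exact: hu.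
  by apply: filterS nW => v /= Wv _.
have gO u : O u -> good i1 K V u.
  move=> [h1 h2]; split=> // m mi Vm; exact: dTW (VT _ Vm) (h2 m mi).
(* [c1] follows the bottom and the right side of the square, [c2] the left side and the top. On the
   vertical sides [K] is constant, so only [f], resp. [g], is seen. *)
pose c1 (t : R) : R2 := (clamp (2 * t), clamp (2 * t - 1)).
pose c2 (t : R) : R2 := (clamp (2 * t - 1), clamp (2 * t)).
have ccl := clamp_continuous.
have cc1 : continuous c1 by rewrite /c1; cont.
have cc2 : continuous c2 by rewrite /c2; cont.
have Kc1 t : K (c1 t) = upd z i3 (f (clamp (2 * t))).
  rewrite /c1; case: (leP t 2^-1) => h.
    by rewrite (@clamp_le0 (2 * t - 1)) ?K0 //; lra.
  by rewrite (@clamp_ge1 (2 * t)) ?Kr ?f1 ?upz //; lra.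
have g0 : upd z i3 (g 0) = z by rewrite -K1 Kl.
have Kc2 t : K (c2 t) = upd z i3 (g (clamp (2 * t - 1))).
  rewrite /c2; case: (leP t 2^-1) => h.
    by rewrite (@clamp_le0 (2 * t - 1)) ?Kl ?g0 //; lra.
  by rewrite (@clamp_ge1 (2 * t)) ?K1 //; lra.
have sq x x' : unit_square (clamp x, clamp x').
  by split; rewrite unit_intervalE; exact: clamp01.
have OU x u : W x -> K u = upd z i3 x -> O u.
  move=> Wx e; rewrite /O /= e /upd; split; first by rewrite (negbTE i13).
  by move=> m mi; case: eqP => // _; exact: Wz.
have h1 t : unit_square (c1 t) /\ O (c1 t).
  by split; [exact: sq | exact: OU (Wf _) (Kc1 t)].
have h2 t : unit_square (c2 t) /\ O (c2 t).
  by split; [exact: sq | exact: OU (Wg _) (Kc2 t)].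
have e0 : c1 0 = c2 0 by rewrite /c1 /c2 mulr0 sub0r clamp0 clamp_le0 //; lra.
have e1 : c1 1 = c2 1.
  by rewrite /c1 /c2 (_ : 2 * 1 - 1 = 1 :> R) ?clamp1 ?clamp_ge1 //; lra.
have c11 : c1 1 = (1, 1).
  by rewrite /c1 (_ : 2 * 1 - 1 = 1 :> R) ?clamp1 ?clamp_ge1 //; lra.
have [lam plam] := @doubling_paths n M sM i1 i2 i3 i12 i13 K cK FK V y O c1 c2
  oO gO Py cc1 cc2 h1 h2 e0 e1.
have [clam Plam lam0 lam1] := plam.
pose B (f : R -> M) t := upd (upd z i3 w) i2 (f t).
(* Only strand [i3] of [K] moves along these paths. The first configuration has forgotten it and
   stays constant; in the second one [i2] performs its motion. *)
have zzc (c : R -> R2) f' t : K (c t) = upd z i3 (f' t) ->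
    zz i1 i2 i3 K (c t) y = (upd z i3 w, B f' t).
  move=> e; rewrite /zz /twocfg e /B /upd; congr pair; apply/funext => j /=.
    case: (eqVneq j i1) => [->|_]; first by rewrite (negbTE i13).
    case: (eqVneq j i3) => // j3.
    by case: (eqVneq j i2) => [->|_]; rewrite ?(negbTE i23) ?(negbTE j3).
  case: (eqVneq j i1) => [->|_]; first by rewrite (negbTE i12) (negbTE i13).
  case: (eqVneq j i3) => [->|j3]; first by rewrite eq_sym (negbTE i23).
  by case: (eqVneq j i2) => [_|_]; rewrite ?eqxx ?(negbTE j3).
have pzz (c : R -> R2) : continuous c -> (forall t, unit_square (c t) /\ O (c t)) ->
    pth FF (zz i1 i2 i3 K (c 0) y) (zz i1 i2 i3 K (c 1) y)
      (fun t => zz i1 i2 i3 K (c t) y).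
  move=> cc hc; split=> //; first by apply: zz_continuous => //; cont.
  move=> t; have [_ _ cl] := gO _ (hc t).2.
  exact: (zz_FF i12 i13 FK cl Py).
have p1 := pzz _ cc1 h1; have p2 := pzz _ cc2 h2.
have [_ _ cl11] := gO _ (h1 1).2.
have pl := loc_pth i12 i13 cK FK cl11 plam.
rewrite /loc (cmul_cls p1 pl) => /(clsP (pth_cat p1 pl)) hh.
pose f' t := f (clamp (2 * t)); pose g' t := g (clamp (2 * t - 1)).
have z1 t : zz i1 i2 i3 K (c1 t) y = (upd z i3 w, B f' t) by exact: zzc (Kc1 t).
have z2 t : zz i1 i2 i3 K (c2 t) y = (upd z i3 w, B g' t) by exact: zzc (Kc2 t).
pose S (v : M * M) (x : M) : Mpow n M := fun j =>
  if j == i1 then v.1 else if j == i3 then v.2 else if j == i2 then x else z j.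
have zS v : zz i1 i2 i3 K (c1 1) v = (S v (z i2), S v (z i3)).
  rewrite /zz /twocfg c11 Kr /S; congr pair; apply/funext => j; case: ifP => // _.
    by case: ifP => // _; case: eqP => // ->.
  by case: ifP => // _; case: eqP.
have Fz : Fconf n M z by rewrite -(Kl 0); exact: FK.
have [ceta heta eta0 eta1] := peta.
have FS v x : P2 V v -> W x -> (forall j, j != i2 -> j != i3 -> z j <> x) -> Fconf n M (S v x).
  move=> [v1 v2 v12] Wx zx.
  have nV m a : V a -> m != i1 -> a <> z m.
    by move=> Va mi e; apply: dTW (VT _ Va) _; rewrite e; exact: Wz.
  have nx a : V a -> a <> x by move=> /VT Ta e; apply: dTW Ta _; rewrite e.
  move=> j j'; rewrite /S.
  case: (eqVneq j i1) => [->|j1]; case: (eqVneq j' i1) => [->|j1'] //.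
  - case: (eqVneq j' i3) => [->|j3'] //; case: eqP => _ e; first by case: (nx _ v1).
    by case: (nV _ _ v1 j1').
  - case: (eqVneq j i3) => [->|j3] //; first by move=> e; case: v12.
    case: eqP => _ e; first by case: (nx _ v1).
    by case: (nV _ _ v1 j1).
  case: (eqVneq j i3) => [->|j3]; case: (eqVneq j' i3) => [->|j3'] //.
  - by case: eqP => _ e; [case: (nx _ v2) | case: (nV _ _ v2 j1')].
  - by case: eqP => _ e; [case: (nx _ v2) | case: (nV _ _ v2 j1)].
  case: (eqVneq j i2) => [->|j2]; case: (eqVneq j' i2) => [->|j2'] // e.
  - by case: (zx j').
  - by case: (zx j).
  - exact: Fz e.
have cS (X : topologicalType) (v : X -> M * M) (x : X -> M) :
    continuous v -> continuous x -> continuous (fun t => S (v t) (x t)).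
  move=> cv cx; apply: cont_Mpow => j; rewrite /S.
  by case: (j == i1); [cont | case: (j == i3); [cont | case: (j == i2); cont]].
have FF1 x : FF x -> Fconf n M x.1 by case.
have FF2 x : FF x -> Fconf n M x.2 by case.
have cfst : continuous (fst : Mpow n M * Mpow n M -> Mpow n M) by apply: cont_fst; cont.
have csnd : continuous (snd : Mpow n M * Mpow n M -> Mpow n M) by apply: cont_snd; cont.
have pS x : W x -> (forall j, j != i2 -> j != i3 -> z j <> x) ->
    pth (Fconf n M) (S y x) (S y x) (fun t => S (lam t) x).
  move=> Wx zx; split; rewrite ?lam0 ?lam1 //; first by apply: cS; cont.
  by move=> t; exact: FS.
have zne a j : j != i2 -> j != i3 -> a \in [:: i2; i3] -> z j <> z a.
  by move=> j2 j3; rewrite !inE => /orP[] /eqP -> /Fz /eqP; apply/negP.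
have pA := pS _ (Wz i2 _) (fun j j2 j3 => zne i2 j j2 j3 (mem_head _ _)).
have := pA; rewrite eq_sym => /(_ i12) {}pA.
have pB := pS (z i3) (Wz i3 _) (fun j j2 j3 => zne i3 j j2 j3 _).
have {}pB : pth (Fconf n M) (S y (z i3)) (S y (z i3)) (fun t => S (lam t) (z i3)).
  by apply: pB; rewrite ?inE ?eqxx ?orbT // eq_sym.
have Sy2 : S y (z i2) = upd z i3 w.
  rewrite /S /upd; apply/funext => j; case: (eqVneq j i1) => [->|_].
    by rewrite (negbTE i13).
  by case: eqP => // _; case: eqP => // ->.
have Sy3 x : S y x = upd (upd z i3 w) i2 x.
  rewrite /S /upd; apply/funext => j; case: (eqVneq j i1) => [->|_].
    by rewrite (negbTE i12) (negbTE i13).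
  by case: (eqVneq j i3) => [->|_]; case: eqP => // e; rewrite e eqxx in i23.
have hA : cls (Fconf n M) (fun t => S (lam t) (z i2)) =
    cls (Fconf n M) (Cconst (S y (z i2))).
  rewrite -(cmul1r (arr_cls pA)) (cmul_cls (pth_cst _) pA); last first.
    by have [_ h <- _] := pA; exact: (h 0).
  apply: esym; apply: cls_eq; have := hpt_comp cfst FF1 hh.
  rewrite comp_cat.
  rewrite (_ : _ \o _ = Cconst (S y (z i2))); last first.
    by apply/funext => t; rewrite /comp z2 Sy2.
  rewrite (_ : _ \o _ = Cconst (S y (z i2))); last first.
    by apply/funext => t; rewrite /comp z1 Sy2.
  by rewrite (_ : _ \o _ = (fun t => S (lam t) (z i2))) //; apply/funext => t; rewrite /comp zS.
have pE : pth (Fconf n M) (S y (z i2)) (S y (z i3)) (fun t => S y (eta t)).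
  split; rewrite ?eta0 ?eta1 //; first by apply: cS; cont.
  by move=> t; have [? ?] := heta t; exact: FS.
have hB : cls (Fconf n M) (fun t => S (lam t) (z i3)) =
    cls (Fconf n M) (Cconst (S y (z i3))).
  have := @cls_square _ (Fconf n M) (fun u => S (lam u.1) (eta u.2)).
  rewrite /= lam0 lam1 eta0 eta1 hA (cmul1r (arr_cls pE)) => h.
  rewrite -(cmulKr (arr_cls pE) (arr_cls pB)) -h ?(cmulVr (arr_cls pE)) //.
  - by apply: cS; cont.
  - by move=> u; have [? ?] := heta u.2; exact: FS.
have FB (h : R -> M) s : (forall t, W (h t)) ->
    (forall t, K (t, s) = upd z i3 (h t)) -> forall t, Fconf n M (B h t).
  move=> Wh Kh t; rewrite /B -Sy3; apply: FS => // j j2 j3 e.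
  have := FK (t, s); rewrite Kh => /(_ j i3); rewrite /upd eqxx (negbTE j3).
  by move=> /(_ e) /eqP; rewrite (negbTE j3).
have FBf := FB f 0 Wf K0; have FBg := FB g 1 Wg K1.
have cB (h : R -> M) : continuous h -> continuous (B h).
  by move=> ch; apply: upd_continuous.
have hf : hpt (Fconf n M) (B f') (B f).
  apply: (@hpt_repar _ _ (B f) (fun t => clamp (2 * t)) id) => //; [exact: cB | | | |].
  - by cont.
  - by cont.
  - by rewrite mulr0 clamp0.
  - by rewrite clamp_ge1 //; lra.
have hg : hpt (Fconf n M) (B g') (B g).
  apply: (@hpt_repar _ _ (B g) (fun t => clamp (2 * t - 1)) id) => //; [exact: cB | | | |].
  - by cont.
  - by cont.
  - by rewrite clamp_le0 //; lra.
  - by rewrite clamp_ge1 //; lra.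
have pf' : pth (Fconf n M) (S y (z i3)) (S y (z i3)) (B f').
  apply: (pth_hpt _ (hpt_sym hf)); split; [exact: cB | by [] | |].
  - by rewrite /B Sy3 f0.
  - by rewrite /B Sy3 f1.
apply: (hpt_trans (hpt_sym hf)); apply: (hpt_trans _ hg); apply: hpt_sym.
apply: (clsP pf').
have := cls_eq (hpt_comp csnd FF2 hh); rewrite comp_cat.
rewrite (_ : _ \o _ = B g'); last by apply/funext => t; rewrite /comp z2.
rewrite (_ : _ \o _ = B f'); last by apply/funext => t; rewrite /comp z1.
rewrite (_ : _ \o _ = (fun t => S (lam t) (z i3))); last first.
  by apply/funext => t; rewrite /comp zS.
by rewrite -(cmul_cls pf' pB) hB (cmulr1 (arr_cls pf')) => ->.
Qed.

(** * Plane geometry and twists *)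

(** The Euclidean distance, for invariance under rotations; the balls of the product topology on
    [R2] are squares. *)
Definition dist (v w : R2) : R := Num.sqrt ((v.1 - w.1) ^+ 2 + (v.2 - w.2) ^+ 2).

Lemma dist_sqr v w : dist v w ^+ 2 = (v.1 - w.1) ^+ 2 + (v.2 - w.2) ^+ 2.
Proof. by rewrite sqr_sqrtr // addr_ge0 // sqr_ge0. Qed.

Lemma dist_ge0 v w : 0 <= dist v w. Proof. exact: sqrtr_ge0. Qed.

Lemma distC v w : dist v w = dist w v.
Proof. by congr Num.sqrt; ring. Qed.

Lemma dist_refl v : dist v v = 0.
Proof. by rewrite /dist !subrr expr0n addr0 sqrtr0. Qed.

Lemma dist_gt0 v w : v <> w -> 0 < dist v w.
Proof.
move=> ne; rewrite lt_def dist_ge0 andbT; apply/eqP => d0; apply: ne.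
have := dist_sqr v w; rewrite d0 => e.
have z0 (x y : R) : (x - y) ^+ 2 = 0 -> x = y by move=> /eqP; rewrite sqrf_eq0 subr_eq0 => /eqP.
have h1 : v.1 = w.1 by apply: z0; have := sqr_ge0 (v.1 - w.1); have := sqr_ge0 (v.2 - w.2); lra.
have h2 : v.2 = w.2 by apply: z0; have := sqr_ge0 (v.1 - w.1); have := sqr_ge0 (v.2 - w.2); lra.
by rewrite [v]surjective_pairing h1 h2 -surjective_pairing.
Qed.

Lemma dist_eq0 v w : dist v w = 0 -> v = w.
Proof. by move=> d0; apply: contrapT => /dist_gt0; rewrite d0 ltxx. Qed.

Lemma dist_lt v w r : 0 < r -> (v.1 - w.1) ^+ 2 + (v.2 - w.2) ^+ 2 < r ^+ 2 ->
  dist v w < r.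
Proof. by rewrite -dist_sqr => r0; have := dist_ge0 v w; nra. Qed.

Lemma dist_tri u v w : dist v w <= dist v u + dist u w.
Proof.
have [h1 h2 h3] := And3 (dist_sqr v w) (dist_sqr v u) (dist_sqr u w).
have [k1 k2 k3] := And3 (dist_ge0 v w) (dist_ge0 v u) (dist_ge0 u w).
set x := v.1 - u.1 in h2; set y := v.2 - u.2 in h2.
set x' := u.1 - w.1 in h3; set y' := u.2 - w.2 in h3.
have e1 : v.1 - w.1 = x + x' by rewrite /x /x'; ring.
have e2 : v.2 - w.2 = y + y' by rewrite /y /y'; ring.
rewrite e1 e2 in h1.
have cs : x * x' + y * y' <= dist v u * dist u w.
  apply: contrapT => /negP; rewrite -ltNge => lt.
  have m0 : 0 <= dist v u * dist u w by apply: mulr_ge0.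
  have : (dist v u * dist u w) ^+ 2 < (x * x' + y * y') ^+ 2 by nra.
  rewrite exprMn h2 h3; have := sqr_ge0 (x * y' - y * x'); nra.
have : dist v w ^+ 2 <= (dist v u + dist u w) ^+ 2 by nra.
nra.
Qed.

Lemma dist_hor x x' y : dist (x, y) (x', y) = `|x - x'|.
Proof. by rewrite /dist /= subrr expr0n addr0 sqrtr_sqr. Qed.

Definition spin (c : R2) (th : R) (v : R2) : R2 :=
  (c.1 + (cos th * (v.1 - c.1) - sin th * (v.2 - c.2)),
   c.2 + (sin th * (v.1 - c.1) + cos th * (v.2 - c.2))).

Lemma spin_dist c th v w : dist (spin c th v) (spin c th w) = dist v w.
Proof.
congr Num.sqrt; rewrite /spin /=; have := cos2Dsin2 th => e.
transitivity ((cos th ^+ 2 + sin th ^+ 2) * ((v.1 - w.1) ^+ 2 + (v.2 - w.2) ^+ 2)).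
  by ring.
by rewrite e mul1r.
Qed.

Lemma spin_center c th : spin c th c = c.
Proof. by rewrite /spin !subrr !mulr0 subr0 !addr0 -surjective_pairing. Qed.

Lemma spin_dist_center c th v : dist c (spin c th v) = dist c v.
Proof. by rewrite -{1}(spin_center c th) spin_dist. Qed.

Lemma spin_dist_self c th v : dist v (spin c th v) <= 2 * dist c v.
Proof.
have := dist_tri c v (spin c th v); rewrite spin_dist_center [dist v c]distC; lra.
Qed.

Lemma spin0 c v : spin c 0 v = v.
Proof.
by rewrite /spin cos0 sin0 [RHS]surjective_pairing; congr pair; ring.
Qed.

Lemma spinD c th th' v : spin c th (spin c th' v) = spin c (th + th') v.
Proof. by rewrite /spin /= (@trigo.cosD R) (@trigo.sinD R); congr pair; ring. Qed.

Lemma spin_2pi c v : spin c (2 * pi) v = v.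
Proof.
rewrite /spin mulr_natl cos2pi sin2pi [RHS]surjective_pairing.
by congr pair; ring.
Qed.

Lemma spin_pi c v : spin c pi v = (2 * c.1 - v.1, 2 * c.2 - v.2).
Proof. by rewrite /spin cospi sinpi; congr pair; ring. Qed.

Lemma cont_spin (T : topologicalType) (c v : T -> R2) (th : T -> R) :
  continuous c -> continuous th -> continuous v ->
  continuous (fun t => spin (c t) (th t) (v t)).
Proof. by move=> cc ct cv; rewrite /spin; cont. Qed.

Lemma spin_inj c th v w : spin c th v = spin c th w -> v = w.
Proof. by move=> e; apply: dist_eq0; rewrite -(spin_dist c th) e dist_refl. Qed.

Lemma lerp_dist t c v w : dist (lerp t c v) (lerp t c w) = `|t| * dist v w.
Proof.
rewrite /dist /lerp /= -sqrtr_sqr -sqrtrM ?sqr_ge0 //; congr Num.sqrt; ring.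
Qed.

Lemma lerp_id t v : lerp t v v = v.
Proof. by rewrite /lerp [RHS]surjective_pairing; congr pair; ring. Qed.

(** [s] compresses the line into the interval from -1 to 1. The second coordinate is shifted to the
    upper half of the box, so that a chart at a boundary point serves as well. *)
Lemma plane_embedding (M : topologicalType) (x : M) : surface_with_boundary M ->
  exists2 e : R2 -> M, continuous e & injective e.
Proof.
move=> sM; have [V [f [g [c [r [r0 Hc [_ _ _ cg [_ _ _ fg]]]]]]] _] :=
  disc_nbhs sM openT (I : [set: M] x).
have d0 (t : R) : 0 < 1 + `|t| by have := normr_ge0 t; lra.
pose s (t : R) := t * (1 + `|t|)^-1.
have cs : continuous s.
  by apply: cont_mul; cont; apply: cont_inv; cont => t; rewrite gt_eqF.
have s1 t : `|s t| < 1.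
  by rewrite normrM normfV (gtr0_norm (d0 t)) ltr_pdivrMr // mul1r; lra.
have sinj t u : s t = s u -> t = u.
  rewrite /s => e.
  have /eqP := e; rewrite eqr_div ?(gt_eqF (d0 _)) // => /eqP e1.
  have := d0 t; have := d0 u; move: e1.
  case: (leP 0 t) => ht; case: (leP 0 u) => hu;
    rewrite ?(ger0_norm ht) ?(ltr0_norm ht) ?(ger0_norm hu) ?(ltr0_norm hu); nra.
pose k v : R2 := (c.1 + r * s v.1, c.2 + r * (2^-1 * (s v.2 + 1))).
have ck : continuous k by rewrite /k; cont.
have hk v : hbox c r (k v).
  have := s1 v.1; have := s1 v.2; rewrite !ltr_norml => /andP[a1 a2] /andP[a3 a4].
  rewrite /halfplane /= in Hc.
  split=> /=; first by rewrite addrAC subrr add0r ltr_norml; apply/andP; split; nra.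
    by rewrite addrAC subrr add0r ltr_norml; apply/andP; split; nra.
  nra.
exists (g \o k) => [|v w /= e]; first exact: (cont_within cg ck hk).
have : k v = k w by rewrite -(fg _ (hk v)) e fg.
move=> [/addrI /(mulfI (lt0r_neq0 r0)) /sinj e1].
move=> /addrI /(mulfI (lt0r_neq0 r0)) e2.
have /sinj e3 : s v.2 = s w.2 by lra.
by rewrite [v]surjective_pairing e1 e3 -surjective_pairing.
Qed.

Lemma cont_dist (T : topologicalType) (v w : T -> R2) :
  continuous v -> continuous w -> continuous (fun t => dist (v t) (w t)).
Proof.
move=> cv cw; rewrite /dist.
pose f t : R := ((v t).1 - (w t).1) * ((v t).1 - (w t).1) +
  ((v t).2 - (w t).2) * ((v t).2 - (w t).2).
have cf : continuous f by rewrite /f; cont.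
exact: (cont_comp (@sqrt_continuous R) cf).
Qed.

Lemma unit_bounded (I : finType) (f : I -> R -> R) : (forall i, continuous (f i)) ->
  exists2 B, 0 < B & forall i t, 0 <= t <= 1 -> f i t <= B.
Proof.
move=> cf; have /choice [b hb] : forall i, exists b, forall t, 0 <= t <= 1 -> f i t <= b.
  move=> i; have [c _ hc] := @EVT_max R (f i) 0 1 ler01 (continuous_subspaceT (@cf i)).
  by exists (f i c) => t t01; apply: hc; rewrite in_itv.
exists (1 + \sum_i `|b i|).
  by rewrite ltr_pwDl // sumr_ge0.
move=> i t t01; apply: (le_trans (hb i t t01)); apply: (le_trans (ler_norm _)).
by rewrite (bigD1 i) //= addrCA lerDl addr_ge0 // sumr_ge0.
Qed.

Section Twists.
Context {n : nat}.
Local Notation F2 := (Fconf n R2).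
Implicit Types (z : Mpow n R2) (k a l : 'I_n).

Definition tw z k a (t : R) : Mpow n R2 := upd z k (spin (z a) (2 * pi * t) (z k)).

(** The circle described by [k] about [a] then meets no other label and encloses [a] alone. *)
Definition isolated z k a := k != a /\ forall l, l != k -> l != a ->
  dist (z a) (z k) < dist (z a) (z l).

Lemma cont_tw (T : topologicalType) (z : T -> Mpow n R2) k a (t : T -> R) :
  continuous z -> continuous t -> continuous (fun x => tw (z x) k a (t x)).
Proof.
move=> cz ct; apply: cont_Mpow => j; rewrite /tw /upd.
have cp i : continuous (fun x => z x i) by exact: cont_proj.
by case: (j == k) => //; apply: cont_spin => //; cont.
Qed.

Lemma tw0 z k a : tw z k a 0 = z.
Proof. by apply/funext => j; rewrite /tw /upd mulr0 spin0; case: eqP => // ->. Qed.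

Lemma tw1 z k a : tw z k a 1 = z.
Proof. by apply/funext => j; rewrite /tw /upd mulr1 spin_2pi; case: eqP => // ->. Qed.

Lemma tw_F z k a t : F2 z -> isolated z k a -> F2 (tw z k a t).
Proof.
move=> Fz [ka iso] i j; rewrite /tw /upd.
have ne l : l != k -> spin (z a) (2 * pi * t) (z k) <> z l.
  move=> lk e; have := spin_dist_center (z a) (2 * pi * t) (z k); rewrite e.
  have [la|la] := eqVneq l a.
    rewrite la dist_refl => d0; move: ka; rewrite -(inj_eq Fz) => /eqP; apply.
    by apply: dist_eq0; rewrite distC -d0.
  by move=> d; have := iso l lk la; rewrite d ltxx.
case: (eqVneq i k) => [->|ik]; case: (eqVneq j k) => [->|jk] //.
- by move/ne; rewrite jk; case.
- by move/esym/ne; rewrite ik; case.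
- exact: Fz.
Qed.

Lemma tw_pth z k a : F2 z -> isolated z k a -> pth F2 z z (tw z k a).
Proof.
move=> Fz iso; split=> [|t||]; [|exact: tw_F|exact: tw0|exact: tw1].
by apply: cont_tw; cont.
Qed.

Lemma act_tw (s : 'S_n) z k a t : act s (tw z (s k) (s a) t) = tw (act s z) k a t.
Proof.
by apply/funext => i; rewrite /act /tw /upd (inj_eq perm_inj).
Qed.

Lemma act_isolated (s : 'S_n) z k a : isolated z (s k) (s a) -> isolated (act s z) k a.
Proof.
move=> [ka iso]; split; first by apply: contra ka => /eqP ->.
by move=> l lk la; apply: iso; rewrite (inj_eq perm_inj).
Qed.

(** Labels in [S] are satellites, [a k] being the anchor of [k]. Each satellite is the nearest label
    to its anchor, and the discs spanned by different satellites are disjoint, so that several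
    twists stay defined along a motion. *)
Definition tight (S : pred 'I_n) (a : 'I_n -> 'I_n) : set (Mpow n R2) :=
  [set z | [/\ inj_on (predC S) z, forall k, S k -> z (a k) <> z k,
    forall k l, S k -> ~~ S l -> l != a k -> dist (z (a k)) (z k) < dist (z (a k)) (z l) &
    forall k k', S k -> S k' -> k != k' ->
      dist (z (a k)) (z k) + dist (z (a k')) (z k') < dist (z (a k)) (z (a k'))]].

Lemma tight_F S (a : _ -> _) z : tight S a z -> F2 z.
Proof.
move=> [inj ne far apart].
have h k l : S k -> ~~ S l -> z k <> z l.
  move=> Sk Sl e; have [la|la] := eqVneq l (a k).
    by case: (ne k Sk); rewrite e la.
  by have := far k l Sk Sl la; rewrite e ltxx.
move=> i j; case Si : (S i); case Sj : (S j) => e.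
- apply/eqP; apply: contraT => ij; have := apart i j Si Sj ij.
  have := dist_tri (z i) (z (a i)) (z (a j)); rewrite {2}e [dist (z j) _]distC; lra.
- by case: (h i j); rewrite ?Sj.
- by case: (h j i); rewrite ?Si.
- by apply: inj; rewrite //= ?Si ?Sj.
Qed.

Lemma tight_isolated S (a : _ -> _) z k : ~~ S (a k) -> S k -> tight S a z -> isolated z k (a k).
Proof.
move=> nS Sk [inj ne far apart]; split; first by apply: contra nS => /eqP <-.
move=> l lk la; case Sl : (S l); last by apply: far; rewrite ?Sl.
have := apart k l Sk Sl; rewrite eq_sym => /(_ lk).
have := dist_tri (z l) (z (a k)) (z (a l)); rewrite [dist (z l) _]distC; lra.
Qed.

(** With factor [-1] this is the difference [v - w], in which form the offset of a satellite from
    its anchor appears below. *)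
Definition move (v w : R2) (r : R) : R2 := (v.1 + r * w.1, v.2 + r * w.2).

Lemma dist_move v w r : 0 <= r -> dist v (move v w r) = r * dist (0, 0) w.
Proof.
move=> r0; rewrite -{2}(ger0_norm r0) /dist /move /= -sqrtr_sqr -sqrtrM ?sqr_ge0 //.
by congr Num.sqrt; ring.
Qed.

(* Satellites are first drawn very close to their anchors, then carried along a
   motion of the anchors. *)
Lemma tight_connected (S : pred 'I_n) (a : _ -> _) z z' : (forall k, S k -> ~~ S (a k)) ->
  tight S a z -> tight S a z' ->
  (forall k t, S k -> 0 <= t <= 1 ->
    lerp t (move (z k) (z (a k)) (-1)) (move (z' k) (z' (a k)) (-1)) <> (0, 0)) ->
  exists c, pth (tight S a) z z' c.
Proof.
move=> Sa tz tz' nz.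
have [inj ne far apart] := tz; have [inj' ne' far' apart'] := tz'.
have [c [cc ic c0 c1]] := configurations_connected surface_plane connected_plane inj inj'.
pose o k := move (z k) (z (a k)) (-1); pose o' k := move (z' k) (z' (a k)) (-1).
have cc' i : continuous (fun t => c t i) by exact: cont_proj.
pose f (ij : 'I_n * 'I_n) t := (if [&& ~~ S ij.1, ~~ S ij.2 & ij.1 != ij.2]
  then dist (c t ij.1) (c t ij.2) else 1)^-1.
have pd i j t : ~~ S i -> ~~ S j -> i != j -> 0 < dist (c t i) (c t j).
  by move=> Si Sj ij; apply: dist_gt0 => /(ic t _ _ Si Sj) e; rewrite e eqxx in ij.
have [D D0 hD] : exists2 D, 0 < D & forall ij t, 0 <= t <= 1 -> f ij t <= D.
  apply: unit_bounded => -[i j]; apply: cont_inv => [t|] /=.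
    by case: ifP => [/and3P[? ? ?]|_]; [rewrite gt_eqF // pd | rewrite oner_eq0].
  by case: [&& ~~ S i, ~~ S j & i != j]; [exact: cont_dist | exact: cont_cst].
have [B B0 hB] : exists2 B, 0 < B & forall k t, 0 <= t <= 1 ->
    dist (0, 0) (lerp t (o k) (o' k)) <= B.
  apply: unit_bounded => k; apply: cont_dist; first by cont.
  by apply: cont_lerp; cont.
have hd i j t : 0 <= t <= 1 -> ~~ S i -> ~~ S j -> i != j -> 1 <= D * dist (c t i) (c t j).
  move=> t01 Si Sj ij; have := hD (i, j) t t01; rewrite /f /= Si Sj ij /=.
  by rewrite -ler_pdivrMr ?pd // div1r.
(* [D] bounds the inverse distances between labels outside [S] along [c], and [B] the lengths of the
   interpolated offsets; hence [2 * (r * B)] is less than each of these distances. *)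
pose r := (1 + 2 * B * D)^-1.
have q0 : 0 < 1 + 2 * B * D by have := mulr_gt0 B0 D0; nra.
have r0 : 0 < r by rewrite invr_gt0.
have rE : r * (1 + 2 * B * D) = 1 by rewrite mulVf // gt_eqF.
have r1 : r <= 1 by have := mulr_gt0 B0 D0; nra.
have rlt x : 0 <= x -> 1 <= D * x -> 2 * (r * B) < x.
  move=> x0 Dx; rewrite -(ltr_pM2r q0).
  rewrite (_ : 2 * (r * B) * _ = 2 * B * (r * (1 + 2 * B * D))); last by ring.
  have xp : 0 < x by rewrite lt_def x0 andbT; apply/eqP => e; move: Dx; rewrite e mulr0 ler10.
  rewrite rE; nra.
have rle y : y <= B -> r * y <= r * B by move=> yB; rewrite ler_pM2l.
(* [u] runs from -1 to 2: the offsets shrink up to 0, the anchors travel and the offsets turn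
   between 0 and 1, and the offsets grow back afterwards. [rho] is the scale, never below [r]. *)
pose u (t : R) := 3 * clamp t - 1.
pose rho (t : R) := Num.max r (Num.max (- u t) (u t - 1)).
have ccl := clamp_continuous.
have cu : continuous u by rewrite /u; cont.
have crho : continuous rho by rewrite /rho; cont.
pose C t : Mpow n R2 := fun i => if S i
  then move (c (clamp (u t)) (a i)) (lerp (clamp (u t)) (o i) (o' i)) (rho t)
  else c (clamp (u t)) i.
have rho0 t : 0 < rho t by rewrite /rho lt_max r0.
have rho1 t : rho t <= 1.
  by rewrite /rho !ge_max r1 /= /u; have /andP[? ?] := clamp01 t; apply/andP; split; lra.
have oE (y : Mpow n R2) k : dist (0, 0) (move (y k) (y (a k)) (-1)) = dist (y (a k)) (y k).
  by rewrite /dist /move /=; congr Num.sqrt; ring.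
have dC t k : S k -> dist (C t (a k)) (C t k) =
    rho t * dist (0, 0) (lerp (clamp (u t)) (o k) (o' k)).
  by move=> Sk; rewrite /C Sk (negbTE (Sa k Sk)) dist_move // ltW.
have Ca t i : ~~ S i -> C t i = c (clamp (u t)) i by move=> Si; rewrite /C (negbTE Si).
have ak k k' : S k -> S k' -> k != k' -> a k != a k'.
  move=> Sk Sk' kk; apply/eqP => e; have := apart k k' Sk Sk' kk.
  have := dist_ge0 (z (a k)) (z k); have := dist_ge0 (z (a k')) (z k').
  rewrite e dist_refl; lra.
have tC t : tight S a (C t).
  have inrange : 0 <= u t <= 1 \/ u t <= 0 \/ 1 <= u t.
    by case: (leP 0 (u t)) => h; [case: (leP (u t) 1) => h'; [left | right; right] |
      right; left]; rewrite ?h ?h' // ltW.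
  split.
  - move=> i j Si Sj; rewrite !Ca //; exact: ic.
  - move=> k Sk e; have := dC t k Sk; rewrite e dist_refl => /esym/eqP.
    rewrite mulf_eq0 gt_eqF //= => /eqP /dist_eq0 /esym.
    by apply: nz => //; exact: clamp01.
  - move=> k l Sk Sl la; rewrite dC // Ca ?Sa // Ca //.
    have dl := dist_ge0 (0, 0) (lerp (clamp (u t)) (o k) (o' k)).
    case: inrange => [h|[h|h]].
    + have rr : rho t = r by rewrite /rho; move/andP: h => [? ?]; apply/max_idPl;
        rewrite ge_max; apply/andP; split; lra.
      have := hd (a k) l (clamp (u t)) (clamp01 _) (Sa k Sk) Sl; rewrite eq_sym => /(_ la).
      move=> /(rlt _ (dist_ge0 _ _)); rewrite rr.
      have := rle _ (hB k (clamp (u t)) (clamp01 _)).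
      have := mulr_gt0 r0 B0; lra.
    + rewrite clamp_le0 // lerp0 c0 /o oE; have := far k l Sk Sl la; have := rho1 t.
      have := dist_ge0 (z (a k)) (z k); nra.
    + rewrite clamp_ge1 // lerp1 c1 /o' oE; have := far' k l Sk Sl la; have := rho1 t.
      have := dist_ge0 (z' (a k)) (z' k); nra.
  - move=> k k' Sk Sk' kk; rewrite !dC // !Ca ?Sa //.
    have aa := ak k k' Sk Sk' kk.
    have dl := dist_ge0 (0, 0) (lerp (clamp (u t)) (o k) (o' k)).
    have dl' := dist_ge0 (0, 0) (lerp (clamp (u t)) (o k') (o' k')).
    case: inrange => [h|[h|h]].
    + have rr : rho t = r by rewrite /rho; move/andP: h => [? ?]; apply/max_idPl;
        rewrite ge_max; apply/andP; split; lra.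
      have := hd (a k) (a k') (clamp (u t)) (clamp01 _) (Sa k Sk) (Sa k' Sk') aa.
      move=> /(rlt _ (dist_ge0 _ _)); rewrite rr.
      have := rle _ (hB k (clamp (u t)) (clamp01 _)).
      have := rle _ (hB k' (clamp (u t)) (clamp01 _)); lra.
    + rewrite clamp_le0 // !lerp0 c0 /o !oE; have := apart k k' Sk Sk' kk; have := rho1 t.
      have := dist_ge0 (z (a k)) (z k); have := dist_ge0 (z (a k')) (z k'); nra.
    + rewrite clamp_ge1 // !lerp1 c1 /o' !oE; have := apart' k k' Sk Sk' kk; have := rho1 t.
      have := dist_ge0 (z' (a k)) (z' k); have := dist_ge0 (z' (a k')) (z' k'); nra.
exists C; split=> //.
- have ccu i : continuous (fun t => c (clamp (u t)) i).
    by apply: (@cont_comp _ _ _ (fun t => c t i) _ (cc' i)); cont.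
  have cca i := ccu (a i).
  apply: cont_Mpow => i; rewrite /C; case: (S i); last exact: ccu.
  rewrite /move /lerp; apply: cont_pair; apply: cont_add; cont; exact: cca.
- apply/funext => i; rewrite /C /u clamp0 clamp_le0; last by lra.
  rewrite c0 lerp0 /rho /u clamp0; case: ifP => // _.
  rewrite (_ : Num.max r _ = 1) /o /move /=.
    by rewrite [RHS]surjective_pairing; congr pair; ring.
  rewrite [Num.max (- _) _]maxEle ifF; last by apply/negbTE; lra.
  by rewrite (_ : - (3 * 0 - 1) = 1); [apply/max_idPr | ring].
- apply/funext => i; rewrite /C /u clamp1 clamp_ge1; last by lra.
  rewrite c1 lerp1 /rho /u clamp1; case: ifP => // _.
  rewrite (_ : Num.max r _ = 1) /o' /move /=.
    by rewrite [RHS]surjective_pairing; congr pair; ring.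
  rewrite [Num.max (- _) _]maxEle ifT; last by lra.
  by rewrite (_ : 3 * 1 - 1 - 1 = 1); [apply/max_idPr | ring].
Qed.

End Twists.

(** * Rotations *)

Lemma cont_mull (a : R) : continuous ( *%R a).
Proof. by change (continuous (fun t : R => a * t)); cont. Qed.

Section Push.
Context {n : nat} {M : topologicalType} (e : R2 -> M).
Hypotheses (ce : continuous e) (ei : injective e).
Local Notation F := (Fconf n M).
Local Notation F2 := (Fconf n R2).
Implicit Types (z : Mpow n R2) (k a l : 'I_n).

Definition push z : Mpow n M := fun i => e (z i).

(** Motions are planar, but their classes are taken in [M]: planar homotopies give equalities here,
    while the unique root property is available in [M] only. *)
Definition pcls (c : R -> Mpow n R2) := cls F (push \o c).

Lemma push_F z : F2 z -> F (push z).
Proof. by move=> Fz i j /ei /Fz. Qed.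

Lemma push_continuous : continuous push.
Proof.
apply: cont_Mpow => i; apply: (cont_comp ce).
by apply: (@cont_proj _ _ _ (fun z => z) i); exact: cont_id.
Qed.

Lemma pth_push x y c : pth F2 x y c -> pth F (push x) (push y) (push \o c).
Proof. exact: pth_comp push_continuous push_F _ _ _. Qed.

Lemma pcls_eq c d : hpt F2 c d -> pcls c = pcls d.
Proof. by move=> h; apply: cls_eq; exact: (hpt_comp push_continuous push_F h). Qed.

Lemma pcls_arr x y c : pth F2 x y c -> arr F (push x) (push y) (pcls c).
Proof. by move=> pc; apply: arr_cls; exact: pth_push. Qed.

Lemma pcls_cat x y z c d : pth F2 x y c -> pth F2 y z d ->
  cmul F (pcls c) (pcls d) = pcls (Cconcat c d).
Proof.
by move=> pc pd; rewrite /pcls (cmul_cls (pth_push pc) (pth_push pd)) comp_cat.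
Qed.

Lemma pcls_rev x y c : pth F2 x y c -> pcls (Creverse c) = cinv F (pcls c).
Proof. by move=> pc; rewrite /pcls (cinv_cls (pth_push pc)). Qed.

Lemma pcls_square (H : R2 -> Mpow n R2) : continuous H -> (forall u, F2 (H u)) ->
  cmul F (pcls (fun s => H (s, 0))) (pcls (fun t => H (1, t))) =
  cmul F (pcls (fun t => H (0, t))) (pcls (fun s => H (s, 1))).
Proof.
move=> cH FH; apply: (@cls_square _ F (push \o H)) => [|u]; last exact: push_F.
exact: (cont_comp push_continuous cH).
Qed.

Lemma pcls_free (H : R2 -> Mpow n R2) : continuous H -> (forall u, F2 (H u)) ->
  pcls (fun s => H (s, 0)) =
  cmul F (cmul F (pcls (fun t => H (0, t))) (pcls (fun s => H (s, 1))))
       (cinv F (pcls (fun t => H (1, t)))).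
Proof.
move=> cH FH; apply: (@cls_free _ F (push \o H)) => [|u]; last exact: push_F.
exact: (cont_comp push_continuous cH).
Qed.

Lemma pcls_act (s : 'S_n) c : cact s (pcls c) = pcls (act s \o c).
Proof. by rewrite /pcls cact_cls. Qed.

Lemma pcls_segments (G : R -> Mpow n R2) (t t' : R) : continuous G -> (forall s, F2 (G s)) ->
  pcls (fun s => G (t' * s)) =
  cmul F (pcls (fun s => G (t * s))) (pcls (fun s => G (t + (t' - t) * s))).
Proof.
move=> cG FG; apply: (@cls_segments _ F (push \o G)) => [|s]; last exact: push_F.
exact: (cont_comp push_continuous cG).
Qed.

Lemma tw_carry z z' k a c : pth [set z | F2 z /\ isolated z k a] z z' c ->
  pcls (tw z k a) = cmul F (cmul F (pcls c) (pcls (tw z' k a))) (cinv F (pcls c)).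
Proof.
move=> [cc Fc <- <-].
have := @pcls_free (fun u => tw (c u.2) k a u.1); rewrite /=.
have e0 : (fun t => tw (c t) k a 0) = c by apply/funext => t; rewrite tw0.
have e1 : (fun t => tw (c t) k a 1) = c by apply/funext => t; rewrite tw1.
rewrite e0 e1; apply; first by apply: cont_tw; cont.
by move=> u; have [? ?] := Fc u.2; exact: tw_F.
Qed.

Lemma tw_arr z k a : F2 z -> isolated z k a ->
  arr F (push z) (push z) (pcls (tw z k a)).
Proof. by move=> Fz iz; apply: pcls_arr; exact: tw_pth. Qed.

(** Both twists stay defined along [c], so both are conjugated by the same class, which cancels. *)
Lemma tw_eq_carry z z' k a k' a' c :
  pth [set z | [/\ F2 z, isolated z k a & isolated z k' a']] z z' c ->
  pcls (tw z k a) = pcls (tw z k' a') -> pcls (tw z' k a) = pcls (tw z' k' a').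
Proof.
move=> [cc Fc c0 c1].
have pc : pth F2 z z' c by split=> // t; case: (Fc t).
have ac := pcls_arr pc.
have [Fz' i1 i2] := Fc 1; rewrite c1 in Fz' i1 i2.
have p1 : pth [set z | F2 z /\ isolated z k a] z z' c by split=> // t; case: (Fc t).
have p2 : pth [set z | F2 z /\ isolated z k' a'] z z' c by split=> // t; case: (Fc t).
rewrite (tw_carry p1) (tw_carry p2) => h.
have a1 := tw_arr Fz' i1; have a2 := tw_arr Fz' i2.
rewrite -(cmulKr ac a1) -(cmulKr ac a2); congr cmul.
have aV := arr_inv ac.
by rewrite -(cmulrVK (arr_mul ac a1) ac) // h (cmulrVK (arr_mul ac a2) ac).
Qed.

Definition trivial_tw z k a := pcls (tw z k a) = cls F (Cconst (push z)).

Lemma trivial_tw_carry z z' k a c : pth [set z | F2 z /\ isolated z k a] z z' c ->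
  trivial_tw z k a -> trivial_tw z' k a.
Proof.
move=> pc; have [cc Fc c0 c1] := pc.
have p2 : pth F2 z z' c by split=> // t; case: (Fc t).
have ac := pcls_arr p2.
have [Fz' i1] := Fc 1; rewrite c1 in Fz' i1.
have a1 := tw_arr Fz' i1.
rewrite /trivial_tw (tw_carry pc) => h.
rewrite -(cmulKr ac a1) -(cmulrVK (arr_mul ac a1) ac) // h.
by rewrite (cmul1r ac) (cmulVr ac).
Qed.

Lemma tw_eq_act (s : 'S_n) z k a k' a' :
  pcls (tw z (s k) (s a)) = pcls (tw z (s k') (s a')) ->
  pcls (tw (act s z) k a) = pcls (tw (act s z) k' a').
Proof.
move=> /(congr1 (cact s)); rewrite !pcls_act.
have E k0 a0 : act s \o tw z (s k0) (s a0) = tw (act s z) k0 a0.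
  by apply/funext => t; exact: act_tw.
by rewrite !E.
Qed.

Lemma trivial_tw_act (s : 'S_n) z k a : trivial_tw z (s k) (s a) ->
  trivial_tw (act s z) k a.
Proof.
move=> /(congr1 (cact s)); rewrite pcls_act cact_cls /trivial_tw => h.
by rewrite -[RHS]h; congr pcls; apply/funext => t; rewrite /= act_tw.
Qed.

(** * Rotations of a disc and their roots *)

Section Rotation.
Variables (I : pred 'I_n) (r : R).

(** The labels in [I] turn about the origin and the others are frozen; under [in_disc] a circle
    separates the two groups, so no collision occurs. *)
Definition disc_spin th z : Mpow n R2 :=
  fun i => if I i then spin (0, 0) th (z i) else z i.

Definition in_disc z := forall i,
  if I i then dist (0, 0) (z i) < r else r <= dist (0, 0) (z i).

Lemma cont_disc_spin (T : topologicalType) (th : T -> R) (z : T -> Mpow n R2) :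
  continuous th -> continuous z -> continuous (fun t => disc_spin (th t) (z t)).
Proof.
move=> ct cz; apply: cont_Mpow => i; rewrite /disc_spin.
have cp : continuous (fun t => z t i) by exact: cont_proj.
by case: (I i) => //; apply: cont_spin; cont.
Qed.

Lemma cont_disc_spin_angle (th : R -> R) z :
  continuous th -> continuous (fun t => disc_spin (th t) z).
Proof. by move=> ct; apply: (@cont_disc_spin _ th (fun=> z)); cont. Qed.

Lemma disc_spin_F th z : F2 z -> in_disc z -> F2 (disc_spin th z).
Proof.
move=> Fz dz i j; rewrite /disc_spin; have := dz i; have := dz j.
have h v w : dist (0, 0) v < r -> r <= dist (0, 0) w -> spin (0, 0) th v <> w.
  by move=> hv hw e'; move: hw; rewrite -e' spin_dist_center; lra.
case: (I i); case: (I j) => dj di.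
- by move/spin_inj/Fz.
- by move=> e'; case: (h _ _ di dj).
- by move=> /esym e'; case: (h _ _ dj di).
- exact: Fz.
Qed.

Lemma disc_spin_in_disc th z : in_disc z -> in_disc (disc_spin th z).
Proof.
by move=> dz i; have := dz i; rewrite /disc_spin; case: (I i); rewrite ?spin_dist_center.
Qed.

Lemma disc_spin0 z : disc_spin 0 z = z.
Proof. by apply/funext => i; rewrite /disc_spin spin0; case: ifP. Qed.

Lemma disc_spin_2pi z : disc_spin (2 * pi) z = z.
Proof. by apply/funext => i; rewrite /disc_spin spin_2pi; case: ifP. Qed.

Lemma disc_spinD th th' z : disc_spin th (disc_spin th' z) = disc_spin (th + th') z.
Proof. by apply/funext => i; rewrite /disc_spin; case: (I i); rewrite ?spinD. Qed.

Definition full_spin z := pcls (fun t => disc_spin (2 * pi * t) z).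

(** The full rotation can be performed at any moment of a motion that respects the disc; for loops
    this says that it commutes with them. *)
Lemma full_spin_natural z z' q : pth [set z | F2 z /\ in_disc z] z z' q ->
  cmul F (pcls q) (full_spin z') = cmul F (full_spin z) (pcls q).
Proof.
move=> [cq Fq q0 q1].
have := @pcls_square (fun u => disc_spin (2 * pi * u.2) (q u.1)); rewrite /= q0 q1.
have e0 : (fun s => disc_spin (2 * pi * 0) (q s)) = q.
  by apply/funext => t; rewrite mulr0 disc_spin0.
have e1 : (fun s => disc_spin (2 * pi * 1) (q s)) = q.
  by apply/funext => t; rewrite mulr1 disc_spin_2pi.
rewrite e0 e1; apply; first by apply: cont_disc_spin; cont.
by move=> u; have [? ?] := Fq u.1; exact: disc_spin_F.
Qed.

Definition rotational (p : nat) (s : 'S_n) z :=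
  [/\ F2 z, in_disc z, (forall i, I (s i) = I i) &
      act s z = disc_spin (2 * pi / p%:R) z].

Definition part_spin (p : nat) z := fun t : R => disc_spin (2 * pi / p%:R * t) z.

Lemma part_spin_pth p s z : rotational p s z -> pth F2 z (act s z) (part_spin p z).
Proof.
move=> [Fz dz Is ->]; split; rewrite /part_spin.
- by apply: cont_disc_spin_angle; exact: cont_mull.
- by move=> t; exact: disc_spin_F.
- by rewrite mulr0 disc_spin0.
- by rewrite mulr1.
Qed.

(** Since [act s z] is [z] turned by [1 / p] of a turn, each translate of the partial rotation
    continues the preceding one. *)
Lemma part_spin_pow p s z : (0 < p)%N -> rotational p s z ->
  cpow (push z) s (pcls (part_spin p z)) p = full_spin z.
Proof.
move=> p0 [Fz dz Is es].
have main (k : nat) : cpow (push z) s (pcls (part_spin p z)) k =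
    pcls (fun t => disc_spin (2 * pi / p%:R * (k%:R * t)) z).
  elim: k => [|k IH] /=.
    rewrite /pcls; congr cls; apply/funext => t /=.
    by rewrite mul0r mulr0 disc_spin0.
  rewrite IH pcls_act.
  have := @pcls_segments (fun t => disc_spin (2 * pi / p%:R * t) z) 1 k.+1%:R.
  move=> ->; last 2 first.
  - by apply: cont_disc_spin_angle; exact: cont_mull.
  - by move=> t; exact: disc_spin_F.
  congr cmul; first by congr pcls; apply/funext => t; rewrite mul1r.
  congr pcls; apply/funext => t; rewrite /=.
  have -> : act s (disc_spin (2 * pi / p%:R * (k%:R * t)) z) =
      disc_spin (2 * pi / p%:R * (k%:R * t)) (act s z).
    by apply/funext => i; rewrite /act /disc_spin Is.
  rewrite es disc_spinD; congr disc_spin; rewrite -natr1; ring.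
rewrite main /full_spin; congr pcls; apply/funext => t; congr disc_spin.
by rewrite mulrA divfK // pnatr_eq0 -lt0n.
Qed.

(* [q x' (s' q)^-1] and [x] have the same [p]-th power, the full rotation. *)
Lemma rotational_roots p t i j z z' q : (0 < p)%N -> unique_roots (push z) t ->
  (t ^+ i ^+ p)%g = 1%g -> (t ^+ j ^+ p)%g = 1%g ->
  rotational p (t ^+ i)%g z -> rotational p (t ^+ j)%g z' ->
  pth [set z | F2 z /\ in_disc z] z z' q ->
  cmul F (cmul F (pcls q) (pcls (part_spin p z')))
    (cinv F (cact (t ^+ j)%g (pcls q))) = pcls (part_spin p z).
Proof.
move=> p0 U ti tj rz rz' pq.
have pq2 : pth F2 z z' q by case: pq => ? h ? ?; split=> // u; case: (h u).
have aq := pcls_arr pq2; have ax := pcls_arr (part_spin_pth rz).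
have ax' := pcls_arr (part_spin_pth rz').
have ajq := arr_act (t ^+ j)%g aq.
apply: (U p j i _ _ p0 _ ax).
  exact: arr_mul (arr_mul aq ax') (arr_inv ajq).
rewrite (cpow_conj _ aq ax') (part_spin_pow p0 rz') (part_spin_pow p0 rz).
rewrite (full_spin_natural pq) tj.
have -> : cact 1%g (pcls q) = pcls q.
  by rewrite pcls_act; congr pcls; apply/funext => u; rewrite /= act1.
have aX : arr F (push z) (push z) (full_spin z).
  have [Fz dz _ _] := rz; apply: pcls_arr; split.
  - by apply: cont_disc_spin_angle; exact: cont_mull.
  - by move=> u; exact: disc_spin_F.
  - by rewrite mulr0 disc_spin0.
  - by rewrite mulr1 disc_spin_2pi.
exact: cmulrK aX aq.
Qed.

Lemma disc_spin_tw th z k a t : I k -> I a ->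
  disc_spin th (tw z k a t) = tw (disc_spin th z) k a t.
Proof.
move=> Ik Ia; apply/funext => i; rewrite /disc_spin /tw /upd.
case: (eqVneq i k) => [->|//]; rewrite Ik Ia.
by rewrite /spin /=; congr pair; ring.
Qed.

(** Write [g] for the twist and [x] for the half rotation. Unique roots give [g x = x (t g)], while
    turning the configuration during the twist gives [g x = x g'], with [g'] the twist of [k] around
    [a] in the rotated configuration. Hence [t g = g'], and applying [t] yields the claim. The bound
    by [r] keeps the twist inside the disc. *)
Lemma tw_symmetric t z k a : unique_roots (push z) t -> (t * t)%g = 1%g ->
  rotational 2 t z -> I k -> I a -> isolated z k a ->
  dist (0, 0) (z a) + dist (z a) (z k) < r ->
  pcls (tw z k a) = pcls (tw z (t k) (t a)).
Proof.
move=> U tt rz Ik Ia iso small.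
have [Fz dz It et] := rz.
have pi2 : 2 * pi / 2%:R = pi :> R by rewrite mulrAC divff ?mul1r // pnatr_eq0.
rewrite pi2 in et.
have pg : pth [set z | F2 z /\ in_disc z] z z (tw z k a).
  have [cg Fg g0 g1] := tw_pth Fz iso; split=> // u; split=> // i.
  have := dz i; rewrite /tw /upd; case: (eqVneq i k) => [->|//]; rewrite Ik => _.
  have := dist_tri (z a) (0, 0) (spin (z a) (2 * pi * u) (z k)).
  by rewrite spin_dist_center; lra.
have pg2 := tw_pth Fz iso.
have := @rotational_roots 2 t 1 1 z z (tw z k a) isT U.
rewrite !expg1 expgS expg1 => /(_ tt tt rz rz pg) h.
have ag := pcls_arr pg2; have ax := pcls_arr (part_spin_pth rz).
have aag := arr_act t ag.
have h1 : cmul F (pcls (tw z k a)) (pcls (part_spin 2 z)) =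
    cmul F (pcls (part_spin 2 z)) (cact t (pcls (tw z k a))).
  by rewrite -[in RHS]h (cmulrVK (arr_mul ag ax) aag).
have ex : part_spin 2 z = fun u => disc_spin (pi * u) z.
  by apply/funext => u; rewrite /part_spin pi2.
rewrite ex in h1 ax.
have := @pcls_square (fun u => disc_spin (pi * u.2) (tw z k a u.1)).
rewrite /= tw0 tw1.
have -> : (fun s => disc_spin (pi * 0) (tw z k a s)) = tw z k a.
  by apply/funext => s; rewrite mulr0 disc_spin0.
have -> : (fun s => disc_spin (pi * 1) (tw z k a s)) = tw (act t z) k a.
  by apply/funext => s; rewrite mulr1 disc_spin_tw // et.
rewrite h1 => h2.
have atw : arr F (act t (push z)) (act t (push z)) (pcls (tw (act t z) k a)).
  have Fa : F2 (act t z) by exact: Fconf_act.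
  apply: (@tw_arr (act t z)) => //; rewrite et.
  split; first by case: iso.
  move=> l lk la; have [_ iz] := iso; have := iz l lk la.
  have di := disc_spin_in_disc pi dz.
  rewrite /disc_spin Ik Ia spin_dist; case: ifP => Il; first by rewrite spin_dist.
  move=> _; have := dist_tri (spin (0, 0) pi (z a)) (0, 0) (z l).
  by rewrite spin_dist_center; have := dz l; rewrite Il; lra.
have := cmulKr ax aag; rewrite h2; last 2 first.
- by apply: cont_disc_spin; [cont | apply: cont_tw; cont].
- by move=> u; have [_ /(_ u.1) [Fu du] _ _] := pg; exact: disc_spin_F.
rewrite (cmulKr ax atw) => /(congr1 (cact t)).
rewrite cactM tt !pcls_act => h3; symmetry.
have -> : pcls (tw z k a) = pcls (act 1 \o tw z k a).
  by congr pcls; apply/funext => u; rewrite /= act1.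
rewrite -h3; congr pcls; apply/funext => u /=.
have tK i : t (t i) = i by rewrite -permM tt perm1.
have -> : tw (act t z) k a u = tw (act t z) (t (t k)) (t (t a)) u by rewrite !tK.
by rewrite act_tw actM tt act1.
Qed.

End Rotation.
End Push.

(** * Permutations of odd prime order *)

Lemma spin_period c (k : nat) (th : R) v : spin c (th + 2 * pi * k%:R) v = spin c th v.
Proof.
elim: k => [|k IH]; first by rewrite mulr0 addr0.
have -> : th + 2 * pi * k.+1%:R = 2 * pi + (th + 2 * pi * k%:R) by rewrite -natr1; ring.
by rewrite -spinD spin_2pi.
Qed.

Lemma spin_fixed c (th : R) v : 0 < th < 2 * pi -> spin c th v = v -> v = c.
Proof.
move=> /andP[t0 t1] fx.
have s0 : 0 < sin (th / 2) by apply: sin_gt0_pi; apply/andP; split; lra.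
have c1 : cos th < 1.
  rewrite (_ : th = th / 2 + th / 2); last by lra.
  rewrite (@trigo.cosD R) -!expr2; have := cos2Dsin2 (th / 2); nra.
have [f1 f2] : cos th * (v.1 - c.1) - sin th * (v.2 - c.2) = v.1 - c.1 /\
    sin th * (v.1 - c.1) + cos th * (v.2 - c.2) = v.2 - c.2.
  by have := congr1 fst fx; have := congr1 snd fx; rewrite /spin /=; split; lra.
have cs := cos2Dsin2 th.
have h1 : (1 - cos th) * (v.1 - c.1) = 0.
  have : cos th * (cos th * (v.1 - c.1) - sin th * (v.2 - c.2)) +
    sin th * (sin th * (v.1 - c.1) + cos th * (v.2 - c.2)) =
    (cos th ^+ 2 + sin th ^+ 2) * (v.1 - c.1) by ring.
  rewrite cs f1 f2; lra.
have h2 : (1 - cos th) * (v.2 - c.2) = 0.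
  have : cos th * (sin th * (v.1 - c.1) + cos th * (v.2 - c.2)) -
    sin th * (cos th * (v.1 - c.1) - sin th * (v.2 - c.2)) =
    (cos th ^+ 2 + sin th ^+ 2) * (v.2 - c.2) by ring.
  rewrite cs f1 f2; lra.
have nz : 1 - cos th != 0 by apply/eqP; lra.
move/eqP: h1; rewrite mulf_eq0 (negbTE nz) /= subr_eq0 => /eqP h1.
move/eqP: h2; rewrite mulf_eq0 (negbTE nz) /= subr_eq0 => /eqP h2.
by rewrite [v]surjective_pairing h1 h2 -surjective_pairing.
Qed.

(** As the order of [t] divides the prime [p], the power [t ^+ d] generates the same group, so [t]
    is a power of it. *)
Lemma perm_fixed_pow (T : finType) (t : {perm T}) p d x : prime p -> (t ^+ p)%g = 1%g ->
  ~~ (p %| d)%N -> (t ^+ d)%g x = x -> t x = x.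
Proof.
move=> pp tp pd fx.
have : generator <[t]>%g (t ^+ d)%g.
  rewrite generator_coprime; apply: (@coprime_dvdl _ p).
    by rewrite order_dvdn tp.
  by rewrite prime_coprime.
move=> /eqP gt; have : (t \in <[t ^+ d]>)%g by rewrite -gt cycle_id.
move=> /cycleP [k ->]; rewrite permX; elim: k => //= k ->; exact: fx.
Qed.

(** Each nontrivial orbit gets its own circle, of radius one more than its root, and the place of
    [i] in its orbit, counted from the root, gives the angle in multiples of [2 * pi / p]. *)
Lemma rotational_position n (t : 'S_n) p : prime p -> (t ^+ p)%g = 1%g ->
  exists2 w : Mpow n R2, inj_on (fun i => t i != i) w &
    forall i, t i != i -> w (t i) = spin (0, 0) (2 * pi / p%:R) (w i).
Proof.
move=> pp tp; have p0 : (0 < p)%N by exact: prime_gt0.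
have pR : (0 : R) < p%:R by rewrite ltr0n.
have sym := fconnect_sym (@perm_inj _ t).
pose r i := froot t i; pose f i := findex t (r i) i.
have fE i : (t ^+ f i)%g (r i) = i.
  by rewrite permX; apply: iter_findex; rewrite sym; exact: connect_root.
have rt i : r (t i) = r i by apply/eqP; rewrite /r eq_sym (root_connect sym) fconnect1.
have moved i : t i != i -> t (r i) != r i.
  by apply: contra => /eqP tr; rewrite -(fE i) permX; elim: (f i) => [|k /eqP IH] /=;
    rewrite ?tr // IH IH.
have same i a b : t i != i -> (t ^+ a)%g i = (t ^+ b)%g i -> a = b %[mod p].
  move=> mi; wlog ab : a b / (a <= b)%N.
    by move=> h; have /orP[ab /(h _ _ ab) //|ba /esym /(h _ _ ba)] := leq_total a b.
  move=> e; apply/eqP; rewrite eq_sym eqn_mod_dvd //; apply: contraNT mi => pd.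
  apply/eqP; apply: (perm_fixed_pow pp tp pd); apply: (@perm_inj _ (t ^+ a)%g).
  by rewrite -permM -expgD subnK.
pose ang (k : nat) : R := 2 * pi / p%:R * k%:R.
have angmod k v : spin (0, 0) (ang k) v = spin (0, 0) (ang (k %% p)%N) v.
  have -> : ang k = ang (k %% p)%N + 2 * pi * (k %/ p)%:R; last exact: spin_period.
  by rewrite /ang {1}(divn_eq k p) natrD natrM; field; rewrite gt_eqF.
exists (fun i => spin (0, 0) (ang (f i %% p)%N) (1 + (r i)%:R, 0)).
  move=> i j mi mj e.
  have dr x y : dist (0, 0) (spin (0, 0) x (1 + y%:R, 0)) = 1 + y%:R.
    rewrite spin_dist_center dist_hor sub0r normrN ger0_norm //.
    by rewrite addr_ge0 // ler0n.
  have := dr (ang (f i %% p)%N) (r i); rewrite e dr => /addrI /eqP; rewrite eqr_nat => /eqP.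
  move=> /ord_inj rr.
  suff ff : (f i %% p = f j %% p)%N.
    by rewrite -(fE i) -(fE j) rr -(expg_mod (f i) tp) -(expg_mod (f j) tp) ff.
  pose v : R2 := (1 + (r j)%:R, 0).
  have nv : v <> (0, 0) by move=> [] h; have := ler0n R (r j); lra.
  (* For [a < b < p] the difference of the angles would be a rotation by less than a full turn
     fixing a point other than the centre. *)
  have key (a b : nat) : (b < p)%N -> spin (0, 0) (ang a) v = spin (0, 0) (ang b) v ->
      (b <= a)%N.
    move=> bp h; rewrite leqNgt; apply/negP => ab; apply: nv.
    have angD : ang b = ang a + ang (b - a)%N by rewrite /ang -mulrDr -natrD subnKC // ltnW.
    apply: (@spin_fixed _ (ang (b - a)%N)); last first.
      by apply: (@spin_inj (0, 0) (ang a)); rewrite spinD -angD.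
    have d0 : (0 : R) < (b - a)%:R by rewrite ltr0n subn_gt0.
    have d1 : (b - a)%:R < p%:R :> R by rewrite ltr_nat (leq_ltn_trans (leq_subr _ _)).
    have pi0 := @pi_gt0 R; rewrite /ang; apply/andP; split.
      by rewrite mulr_gt0 // divr_gt0 //; lra.
    by rewrite mulrAC ltr_pdivrMr // ltr_pM2l //; lra.
  rewrite -rr in e; apply/eqP; rewrite eqn_leq.
  by rewrite (key _ _ (ltn_pmod _ p0) e) (key _ _ (ltn_pmod _ p0) (esym e)).
move=> i mi; rewrite -!angmod rt.
have /same h : (t ^+ f (t i))%g (r i) = (t ^+ (f i).+1)%g (r i).
  by rewrite -{1}(rt i) fE expgSr permM fE.
rewrite angmod (h (moved i mi)) -angmod spinD; congr spin.
by rewrite /ang -natr1; ring.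
Qed.

Section OddOrder.
Context {n : nat} {M : topologicalType} (e : R2 -> M).
Hypotheses (ce : continuous e) (ei : injective e).
Variable t : 'S_n.
Hypothesis U : forall z, Fconf n M z -> unique_roots z t.

Lemma no_odd_order p : prime p -> odd p -> (t ^+ p)%g = 1%g -> t = 1%g.
Proof.
move=> pp po tp; have p0 : (0 < p)%N by exact: prime_gt0.
pose I : pred 'I_n := fun i => t i != i.
have [w iw hw] := rotational_position pp tp.
have tp' : ((t ^+ p.-1) ^+ p = 1)%g by rewrite -expgM mulnC expgM tp expg1n.
have [w' iw' hw'] := rotational_position pp tp'.
have tV : (t ^+ p.-1 = t^-1)%g.
  by apply: (mulgI t); rewrite -expgS prednK // tp mulgV.
have movedV i : ((t ^+ p.-1)%g i != i) = I i.
  by rewrite tV /I -(inj_eq (@perm_inj _ t)) permKV eq_sym.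
have {}iw' : inj_on I w'.
  by move=> i j Ii Ij; apply: iw'; rewrite movedV.
have {}hw' i : I i -> w' ((t ^+ p.-1)%g i) = spin (0, 0) (2 * pi / p%:R) (w' i).
  by move=> Ii; apply: hw'; rewrite movedV.
have [q [cq Iq q0 q1]] := configurations_connected surface_plane connected_plane iw iw'.
have cqi i : continuous (fun t => q t i) by exact: cont_proj.
have [B B0 hB] : exists2 B, 0 < B & forall i t, 0 <= t <= 1 -> dist (0, 0) (q t i) <= B.
  by apply: unit_bounded => i; apply: cont_dist; cont.
(* [B] bounds the whole motion of the moved labels, so the labels fixed by [t] can be parked on the
   axis at distance at least [B + 1], outside the rotating disc. *)
pose Q (v : Mpow n R2) : Mpow n R2 := fun i => if I i then v i else (B + 1 + i%:R, 0).
have dB (i : 'I_n) : dist (0, 0) (B + 1 + i%:R, 0) = B + 1 + i%:R.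
  rewrite dist_hor sub0r normrN ger0_norm //.
  by rewrite !addr_ge0 // ?ler0n // ltW.
have QD v : inj_on I v -> (forall i, dist (0, 0) (v i) <= B) ->
    Fconf n R2 (Q v) /\ in_disc I (B + 1) (Q v).
  move=> iv bv; split; last first.
    move=> i; rewrite /Q; case: (I i); first by have := bv i; lra.
    by rewrite dB lerDl ler0n.
  move=> i j; rewrite /Q; case Ii : (I i); case Ij : (I j).
  - exact: iv.
  - by move=> h; exfalso; have := bv i; rewrite h dB; have := ler0n R j; lra.
  - by move=> h; exfalso; have := bv j; rewrite -h dB; have := ler0n R i; lra.
  - by move=> [] /addrI /eqP; rewrite eqr_nat => /eqP /ord_inj.
have ccl := clamp_continuous.
have pQ : pth [set z | Fconf n R2 z /\ in_disc I (B + 1) z] (Q w) (Q w')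
    (fun t => Q (q (clamp t))).
  split; rewrite ?clamp0 ?clamp1 ?q0 ?q1 //.
  - apply: cont_Mpow => i; rewrite /Q; case: (I i); last exact: cont_cst.
    exact: (cont_comp (cqi i) ccl).
  - by move=> s; apply: QD => [|i]; [exact: Iq | apply: hB; exact: clamp01].
have rot (s : 'S_n) v : inj_on I v -> (forall i, dist (0, 0) (v i) <= B) ->
    (forall i, (s i != i) = I i) ->
    (forall i, I i -> v (s i) = spin (0, 0) (2 * pi / p%:R) (v i)) ->
    rotational I (B + 1) p s (Q v).
  move=> iv bv sI hv; have [F2 D] := QD v iv bv.
  have Is i : I (s i) = I i by rewrite -!sI (inj_eq (@perm_inj _ s)).
  split=> //; apply/funext => i; rewrite /act /disc_spin /Q Is.
  case Ii : (I i); first exact: hv.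
  by move: Ii; rewrite -sI => /negbFE /eqP ->.
have rw : rotational I (B + 1) p (t ^+ 1)%g (Q w).
  by rewrite expg1; apply: rot => // i; rewrite -q0; apply: hB; rewrite ?lexx ?ler01.
have rw' : rotational I (B + 1) p (t ^+ p.-1)%g (Q w').
  by apply: rot => // i; rewrite -q1; apply: hB; rewrite ?lexx ?ler01.
have Fw : Fconf n M (push e (Q w)) by apply: push_F => //; have [] := rw.
have := rotational_roots ce ei p0 (U Fw) _ tp' rw rw' pQ; rewrite expg1 => /(_ tp) h.
have pQ2 : pth (Fconf n R2) (Q w) (Q w') (fun t => Q (q (clamp t))).
  by have [? k ? ?] := pQ; split=> // s; case: (k s).
have aq := pcls_arr ce ei pQ2.
have ax := pcls_arr ce ei (part_spin_pth rw).
have ax' := pcls_arr ce ei (part_spin_pth rw').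
have := arr_mul (arr_mul aq ax') (arr_inv (arr_act (t ^+ p.-1)%g aq)).
rewrite h => /(arr_inj ax) [_].
rewrite expg1 => /(act_inj Fw) tt.
have t2 : (t ^+ 2 = 1)%g by rewrite expgS expg1 {2}tt tV mulgV.
move: tp; rewrite -(odd_double_half p) po expgD -mul2n expgM t2 expg1n mulg1 expg1.
by [].
Qed.

End OddOrder.

(** * Trivial twists *)

Lemma disc_convex c r v w t : dist c v <= r -> dist c w <= r -> 0 <= t <= 1 ->
  dist c (lerp t v w) <= r.
Proof.
move=> hv hw /andP[t0 t1].
have := dist_tri (lerp t v c) c (lerp t v w); rewrite lerp_dist ger0_norm //.
have -> : dist c (lerp t v c) = (1 - t) * dist c v.
  rewrite -{1}(lerp_id (1 - t) c) (_ : lerp t v c = lerp (1 - t) c v).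
    by rewrite lerp_dist ger0_norm //; lra.
  by rewrite /lerp; congr pair; ring.
nra.
Qed.

Lemma compact_separation (M : topologicalType) (x : M) (Q : set M) :
  hausdorff_space M -> compact [set: M] -> compact Q -> ~ Q x ->
  exists T W : set M, [/\ open T, open W, T x, Q `<=` W &
    forall y, T y -> W y -> False].
Proof.
move=> hM cM cQ nQ.
have oQ : open (~` Q) by apply: closed_openC; exact: compact_closed.
have nx : nbhs x (~` Q) by apply: open_nbhs_nbhs.
have nT : nbhs x [set: M] by exact: filterT.
have [A nA sA] := compact_regular hM cM nT nx.
exists (A^°), (~` closure A); split=> //.
- exact: open_interior.
- by apply: closed_openC; exact: closed_closure.
- by move=> y Qy clA; exact: sA clA Qy.
- by move=> y /interior_subset Ay; apply; exact: subset_closure.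
Qed.

(** This provides the sets [T] and [W] of [doubling]: the bound [B] makes the planar region compact,
    and compactness of [M] gives the regularity that separates its image from [e c]. *)
Lemma planar_separation (M : topologicalType) (e : R2 -> M) (c : R2) (B r : R) :
  hausdorff_space M -> compact [set: M] -> continuous e -> injective e -> 0 < r ->
  exists T W : set M, [/\ open T, open W, T (e c),
    forall v, `|v.1| <= B -> `|v.2| <= B -> r <= dist c v -> W (e v) &
    forall y, T y -> W y -> False].
Proof.
move=> hM cM ce ei r0.
pose K0 := [set v : R2 | [/\ `|v.1| <= B, `|v.2| <= B & r <= dist c v]].
have cl : closed [set v | r <= dist c v].
  rewrite -[X in closed X]setCK; apply: open_closedC.
  rewrite (_ : ~` _ = [set v | dist c v < r]).
    by apply: open_sublevel; apply: cont_dist; cont.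
  by rewrite predeqE => v /=; rewrite ltNge; split=> /negP.
have cK : compact K0.
  have := compact_setX (@segment_compact R (- B) B) (@segment_compact R (- B) B).
  move=> cX; have cI := compact_closedI cX cl.
  rewrite (_ : K0 = (`[(- B), B]%classic `*` `[(- B), B]%classic) `&` [set v | r <= dist c v]) //.
  rewrite predeqE => v; rewrite /K0 /= !in_itv /= !ler_norml.
  by split=> [[? ? ?]|[[? ?] ?]].
have cQ : compact (e @` K0) by apply: continuous_compact => //; exact: continuous_subspaceT.
have nQ : ~ (e @` K0) (e c).
  by move=> [v [_ _ h] /ei ev]; move: h; rewrite ev dist_refl; lra.
have [T [W [oT oW Tc QW dTW]]] := compact_separation hM cM cQ nQ.
by exists T, W; split=> // v v1 v2 hv; apply: QW; exists v.
Qed.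

Section Doubling.
Context {n : nat} {M : topologicalType} (e : R2 -> M).
Hypotheses (ce : continuous e) (ei : injective e).
Hypotheses (sM : surface_with_boundary M) (cM : compact [set: M]).
Local Notation F := (Fconf n M).
Local Notation F2 := (Fconf n R2).

Lemma conj_trivial (X : topologicalType) (A : set X) x y p q : arr A x y p -> arr A y y q ->
  cmul A (cmul A p q) (cinv A p) = cls A (Cconst x) -> q = cls A (Cconst y).
Proof.
move=> ap aq h; rewrite -(cmulKr ap aq) -(cmulrVK (arr_mul ap aq) ap) // h.
by rewrite (cmul1r ap) (cmulVr ap).
Qed.

Lemma conj_trivial' (X : topologicalType) (A : set X) x y p : arr A x y p ->
  cmul A (cmul A p (cls A (Cconst y))) (cinv A p) = cls A (Cconst x).
Proof. by move=> ap; rewrite (cmulr1 ap) (cmulrV ap). Qed.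

Variables (i1 i2 i3 : 'I_n).
Hypotheses (i12 : i1 != i2) (i13 : i1 != i3) (i23 : i2 != i3).
Variable z : Mpow n R2.
Hypotheses (Fz : F2 z) (z1 : z i1 = (-1, 0)) (z2 : z i2 = (1, 0)) (z3 : z i3 = (0, 0)).
Hypothesis far : forall l, l != i1 -> l != i2 -> l != i3 -> 5 <= dist (0, 0) (z l).

Lemma place_F (v w : R2) : v <> (-1, 0) -> w <> (-1, 0) -> v <> w ->
  dist (0, 0) v < 5 -> dist (0, 0) w < 5 -> F2 (upd (upd z i2 v) i3 w).
Proof.
move=> v1 w1 vw dv dw i j.
have f x l : dist (0, 0) x < 5 -> x <> (-1, 0) -> l != i2 -> l != i3 -> x <> z l.
  move=> dx x1 l2 l3; have [->|l1] := eqVneq l i1; first by rewrite z1.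
  by move=> ex; have := far l1 l2 l3; rewrite -ex; lra.
rewrite /upd; case: (eqVneq i i3) => [->|a3]; case: (eqVneq j i3) => [->|b3] //.
- by case: (eqVneq j i2) => [->|b2] e'; [case: vw | case: (f w j)].
- by case: (eqVneq i i2) => [->|a2] e'; [case: vw | case: (f w i)].
case: (eqVneq i i2) => [->|a2]; case: (eqVneq j i2) => [->|b2] // e'.
- by case: (f v j).
- by case: (f v i).
- exact: Fz.
Qed.

Lemma place_continuous (T : topologicalType) (v w : T -> R2) :
  continuous v -> continuous w -> continuous (fun t => upd (upd z i2 (v t)) i3 (w t)).
Proof.
move=> cv cw; apply: cont_Mpow => j; rewrite /upd.
by case: (j == i3) => //; case: (j == i2) => //; cont.
Qed.

Lemma twist31E t : tw z i3 i1 t = upd z i3 (spin (-1, 0) (2 * pi * t) (0, 0)).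
Proof. by rewrite /tw z1 z3. Qed.

Lemma twist32E t : tw z i3 i2 t = upd z i3 (spin (1, 0) (2 * pi * t) (0, 0)).
Proof. by rewrite /tw z2 z3. Qed.

Lemma iso31 : isolated z i3 i1.
Proof.
have d1 : dist (-1, 0) (0, 0) = 1 by rewrite dist_hor ler0_norm; lra.
split; first by rewrite eq_sym.
move=> l l3 l1; rewrite z1 z3 d1.
have [->|l2] := eqVneq l i2; first by rewrite z2 dist_hor ler0_norm; lra.
have := far l1 l2 l3; have := dist_tri (-1, 0) (0, 0) (z l); have := dist_tri (0, 0) (-1, 0) (z l).
by rewrite [dist (0, 0) (-1, 0)]distC d1; lra.
Qed.

Lemma iso32 : isolated z i3 i2.
Proof.
have d1 : dist (1, 0) (0, 0) = 1 by rewrite dist_hor ger0_norm; lra.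
split; first by rewrite eq_sym.
move=> l l3 l2; rewrite z2 z3 d1.
have [->|l1] := eqVneq l i1; first by rewrite z1 dist_hor ger0_norm; lra.
have := far l1 l2 l3; have := dist_tri (1, 0) (0, 0) (z l); have := dist_tri (0, 0) (1, 0) (z l).
by rewrite [dist (0, 0) (1, 0)]distC d1; lra.
Qed.

Lemma push_upd (v : Mpow n R2) (i : 'I_n) x : push e (upd v i x) = upd (push e v) i (e x).
Proof. by apply/funext => j; rewrite /push /upd; case: eqP. Qed.

Notation P := (pcls e).
Notation C1 := (fun x => cls F (Cconst (push e x))).

(** The outcome of [doubling]: [i3] is now a second point beside [i1], and [i2] starts at the
    origin. On the left [i2] runs around [i1] and [i3] together, on the right around the place
    [(1, 0)] that it has left. *)
Lemma pair_encircled : P (tw z i3 i1) = P (tw z i3 i2) ->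
  exists2 d : R, 0 < d < 2^-1 &
    P (fun t => upd (upd z i3 (-1 + d, 0)) i2 (spin (-1, 0) (2 * pi * t) (0, 0))) =
    P (fun t => upd (upd z i3 (-1 + d, 0)) i2 (spin (1, 0) (2 * pi * t) (0, 0))).
Proof.
move=> share; have hM := sM.1.
pose f t := spin (-1, 0) (2 * pi * t) (0, 0).
pose g t := spin (1, 0) (2 * pi * t) (0, 0).
have cf : continuous f by rewrite /f; apply: cont_spin; cont; exact: cont_mull.
have cg : continuous g by rewrite /g; apply: cont_spin; cont; exact: cont_mull.
have h31 := clsP (pth_push ce ei (tw_pth Fz iso32)) share.
have hK : hpt F (fun t => upd (push e z) i3 (e (f t))) (fun t => upd (push e z) i3 (e (g t))).
  rewrite (_ : (fun t => upd (push e z) i3 (e (f t))) = push e \o tw z i3 i1); last first.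
    by apply/funext => t; rewrite /comp twist31E push_upd.
  rewrite (_ : (fun t => upd (push e z) i3 (e (g t))) = push e \o tw z i3 i2) //.
  by apply/funext => t; rewrite /comp twist32E push_upd.
pose B := 10 + \sum_j (`|(z j).1| + `|(z j).2|).
have sum0 (P : pred 'I_n) : 0 <= \sum_(j | P j) (`|(z j).1| + `|(z j).2|).
  by apply: sumr_ge0 => j _; rewrite addr_ge0.
have Bz j : `|(z j).1| <= B /\ `|(z j).2| <= B.
  rewrite /B (bigD1 j) //=; have := sum0 (fun k => k != j).
  by have := normr_ge0 (z j).1; have := normr_ge0 (z j).2; split; lra.
have B10 : 10 <= B by rewrite /B; have := sum0 predT; lra.
have r0 : (0 : R) < 2^-1 by lra.
have [T [W [oT oW Tz Wv dTW]]] := planar_separation (-1, 0) B hM cM ce ei r0.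
have coord (v : R2) : `|v.1| <= dist (0, 0) v /\ `|v.2| <= dist (0, 0) v.
  have := dist_sqr (0, 0) v; have := dist_ge0 (0, 0) v => /=.
  have := sqr_ge0 v.1; have := sqr_ge0 v.2.
  by rewrite !ler_norml; split; apply/andP; split; nra.
have Wn v : dist (0, 0) v < 5 -> 2^-1 <= dist (-1, 0) v -> W (e v).
  by move=> dv h; have [h1 h2] := coord v; apply: Wv => //; lra.
have d10 : dist (-1, 0) (0, 0) = 1 by rewrite dist_hor ler0_norm; lra.
have d20 : dist (1, 0) (0, 0) = 1 by rewrite dist_hor ger0_norm; lra.
have d12 : dist (-1, 0) (1, 0) = 2 by rewrite dist_hor ler0_norm; lra.
have df t : dist (-1, 0) (f t) = 1 by rewrite spin_dist_center.
have dg t : dist (1, 0) (g t) = 1 by rewrite spin_dist_center.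
have Wf t : W (e (f t)).
  apply: Wn; rewrite ?df; last by lra.
  by have := dist_tri (-1, 0) (0, 0) (f t); rewrite df [dist (0, 0) (-1, 0)]distC d10; lra.
have Wg t : W (e (g t)).
  have := dg t; have := dist_tri (g t) (-1, 0) (1, 0); rewrite [dist (g t) _]distC d12 => ? ?.
  apply: Wn; last by lra.
  by have := dist_tri (1, 0) (0, 0) (g t); rewrite [dist (0, 0) (1, 0)]distC d20; lra.
have Wz j : j != i1 -> W (push e z j).
  move=> j1; have [h1 h2] := Bz j; apply: Wv => //.
  have [->|j2] := eqVneq j i2; first by rewrite z2 d12; lra.
  have [->|j3] := eqVneq j i3; first by rewrite z3 d10; lra.
  have := far j1 j2 j3; have := dist_tri (-1, 0) (0, 0) (z j).
  by rewrite [dist (0, 0) (-1, 0)]distC d10; lra.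
(* The straight way of [i2] from its own place [(1, 0)] to the origin, the former place of [i3]. *)
pose eta t : R2 := (1 - clamp t, 0).
have ccl := clamp_continuous.
have ceta : continuous eta by rewrite /eta; cont.
have deta t : dist (0, 0) (eta t) <= 1 /\ 1 <= dist (-1, 0) (eta t).
  have /andP[c0 c1] := clamp01 t.
  by rewrite /eta !dist_hor !ler0_norm; lra.
have peta : pth [set x | W x /\ forall j, j != i2 -> j != i3 -> push e z j <> x]
    (push e z i2) (push e z i3) (e \o eta).
  split; rewrite /push /eta /= ?clamp0 ?clamp1 ?z2 ?z3 ?subr0 ?subrr //.
  - exact: (cont_comp ce ceta).
  - move=> t; have [h1 h2] := deta t; split; first by apply: Wn; rewrite -/(eta t); lra.
    move=> j j2 j3 /ei; rewrite -/(eta t) => ej.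
    have [j1|j1] := eqVneq j i1.
      by move: h2; rewrite -ej j1 z1 dist_refl; lra.
    by have := far j1 j2 j3; rewrite ej; lra.
have [V dV [Vz hV]] := @doubling n M i1 i2 i3 (push e z) (e \o f) (e \o g) (e \o eta) T W
  sM i12 i13 i23 hK (cont_comp ce cf) (cont_comp ce cg)
  ltac:(by rewrite /f /push /= mulr0 spin0 z3) ltac:(by rewrite /f /push /= mulr1 spin_2pi z3)
  oT oW dTW ltac:(by rewrite /push z1) Wz Wf Wg peta.
have nV : nbhs (0 : R) [set s : R | V (e (-1 + s, 0))].
  have cs : continuous (fun s : R => e (-1 + s, 0)) by apply: (cont_comp ce); cont.
  apply: (cs 0); apply: open_nbhs_nbhs; split; first exact: disc_open.
  by rewrite addr0 -z1.
have /nbhs_ballP [d' /= d0 hd] := nV.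
pose d := Num.min (d' / 2) (1 / 4).
have dd : 0 < d < 2^-1 /\ d < d'.
  by rewrite /d minEle; case: (leP (d' / 2) (1 / 4)) => h; split; lra.
have [db dd'] := dd; exists d => //.
have Vw : V (e (-1 + d, 0)).
  apply: hd; rewrite /ball /= sub0r normrN gtr0_norm //.
  by move/andP: db => [].
have wz : e (-1 + d, 0) <> push e z i1.
  by rewrite /push z1 => /ei [] h; move: db; rewrite (@addrI _ (-1) d 0) ?addr0 // ltxx.
have /cls_eq := hV _ Vw wz.
have E (h : R -> R2) : (fun t => upd (upd (push e z) i3 (e (-1 + d, 0))) i2 ((e \o h) t)) =
    push e \o (fun t => upd (upd z i3 (-1 + d, 0)) i2 (h t)).
  by apply/funext => t; rewrite /comp !push_upd.
by rewrite !E.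
Qed.

(** The two ends have the same track, so the loops at heights 0 and 1 are conjugate and one is
    trivial exactly when the other is. *)
Lemma loop_conj (H : R2 -> Mpow n R2) : continuous H -> (forall u, F2 (H u)) ->
  (forall t, H (1, t) = H (0, t)) ->
  P (fun s => H (s, 0)) = C1 (H (0, 0)) <-> P (fun s => H (s, 1)) = C1 (H (0, 1)).
Proof.
move=> cH FH per; have := pcls_free ce ei cH FH.
have -> : (fun t => H (1, t)) = (fun t => H (0, t)) by apply/funext.
have pc : pth F2 (H (0, 0)) (H (0, 1)) (fun t => H (0, t)) by split=> //; cont.
have pq : pth F2 (H (0, 1)) (H (0, 1)) (fun s => H (s, 1)) by split=> //; cont.
have ac := pcls_arr ce ei pc; have aq := pcls_arr ce ei pq.
move=> ->; split=> [|->]; first exact: conj_trivial.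
exact: conj_trivial'.
Qed.

Notation C v w := (upd (upd z i2 v) i3 w).

Lemma swap_labels v w : upd (upd z i3 v) i2 w = act (tperm i2 i3) (C v w).
Proof.
apply/funext => j; rewrite /act /upd; case: tpermP => [->|->|/eqP j2 /eqP j3].
- by rewrite !eqxx.
- by rewrite eq_sym (negbTE i23) !eqxx.
- by rewrite (negbTE j2) (negbTE j3).
Qed.

Lemma place_far (x r : R) c v : -1 < x -> x < 3 -> dist c v = r ->
  dist (0, 0) c + r < 5 -> dist c (-1, 0) < r -> dist c (x, 0) < r -> F2 (C (x, 0) v).
Proof.
move=> x0 x1 dv d5 d1 dx.
have ne w : dist c w < r -> w <> v by move=> dw e'; move: dw; rewrite e' dv ltxx.
apply: place_F.
- by move=> [] h; move: x0; rewrite h ltxx.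
- by apply/nesym; exact: ne.
- exact: ne.
- by rewrite dist_hor sub0r normrN ltr_norml; apply/andP; split; lra.
- have := dist_tri c (0, 0) v; lra.
Qed.

(** The loop contracts to its base point in the closed unit disc about [(1, 0)], which contains
    neither [i1] at [(-1, 0)] nor [i2] at [(-1 + d, 0)]. *)
Lemma empty_circle (d : R) : 0 < d < 2^-1 ->
  P (fun t => C (-1 + d, 0) (spin (1, 0) (2 * pi * t) (0, 0))) = C1 (C (-1 + d, 0) (0, 0)).
Proof.
move=> /andP[d0 d1]; pose B : set R2 := [set v | dist (1, 0) v <= 1].
have d20 : dist (1, 0) (0, 0) = 1 by rewrite dist_hor ger0_norm; lra.
apply: (pcls_eq ce ei).
apply: (@hpt_convex _ F2 B (fun v => C (-1 + d, 0) v) _ (fun=> (0, 0))).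
- by move=> v w t hv hw; exact: disc_convex.
- by apply: place_continuous; cont.
- move=> v; rewrite /B /= => dv.
  have ne x : x < 0 -> v <> (x, 0).
    by move=> x0 e'; move: dv; rewrite e' dist_hor ger0_norm; lra.
  apply: place_F.
  + by move=> [] h; move: d0; rewrite (@addrI _ (-1) d 0) ?addr0 // ltxx.
  + by apply: ne; lra.
  + by apply/nesym; apply: ne; lra.
  + by rewrite dist_hor ger0_norm; lra.
  + by have := dist_tri (1, 0) (0, 0) v; rewrite [dist (0, 0) (1, 0)]distC d20; lra.
- by apply: cont_spin; cont; exact: cont_mull.
- by cont.
- by move=> t; rewrite /B /= spin_dist_center d20.
- by move=> t; rewrite /B /= d20.
- by rewrite mulr0 spin0.
- by rewrite mulr1 spin_2pi.
Qed.

(** The circle grows with centre [-1 + l] and radius [1 + l], while [i2] travels from beside [i1] to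
    [(1, 0)], always inside it. Turning the start by a quarter turn makes the final circle begin at
    [(0, 2)]. *)
Lemma big_circle (d : R) : 0 < d < 2^-1 ->
  P (fun t => C (-1 + d, 0) (spin (-1, 0) (2 * pi * t) (0, 0))) = C1 (C (-1 + d, 0) (0, 0)) ->
  P (fun t => upd z i3 (2 * - sin (2 * pi * t), 2 * cos (2 * pi * t))) =
    C1 (upd z i3 (0, 2)).
Proof.
move=> /andP[d0 d1] h.
have ccl := clamp_continuous.
pose x (l : R) : R := -1 + d + l * (2 - d).
pose H (u : R2) := C (x (clamp u.2), 0)
  (spin (-1 + clamp u.2, 0) (2 * pi * u.1 + pi / 2 * clamp u.2) (2 * clamp u.2, 0)).
have cH : continuous H.
  by apply: place_continuous; rewrite /x; [cont | apply: cont_spin; cont].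
have FH u : F2 (H u).
  have /andP[l0 l1] := clamp01 u.2; set l := clamp u.2 in l0 l1 *.
  have xl : x l = -1 + l + (d + l * (1 - d)) by rewrite /x; ring.
  have xd : 0 <= l * (1 - d) <= l by apply/andP; split; nra.
  move/andP: xd => [xd0 xd1].
  apply: (@place_far _ (1 + l) (-1 + l, 0)); rewrite -/l.
  - by rewrite xl; lra.
  - by rewrite xl; lra.
  - by rewrite spin_dist_center dist_hor ler0_norm; lra.
  - by rewrite dist_hor ger0_norm; lra.
  - by rewrite dist_hor ger0_norm; lra.
  - by rewrite dist_hor xl ler0_norm; lra.
have per t : H (1, t) = H (0, t).
  rewrite /H /=; congr (C _ _); rewrite mulr1 mulr0 add0r.
  by rewrite -spinD spin_2pi.
have [h1 _] := loop_conj cH FH per.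
have E0 : (fun s => H (s, 0)) = (fun t => C (-1 + d, 0) (spin (-1, 0) (2 * pi * t) (0, 0))).
  by apply/funext => s; rewrite /H /x /= clamp0 !(mulr0, mul0r, addr0).
have Ez : upd z i2 (1, 0) = z.
  by apply/funext => j; rewrite /upd -z2; case: eqP => // ->.
have E1 : (fun s => H (s, 1)) =
    (fun t => upd z i3 (2 * - sin (2 * pi * t), 2 * cos (2 * pi * t))).
  apply/funext => s; rewrite /H /x /= clamp1 mul1r !mulr1.
  rewrite (_ : -1 + d + (2 - d) = 1); last by ring.
  rewrite Ez addNr; congr upd; rewrite addrC -spinD /spin /= cos_pihalf sin_pihalf.
  by congr pair; ring.
have := h1; rewrite E0 E1.
have -> : H (0, 0) = C (-1 + d, 0) (0, 0).
  by have := congr1 (@^~ 0) E0; rewrite mulr0 spin0.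
have -> : H (0, 1) = upd z i3 (0, 2).
  have := congr1 (@^~ 0) E1; rewrite mulr0 sin0 cos0 => ->.
  by congr upd; congr pair; ring.
exact.
Qed.

(* Scaling the big circle by [`|sin|] pinches it into the two small ones. *)
Lemma figure_eight :
  P (fun t => upd z i3 (2 * - sin (2 * pi * t), 2 * cos (2 * pi * t))) =
    C1 (upd z i3 (0, 2)) ->
  cmul F (P (tw z i3 i1)) (P (tw z i3 i2)) = C1 z.
Proof.
move=> h.
have ccl := clamp_continuous.
pose k (u : R2) : R := `|sin (2 * pi * u.1)| * (1 - clamp u.2) + clamp u.2.
pose m (u : R2) : R2 := (k u * (2 * - sin (2 * pi * u.1)), k u * (2 * cos (2 * pi * u.1))).
pose H (u : R2) := upd z i3 (m u).
have Ez : upd z i2 (1, 0) = z.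
  by apply/funext => j; rewrite /upd -z2; case: eqP => // ->.
have cH : continuous H.
  by apply: upd_continuous; rewrite /m /k; cont.
have k01 u : 0 <= k u <= 1.
  have /andP[l0 l1] := clamp01 u.2; rewrite /k.
  have := normr_ge0 (sin (2 * pi * u.1)).
  have : `|sin (2 * pi * u.1)| <= 1 by rewrite ler_norml sin_geN1 sin_le1.
  by move=> ? ?; apply/andP; split; nra.
(* The curve meets the axis at the origin, where [k] vanishes, or where the cosine is 0; there [k]
   is 1 and the abscissa is 2 or -2, never the place of [i1] or [i2]. *)
have key u x : `|x| = 1 -> m u <> (x, 0).
  move=> x1 [] e1 /eqP; rewrite mulf_eq0 => /orP[/eqP k0|].
    by move: x1; rewrite -e1 k0 mul0r normr0 => /eqP; rewrite eq_sym oner_eq0.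
  rewrite mulf_eq0 pnatr_eq0 /= => /eqP c0.
  have s1 : `|sin (2 * pi * u.1)| = 1.
    have := cos2Dsin2 (2 * pi * u.1); rewrite c0 expr0n add0r => /eqP.
    by rewrite sqrf_eq1 => /orP[] /eqP ->; rewrite ?normrN normr1.
  have k1 : k u = 1 by rewrite /k s1; ring.
  move: x1; rewrite -e1 k1 mul1r normrM normrN s1 normr_nat mulr1.
  by move=> /eqP; rewrite (eqr_nat R 2 1).
have FH u : F2 (H u).
  rewrite /H -Ez; apply: place_F.
  - by move=> [] /eqP; rewrite -subr_eq0 opprK -(natrD R 1 1) pnatr_eq0.
  - by apply: key; rewrite normrN normr1.
  - by apply/nesym; apply: key; rewrite normr1.
  - by rewrite dist_hor sub0r normrN normr1; lra.
  - apply: dist_lt; rewrite //= !sub0r !sqrrN.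
    have /andP[k0 k1] := k01 u; have := cos2Dsin2 (2 * pi * u.1) => cs.
    rewrite (_ : _ + _ = 4 * k u ^+ 2 * (cos (2 * pi * u.1) ^+ 2 + sin (2 * pi * u.1) ^+ 2)).
      by rewrite cs; nra.
    by rewrite /=; ring.
have per t : H (1, t) = H (0, t).
  by rewrite /H /m /k /= mulr1 mulr0 mulr_natl sin2pi cos2pi sin0 cos0.
have [_ h1] := loop_conj cH FH per.
have E1 : (fun s => H (s, 1)) =
    (fun t => upd z i3 (2 * - sin (2 * pi * t), 2 * cos (2 * pi * t))).
  by apply/funext => s; rewrite /H /m /k /= clamp1 subrr mulr0 add0r !mul1r.
have H01 : H (0, 1) = upd z i3 (0, 2).
  by rewrite /H /m /k /= clamp1 subrr mulr0 add0r !mul1r mulr0 sin0 cos0 oppr0 mulr0 mulr1.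
have H00 : H (0, 0) = z.
  rewrite /H /m /k /= clamp0 mulr0 sin0 normr0 mul0r addr0 !mul0r -z3.
  by apply/funext => j; rewrite /upd; case: eqP => // ->.
rewrite E1 H01 H00 in h1; have h2 := h1 h.
rewrite (pcls_cat ce ei (tw_pth Fz iso31) (tw_pth Fz iso32)) -h2.
have pc := pth_cat (tw_pth Fz iso31) (tw_pth Fz iso32).
apply: (pcls_eq ce ei); apply: (hpt_eq pc (y := z)).
  split=> //; first by cont.
  by rewrite per H00.
move=> t /andP[t0 t1]; rewrite /Cconcat twist31E twist32E /H.
have pi0 := @pi_gt0 R; have cs := cos2Dsin2 (2 * pi * t).
have dbl : cos (2 * pi * t + 2 * pi * t) = cos (2 * pi * t) ^+ 2 - sin (2 * pi * t) ^+ 2 /\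
    sin (2 * pi * t + 2 * pi * t) = 2 * sin (2 * pi * t) * cos (2 * pi * t).
  by rewrite (@trigo.cosD R) (@trigo.sinD R); split; ring.
(* By the formulas for the double angle, [|sin|] times the circle of radius 2 is the unit circle
   about [(-1, 0)] while the sine is positive, and the one about [(1, 0)] while it is negative. *)
case: ifP => th; congr upd.
- have s0 : 0 <= sin (2 * pi * t) by apply: sin_ge0_pi; apply/andP; split; nra.
  rewrite /m /k /= clamp0 subr0 mulr1 addr0 ger0_norm //.
  rewrite (_ : 2 * pi * (2 * t) = 2 * pi * t + 2 * pi * t); last by ring.
  by rewrite /spin /= dbl.1 dbl.2; congr pair; nra.
- have th' : 2^-1 < t by rewrite ltNge th.
  have s0 : sin (2 * pi * t) <= 0.
    rewrite (_ : 2 * pi * t = (2 * pi * t - pi) + pi); last by ring.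
    by rewrite sinDpi oppr_le0; apply: sin_ge0_pi; apply/andP; split; nra.
  rewrite /m /k /= clamp0 subr0 mulr1 addr0 ler0_norm //.
  rewrite -[LHS](spin_2pi (1, 0)) spinD.
  rewrite (_ : 2 * pi + 2 * pi * (2 * t - 1) = 2 * pi * t + 2 * pi * t); last by ring.
  by rewrite /spin /= dbl.1 dbl.2; congr pair; nra.
Qed.

(** Exchanging the labels [i2] and [i3] in [pair_encircled] lets [i3] be the running strand, as the
    circles above require. *)
Lemma triple_trivial : P (tw z i3 i1) = P (tw z i3 i2) ->
  cmul F (P (tw z i3 i1)) (P (tw z i3 i2)) = C1 z.
Proof.
move=> share; have [d db encircled] := pair_encircled share.
apply: figure_eight; apply: (big_circle db); rewrite -(empty_circle db).
have E (h : R -> R2) : P (fun t => C (-1 + d, 0) (h t)) =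
    cact (tperm i2 i3) (P (fun t => upd (upd z i3 (-1 + d, 0)) i2 (h t))).
  rewrite pcls_act; congr pcls; apply/funext => t /=.
  by rewrite swap_labels actM tperm2 act1.
by rewrite !E encircled.
Qed.

End Doubling.

Lemma perm_extend (T : finType) (xs ys : seq T) : uniq xs -> uniq ys ->
  size xs = size ys -> exists s : {perm T}, map s xs = ys.
Proof.
elim: xs ys => [|x xs IH] [|y ys] //=; first by exists 1%g.
move=> /andP[xn ux] /andP[yn uy] [] /(IH _ ux uy) [s es].
exists (s * tperm (s x) y)%g; rewrite permM tpermL; congr cons.
rewrite -es; apply/eq_in_map => i ix; rewrite permM tpermD //.
  by rewrite (inj_eq perm_inj); apply: contraNneq xn => ->.
by apply: contraNneq yn => ->; rewrite -es map_f.
Qed.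

(** * Pairs turning about their midpoints *)

Section Involution.
Context {n : nat} {M : topologicalType} (e : R2 -> M).
Hypotheses (ce : continuous e) (ei : injective e).
Local Notation F := (Fconf n M).
Local Notation F2 := (Fconf n R2).
Local Notation P := (pcls e).
Local Notation C1 := (fun x => cls F (Cconst (push e x))).
Implicit Types (z : Mpow n R2) (i j k l a : 'I_n).

(** Simultaneous independent motions are a product: the diagonal of a square is homotopic to the
    bottom followed by the right side. *)
Lemma pcls_diag (H : R2 -> Mpow n R2) : continuous H -> (forall u, F2 (H u)) ->
  P (fun t => H (t, t)) = cmul F (P (fun t => H (t, 0))) (P (fun t => H (1, t))).
Proof.
move=> cH FH.
have p1 : pth F2 (H (0, 0)) (H (1, 0)) (fun t => H (t, 0)) by split=> //; cont.
have p2 : pth F2 (H (1, 0)) (H (1, 1)) (fun t => H (1, t)) by split=> //; cont.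
rewrite (pcls_cat ce ei p1 p2); apply: (pcls_eq ce ei).
pose q := Cconcat (fun t : R => (t, 0) : R2) (fun t : R => (1, t)).
have -> : Cconcat (fun t => H (t, 0)) (fun t => H (1, t)) = H \o q.
  by rewrite /q comp_cat.
have pq : pth [set: R2] (0, 0) (1, 1) q.
  have r1 : pth [set: R2] (0, 0) (1, 0) (fun t : R => (t, 0)) by split=> //; cont.
  have r2 : pth [set: R2] (1, 0) (1, 1) (fun t : R => (1, t)) by split=> //; cont.
  exact: pth_cat r1 r2.
have [cq _ q0 q1] := pq.
by apply: (@hpt_line _ _ H (fun t => (t, t)) q) => //; rewrite ?q0 ?q1 //; cont.
Qed.

Lemma spins_F z (c : 'I_n -> R2) (th : 'I_n -> R) : F2 z ->
  (forall i j, (c i = c j /\ th i = th j) \/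
     dist (c i) (z i) + dist (c j) (z j) < dist (c i) (c j)) ->
  F2 (fun i => spin (c i) (th i) (z i)).
Proof.
move=> Fz h i j eij; have [[ec eth]|lt] := h i j.
  by apply: Fz; apply: (@spin_inj (c j) (th j)); rewrite -{1}ec -{1}eth.
exfalso; have := dist_tri (spin (c i) (th i) (z i)) (c i) (c j).
rewrite {2}eij spin_dist_center [dist (spin _ _ _) _]distC spin_dist_center; lra.
Qed.

Lemma cont_spins (T : topologicalType) z (c : 'I_n -> R2) (th : T -> 'I_n -> R) :
  (forall i, continuous (fun x => th x i)) ->
  continuous (fun x => (fun i => spin (c i) (th x i) (z i)) : Mpow n R2).
Proof.
by move=> ct; apply: cont_Mpow => i; apply: cont_spin => //; [cont | cont].
Qed.

Lemma dist_move2 v v' w r : dist (move v w r) (move v' w r) = dist v v'.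
Proof. by rewrite /dist /move /=; congr Num.sqrt; ring. Qed.

(* Translating the rotating pair so that [a] stays in place. *)
Lemma pair_rotation z k a (c := lerp 2^-1 (z a) (z k)) : F2 z -> k != a ->
  (forall l, l != k -> l != a -> 3 / 2 * dist (z a) (z k) < dist c (z l)) ->
  P (fun t => (fun i => spin c (2 * pi * (if (i == k) || (i == a) then t else 0)) (z i)) : Mpow n R2)
  = P (tw z k a).
Proof.
move=> Fz ka far; set D := dist (z a) (z k) in far.
have D0 : 0 < D by apply: dist_gt0 => /Fz /eqP; rewrite eq_sym (negbTE ka).
have ccl := clamp_continuous.
pose sp (u : R) v := spin c (2 * pi * u) v.
pose w u : R2 := ((z a).1 - (sp u (z a)).1, (z a).2 - (sp u (z a)).2).
pose H (u : R2) : Mpow n R2 := fun i => if (i == k) || (i == a)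
  then move (sp u.1 (z i)) (w u.1) (clamp u.2) else z i.
have half (v v' : R2) : dist (lerp 2^-1 v v') v = dist v v' / 2.
  by rewrite -{2}(lerp_id 2^-1 v) lerp_dist ger0_norm ?invr_ge0 // distC mulrC.
have ca : dist c (z a) = D / 2 by exact: half.
have ck : dist c (z k) = D / 2.
  rewrite /c (_ : lerp _ _ _ = lerp 2^-1 (z k) (z a)) ?half 1?distC //.
  by rewrite /lerp; congr pair; field.
have dw u : dist (0, 0) (w u) <= D.
  have := spin_dist_self c (2 * pi * u) (z a); rewrite ca -/(sp u (z a)).
  have -> : dist (z a) (sp u (z a)) = dist (0, 0) (w u).
    by rewrite /dist /w /=; congr Num.sqrt; ring.
  lra.
have FH u : F2 (H u).
  (* The turning labels stay at distance [D / 2] from the centre and the translation adds at most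
     [D], whence the constant [3 / 2]. *)
  have near i : (i == k) || (i == a) -> dist c (move (sp u.1 (z i)) (w u.1) (clamp u.2)) <= 3 / 2 * D.
    move=> hi; have /andP[h0 h1] := clamp01 u.2.
    have := dist_tri (sp u.1 (z i)) c (move (sp u.1 (z i)) (w u.1) (clamp u.2)).
    rewrite dist_move // spin_dist_center.
    have -> : dist c (z i) = D / 2 by case/orP: hi => /eqP ->.
    have := dw u.1; have := dist_ge0 (0, 0) (w u.1); nra.
  have ne i l : (i == k) || (i == a) -> ~~ ((l == k) || (l == a)) ->
      move (sp u.1 (z i)) (w u.1) (clamp u.2) <> z l.
    move=> hi; rewrite negb_or => /andP[lk la] h.
    by have := near i hi; rewrite h; have := far l lk la; lra.
  move=> i j; rewrite /H; case hi : (_ || _); case hj : (_ || _) => h.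
  - have := dist_refl (move (sp u.1 (z i)) (w u.1) (clamp u.2)).
    by rewrite {2}h dist_move2 spin_dist => /dist_eq0 /Fz.
  - by case: (ne i j hi (negbT hj)).
  - by case: (ne j i hj (negbT hi)).
  - exact: Fz.
apply: (pcls_eq ce ei); exists H; split=> //.
- apply: cont_Mpow => i; rewrite /H; case: (_ || _); last exact: cont_cst.
  by rewrite /move /w /sp /spin; cont.
- move=> s; apply/funext => i; rewrite /H /= clamp0; case: (_ || _).
    by rewrite /move !mul0r !addr0 -surjective_pairing.
  by rewrite mulr0 spin0.
- move=> s; apply/funext => i; rewrite /H /= clamp1 /tw /upd.
  case: (eqVneq i k) => [->|ik] /=.
    by rewrite /move /w /sp /spin /=; congr pair; ring.
  case: (eqVneq i a) => [->|//].
  by rewrite /move /w /sp /= [RHS]surjective_pairing; congr pair; ring.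
- have ends u : sp u (z a) = z a -> (forall i, sp u (z i) = z i) -> forall t,
      H (u, t) = (fun i => spin c (2 * pi * (if (i == k) || (i == a) then u else 0)) (z i)).
    move=> ea eu t; apply/funext => i; rewrite /H /=; case: ifP => _.
      rewrite -/(sp u (z i)) !eu /move /w ea !subrr !mulr0 !addr0 -surjective_pairing //.
    by rewrite mulr0 spin0.
  by move=> t; split; apply: ends => *; rewrite /sp ?mulr0 ?mulr1 ?spin0 ?spin_2pi.
Qed.

Variable t : 'S_n.
Hypothesis U : forall z : Mpow n M, F z -> unique_roots z t.

(** [G] is a braid over [t] and [u |-> G (2 * u)] is its square. If that is trivial, [G] and the
    constant braid are square roots of the same element, hence equal, and their ends give [t = 1].
    The factors [eps] allow pairs to turn in opposite directions. *)
Lemma half_twist_root z (c : 'I_n -> R2) (eps : 'I_n -> R)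
    (G := fun u : R => (fun i => spin (c i) (eps i * pi * u) (z i)) : Mpow n R2) :
  (forall u, F2 (G u)) -> (forall i, c (t i) = c i) -> (forall i, eps (t i) = eps i) ->
  (forall i, spin (c i) (eps i * pi) (z i) = z (t i)) ->
  P (fun u => G (2 * u)) = C1 z -> t = 1%g.
Proof.
move=> FG ct et G1 full.
have G0 : G 0 = z by apply/funext => i; rewrite /G mulr0 spin0.
have Fz : F2 z by rewrite -G0.
have cG : continuous G by apply: cont_spins => i; exact: cont_mull.
have pG : pth F2 z (act t z) G.
  by split=> //; apply/funext => i; rewrite /G mulr1 G1.
have aG := pcls_arr ce ei pG.
have a1 : arr F (push e z) (push e z) (C1 z) by apply: arr1; exact: push_F.
have step : cmul F (P G) (cact t (P G)) = C1 z.
  rewrite -full (pcls_segments ce ei 1 2 cG FG); congr cmul.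
    by congr pcls; apply/funext => u; rewrite mul1r.
  rewrite pcls_act; congr pcls; apply/funext => u; apply/funext => i.
  rewrite /= /act /G ct et -G1 spinD; congr spin; ring.
have := U (push_F ei Fz) (k := 2) (i := 1) (j := 0) (p := P G) (q := C1 z) isT.
rewrite expg1 expg0 act1 => /(_ aG a1).
have actc : cact 1%g (C1 z) = C1 z by rewrite cact_cls; congr cls; apply/funext => u; exact: act1.
have actt : cact t (C1 z) = cls F (Cconst (act t (push e z))) by rewrite cact_cls.
rewrite /= actc actt (cmulr1 aG) step !(cmul1r a1) actc (cmul1r a1) => /(_ erefl) ePG.
move: aG; rewrite ePG => /(arr_inj a1) [_ et'].
by apply: (act_inj (push_F ei Fz)); rewrite act1; exact: esym et'.
Qed.

End Involution.

(** * Involutions *)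

Section Twists.
Context {n : nat} {M : topologicalType} (e : R2 -> M).
Hypotheses (ce : continuous e) (ei : injective e).
Local Notation F := (Fconf n M).
Local Notation F2 := (Fconf n R2).
Local Notation P := (pcls e).
Local Notation C1 := (fun x => cls F (Cconst (push e x))).
Implicit Types (z : Mpow n R2) (i j k l a : 'I_n).

Lemma tight1 z k a : F2 z -> isolated z k a -> tight (pred1 k) (fun=> a) z.
Proof.
move=> Fz [ka iso]; split=> /=.
- by move=> i j _ _ /Fz.
- by move=> l /eqP -> /Fz h; rewrite h eqxx in ka.
- by move=> l l' /eqP -> l'k l'a; exact: iso.
- by move=> l l' /eqP -> /eqP ->; rewrite eqxx.
Qed.

Definition rightwards z k a := exists2 r : R, 0 < r & z k = move (z a) (1, 0) r.

(** After relabelling, both configurations have the satellite to the right of its anchor. Their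
    offsets are not opposite, so [tight_connected] joins them and the trivial twist is carried
    along. *)
Lemma trivial_tw_everywhere z k a z' k' a' :
  F2 z -> isolated z k a -> rightwards z k a ->
  F2 z' -> isolated z' k' a' -> rightwards z' k' a' ->
  trivial_tw e z k a -> trivial_tw e z' k' a'.
Proof.
move=> Fz iz [r r0 er] Fz' iz' [r' r0' er'] tr.
have ka : k != a by case: iz.
have ka' : k' != a' by case: iz'.
have [||//|s [sk sa]] := @perm_extend _ [:: k'; a'] [:: k; a].
- by rewrite /= inE ka'.
- by rewrite /= inE ka.
have {}tr : trivial_tw e (act s z) k' a' by apply: trivial_tw_act; rewrite sk sa.
have Fs : F2 (act s z) by exact: Fconf_act.
have is' : isolated (act s z) k' a' by apply: act_isolated; rewrite sk sa.
have [||||c [cc tc c0 c1]] := @tight_connected n (pred1 k') (fun=> a') (act s z) z'.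
- by move=> l _ /=; rewrite eq_sym.
- exact: tight1.
- exact: tight1.
- move=> l u /eqP -> /andP[u0 u1]; rewrite /act sk sa er er' /lerp /move /= => -[h _].
  have : (1 - u) * r + u * r' = 0 by rewrite -[RHS]h; ring.
  nra.
apply: (trivial_tw_carry ce ei (c := c) _ tr); split=> // u; split.
  exact: tight_F (tc u).
by apply: (tight_isolated _ _ (tc u)) => //=; rewrite eq_sym.
Qed.

Variable t : 'S_n.
Hypothesis U : forall z : Mpow n M, F z -> unique_roots z t.
Hypothesis tt : (t * t)%g = 1%g.

Lemma involution_cancel i : t (t i) = i.
Proof. by rewrite -permM tt perm1. Qed.

(** A pair exchanged by [t] is indexed by its smaller label, and [x] is the side of a label: -1 for
    the smaller one, 1 for the larger one, 0 for a fixed label. *)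
Let m i := minn i (t i).
Let x i : R := if t i == i then 0 else if (i < t i)%N then -1 else 1.

Lemma pair_index_t i : m (t i) = m i.
Proof. by rewrite /m involution_cancel minnC. Qed.

Lemma pair_side_t i : x (t i) = - x i.
Proof.
rewrite /x involution_cancel [t i == i]eq_sym.
case: (eqVneq i (t i)) => [h|h]; first by rewrite oppr0.
by case: ltngtP => //; [rewrite opprK | move/ord_inj => h'; rewrite h' eqxx in h].
Qed.

Lemma pair_index_inj i j : m i = m j -> i = j \/ i = t j.
Proof.
rewrite /m; case: leqP => h1; case: leqP => h2 /ord_inj h.
- by left.
- by right.
- by right; rewrite -h involution_cancel.
- by left; apply: (@perm_inj _ t).
Qed.

Lemma pair_side_inj i j : m i = m j -> x i = x j -> i = j.
Proof.
move=> mij xij; have [//|ij] := pair_index_inj mij.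
have x0 : x j = 0 by move: xij; rewrite ij pair_side_t => /eqP; rewrite eq_sym -addr_eq0 -mulr2n mulrn_eq0 => /eqP.
move: x0; rewrite /x; case: eqP => [h _|_]; first by rewrite ij h.
by case: ifP => _ /eqP; rewrite ?oppr_eq0 oner_eq0.
Qed.

Lemma pair_side_le i : `|x i| <= 1.
Proof. by rewrite /x; do 2?case: ifP => _; rewrite ?normr0 ?normrN ?normr1. Qed.

Lemma index_apart (p q : nat) : p <> q -> 10 <= `|10 * p%:R - 10 * q%:R| :> R.
Proof.
move=> pq; rewrite -mulrBr normrM ger0_norm // ler_pMr //.
have [h|h|//] := ltngtP p q.
- rewrite distrC ger0_norm ?subr_ge0 ?ler_nat ?(ltnW h) // -natrB ?(ltnW h) //.
  by rewrite (ler_nat R 1) subn_gt0.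
- rewrite ger0_norm ?subr_ge0 ?ler_nat ?(ltnW h) // -natrB ?(ltnW h) //.
  by rewrite (ler_nat R 1) subn_gt0.
Qed.

(** The pairs sit at distance 1 on either side of centres spaced by 10, fixed labels at the centres
    themselves. The square of the simultaneous half turn is the simultaneous full turn, and each
    full turn of a pair is a twist by [pair_rotation]. *)
Lemma trivial_twists_root :
  (forall z k a, F2 z -> isolated z k a -> rightwards z k a -> trivial_tw e z k a) ->
  t = 1%g.
Proof.
move=> triv.
pose c i : R2 := (10 * (m i)%:R, 0).
pose z : Mpow n R2 := fun i => (10 * (m i)%:R + x i, 0).
have dcz i : dist (c i) (z i) <= 1.
  rewrite dist_hor (_ : _ - _ = - x i); last by ring.
  by rewrite normrN pair_side_le.
have dcc i j : m i <> m j -> 10 <= dist (c i) (c j).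
  by move=> h; rewrite dist_hor; exact: index_apart.
have Fz : F2 z.
  move=> i j [] h; have mm : m i = m j.
    apply: contrapT => /index_apart.
    rewrite (_ : _ - _ = x j - x i); last by lra.
    have := ler_normB (x j) (x i); have := pair_side_le i; have := pair_side_le j; lra.
  by apply: (pair_side_inj mm); move: h; rewrite mm => /addrI.
have Fspin (th : nat -> R) : F2 (fun i => spin (c i) (th (m i)) (z i)).
  apply: spins_F => // i j; have [h|h] := eqVneq (m i) (m j).
    by left; rewrite /c h.
  by right; have := dcc i j (elimN eqP h); have := dcz i; have := dcz j; lra.
apply: (@half_twist_root n M e ce ei t U z c (fun=> 1)) => //.
- by move=> u; exact: (Fspin (fun=> 1 * pi * u)).
- by move=> i; rewrite /c pair_index_t.
- move=> i; rewrite mul1r spin_pi /c /z pair_index_t pair_side_t /=.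
  by congr pair; ring.
pose S (k : nat) (u : R) : Mpow n R2 :=
  fun i => spin (c i) (2 * pi * (if (m i < k)%N then u else 0)) (z i).
suff main (k : nat) : P (S k) = C1 z.
  rewrite -[RHS](main n); congr pcls; apply/funext => u; apply/funext => i.
  rewrite /S ifT; last by rewrite /m gtn_min ltn_ord.
  by congr spin; ring.
elim: k => [|k IH].
  rewrite /pcls; congr cls; apply/funext => u; rewrite /comp; congr (push e _).
  by apply/funext => i; rewrite /S ltn0 mulr0 spin0.
(* The pairs of index below [k] turn with the first parameter and the one of index [k] with the
   second, so the diagonal splits off one pair. *)
pose H (u : R2) : Mpow n R2 := fun i => spin (c i)
  (2 * pi * (if (m i < k)%N then u.1 else if m i == k then u.2 else 0)) (z i).
have cH : continuous H.
  apply: cont_spins => i; case: (_ < _)%N; first by cont.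
  by case: (_ == _); cont.
have FH u : F2 (H u).
  exact: (Fspin (fun p => 2 * pi * (if (p < k)%N then u.1 else if p == k then u.2 else 0))).
have -> : S k.+1 = fun u => H (u, u).
  by apply/funext => u; apply/funext => i; rewrite /S /H /= ltnS leq_eqVlt; case: ltngtP.
rewrite (pcls_diag ce ei cH FH).
have -> : (fun u => H (u, 0)) = S k.
  by apply/funext => u; apply/funext => i; rewrite /S /H /=; case: ltngtP.
rewrite IH; have aR : arr F (push e z) (push e z) (P (fun u => H (1, u))).
  have E0 : H (1, 0) = z.
    apply/funext => i; rewrite /H /=; case: ltngtP; rewrite ?mulr0 ?mulr1 ?spin0 ?spin_2pi //.
  have E1 : H (1, 1) = z.
    apply/funext => i; rewrite /H /=; case: ltngtP; rewrite ?mulr0 ?mulr1 ?spin0 ?spin_2pi //.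
  by rewrite -{1}E0 -E1; apply: pcls_arr => //; split=> //; cont.
rewrite (cmul1r aR).
(* If [k] is not the smaller label of an exchanged pair, any label of index [k] is fixed by [t] and
   sits at its centre, where turning does nothing. *)
have [[a ak at']|none] := pselect (exists2 a : 'I_n, nat_of_ord a = k & (a < t a)%N); last first.
  rewrite /pcls; congr cls; apply/funext => u; rewrite /comp; congr (push e _); apply/funext => i.
  rewrite /H /=; case: ltngtP => [_|_|mk]; rewrite ?mulr0 ?mulr1 ?spin0 ?spin_2pi //.
  have fx : t i = i.
    apply: contrapT => /eqP ti; apply: none; have : m i = k by [].
    rewrite /m; case: (ltngtP i (t i)) => [h hk|h hk|/ord_inj h]; last by rewrite -h eqxx in ti.
    - by exists i.
    - by exists (t i) => //; rewrite involution_cancel.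
  by rewrite (_ : z i = c i) ?spin_center // /z /x fx eqxx addr0.
have ta : t a != a by apply: contraTneq at' => ->; rewrite ltnn.
have ma : m a = k by rewrite /m; move/ltnW/minn_idPl: at' => ->.
have xa : x a = -1 by rewrite /x (negbTE ta) at'.
have xta : x (t a) = 1 by rewrite pair_side_t xa opprK.
have mta : m (t a) = k by rewrite pair_index_t.
have za : z a = (10 * k%:R - 1, 0) by rewrite /z ma xa.
have zta : z (t a) = (10 * k%:R + 1, 0) by rewrite /z mta xta.
have cE : lerp 2^-1 (z a) (z (t a)) = (10 * k%:R, 0).
  by rewrite za zta /lerp /=; congr pair; field.
have d2 : dist (z a) (z (t a)) = 2 by rewrite za zta dist_hor ler0_norm; lra.
have in_pair i : (m i == k) = (i == t a) || (i == a).
  apply/eqP/orP => [h|[] /eqP -> //]; have [||] := @pair_index_inj i a; rewrite ?ma //.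
    by move=> ->; right.
  by move=> ->; left.
have away l : l != t a -> l != a -> 8 < dist (10 * k%:R, 0) (z l).
  move=> l1 l2; have mk : k <> m l.
    by move=> h; have := in_pair l; rewrite -h eqxx (negbTE l1) (negbTE l2).
  have := dist_tri (z l) (10 * k%:R, 0) (c l); have := dcz l.
  rewrite [dist (z l) _]distC; have := index_apart mk; rewrite -(dist_hor _ _ 0) /c; lra.
transitivity (P (tw z (t a) a)); last first.
  apply: triv => //.
    split=> // l l1 l2; rewrite d2; have := away l l1 l2.
    have := dist_tri (z a) (10 * k%:R, 0) (z l).
    rewrite (_ : dist (10 * k%:R, 0) (z a) = 1); first by lra.
    by rewrite za dist_hor ger0_norm; lra.
  exists 2 => //; rewrite zta za /move /=; congr pair; ring.
rewrite -(pair_rotation ce ei Fz ta); last first.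
  by move=> l l1 l2; rewrite cE d2; have := away l l1 l2; lra.
congr pcls; apply/funext => u; apply/funext => i; rewrite cE /H /= -in_pair.
case: ltngtP => [h|h|h].
- by rewrite mulr1 mulr0 spin_2pi spin0.
- by rewrite mulr0 !spin0.
- by rewrite /c h.
Qed.

(** The labels in [S] are placed as prescribed, within 50 of the origin. The other exchanged pairs
    stand at opposite points, at distances from 100 up to [100 * n], and the remaining fixed labels
    beyond [100 * (n + 2)]; the radius [100 * (n + 1)] lies between. *)
Lemma symmetric_position (S : pred 'I_n) (v : 'I_n -> R) :
  (forall i, S (t i) = S i) -> (forall i, S i -> v (t i) = - v i) ->
  (forall i, S i -> `|v i| <= 50) -> (forall i j, S i -> S j -> v i = v j -> i = j) ->
  exists z I r, [/\ rotational I r 2 t z, forall i, S i -> I i /\ z i = (v i, 0),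
    forall i, ~~ S i -> 100 <= dist (0, 0) (z i) & 100 <= r].
Proof.
move=> St vt v50 vinj.
pose r : R := 100 * (n%:R + 1).
pose X i : R := if S i then v i else if t i == i then 100 * (n%:R + 2 + i%:R)
  else x i * (100 * (1 + (m i)%:R)).
pose z : Mpow n R2 := fun i => (X i, 0).
have dz i : dist (0, 0) (z i) = `|X i| by rewrite dist_hor sub0r normrN.
have x1 i : t i != i -> `|x i| = 1.
  by move=> h; rewrite /x (negbTE h); case: ifP; rewrite ?normrN normr1.
have n0 : (0 : R) <= n%:R by exact: ler0n.
have mR i : (0 : R) <= (m i)%:R /\ (m i)%:R + 1 <= n%:R :> R.
  by split; [exact: ler0n | rewrite natr1 ler_nat /m gtn_min ltn_ord].
have Xm i : ~~ S i -> t i != i -> `|X i| = 100 * (1 + (m i)%:R).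
  move=> nS ti; have [? ?] := mR i.
  by rewrite /X (negbTE nS) (negbTE ti) normrM x1 // mul1r ger0_norm //; lra.
have Xf i : ~~ S i -> t i == i -> X i = 100 * (n%:R + 2 + i%:R).
  by move=> nS ti; rewrite /X (negbTE nS) ti.
have Xf' i : ~~ S i -> t i == i -> 100 * (n%:R + 2) <= `|X i|.
  move=> nS ti; rewrite Xf // ger0_norm; have := ler0n R i; lra.
have XS i : S i -> X i = v i by rewrite /X => ->.
have XS' i : S i -> `|X i| <= 50 by move=> Si; rewrite XS // v50.
have Xinj i j : X i = X j -> i = j.
  move=> h; have hn : `|X i| = `|X j| by rewrite h.
  case Si : (S i); case Sj : (S j).
  - by apply: vinj; rewrite // -!XS.
  - exfalso; have := XS' i Si; rewrite hn; have [tj|tj] := boolP (t j == j).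
      by have := Xf' j (negbT Sj) tj; lra.
    by rewrite Xm ?Sj //; have [? ?] := mR j; lra.
  - exfalso; have := XS' j Sj; rewrite -hn; have [ti|ti] := boolP (t i == i).
      by have := Xf' i (negbT Si) ti; lra.
    by rewrite Xm ?Si //; have [? ?] := mR i; lra.
  have [ti|ti] := boolP (t i == i); have [tj|tj] := boolP (t j == j).
  - move: h; rewrite !Xf ?Si ?Sj // => h.
    have /eqP : i%:R = j%:R :> R by lra.
    by rewrite eqr_nat => /eqP /ord_inj.
  - exfalso; have := Xf' i (negbT Si) ti; rewrite hn Xm ?Sj //; have [? ?] := mR j; lra.
  - exfalso; have := Xf' j (negbT Sj) tj; rewrite -hn Xm ?Si //; have [? ?] := mR i; lra.
  have mm : m i = m j.
    move: hn; rewrite !Xm ?Si ?Sj // => hh.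
    have /eqP : (m i)%:R = (m j)%:R :> R by lra.
    by rewrite eqr_nat => /eqP.
  apply: (pair_side_inj mm); move: h; rewrite /X Si Sj (negbTE ti) (negbTE tj) mm.
  by apply: mulIf; have [? ?] := mR j; apply/eqP; lra.
exists z, (fun i => S i || (t i != i)), r; split=> [|i Si|i nS|]; last 1 first.
- by rewrite /r; lra.
- split=> [|i|i|].
  + by move=> i j [] /Xinj.
  + rewrite dz; case Si : (S i) => /=; first by have := XS' i Si; rewrite /r; lra.
    have [ti|ti] := boolP (t i == i) => /=.
      by have := Xf' i (negbT Si) ti; rewrite /r; lra.
    by rewrite Xm ?Si //; have [? ?] := mR i; rewrite /r; lra.
  + by rewrite St (inj_eq perm_inj).
  + have -> : 2 * pi / 2%:R = pi :> R by rewrite mulrAC divff ?mul1r // pnatr_eq0.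
    apply/funext => i; rewrite /act /disc_spin /z /X St involution_cancel.
    rewrite [i == t i]eq_sym; case Si : (S i) => /=.
      by rewrite spin_pi /= vt //; congr pair; ring.
    case: (eqVneq (t i) i) => [-> //|ti] /=.
    by rewrite spin_pi /= pair_side_t pair_index_t; congr pair; ring.
- by rewrite Si /z XS.
- rewrite dz; have [ti|ti] := boolP (t i == i); first by have := Xf' i nS ti; lra.
  by rewrite Xm //; have [? ?] := mR i; lra.
Qed.

End Twists.

(** Checks of the direction condition of [tight_connected]: here a horizontal offset is turned into
    a vertical one, in the next two lemmas the offset is unchanged. *)
Lemma lerp_turn (s u : R) : s != 0 -> 0 <= u <= 1 ->
  lerp u (s, 0) (move (0, 11) (0, 10) (-1)) <> (0, 0).
Proof.
move=> s0 /andP[u0 u1]; rewrite /lerp /move /= => -[h1 h2].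
have u00 : u = 0 by lra.
by move: h1; rewrite u00 subr0 mul1r mul0r addr0; exact/eqP.
Qed.

Lemma lerp_left (u : R) : 0 <= u <= 1 -> lerp u (-1, 0) (move (0, 0) (1, 0) (-1)) <> (0, 0).
Proof. by move=> /andP[u0 u1]; rewrite /lerp /move /= => -[h1 _]; lra. Qed.

Lemma lerp_right (u : R) : 0 <= u <= 1 -> lerp u (1, 0) (move (0, 0) (-1, 0) (-1)) <> (0, 0).
Proof. by move=> /andP[u0 u1]; rewrite /lerp /move /= => -[h1 _]; lra. Qed.

Section Involutions.
Context {n : nat} {M : topologicalType} (e : R2 -> M).
Hypotheses (ce : continuous e) (ei : injective e).
Hypotheses (sM : surface_with_boundary M) (cM : compact [set: M]).
Local Notation F := (Fconf n M).
Local Notation F2 := (Fconf n R2).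
Local Notation P := (pcls e).
Local Notation C1 := (fun x => cls F (Cconst (push e x))).
Variable t : 'S_n.
Hypothesis U : forall z : Mpow n M, F z -> unique_roots z t.
Hypothesis tt : (t * t)%g = 1%g.
Implicit Types (z : Mpow n R2) (i j k l a : 'I_n).

Let tK i : t (t i) = i. Proof. exact: involution_cancel. Qed.

(** The square of the common twist is trivial by [triple_trivial]. A twist and the constant braid
    both lie over [t ^+ 0], so unique roots apply and the twist is trivial; then so is every
    rightward twist. *)
Lemma sharing_root i1 i2 i3 z : i1 != i2 -> i1 != i3 -> i2 != i3 -> F2 z ->
  z i1 = (-1, 0) -> z i2 = (1, 0) -> z i3 = (0, 0) ->
  (forall l, l != i1 -> l != i2 -> l != i3 -> 5 <= dist (0, 0) (z l)) ->
  P (tw z i3 i1) = P (tw z i3 i2) -> t = 1%g.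
Proof.
move=> i12 i13 i23 Fz z1 z2 z3 far share.
have iso : isolated z i3 i1 := iso31 i13 z1 z2 z3 far.
have := triple_trivial ce ei sM cM i12 i13 i23 Fz z1 z2 z3 far share.
rewrite -share => sq.
have Fp := push_F ei Fz.
have aw := tw_arr ce ei Fz iso.
have a1 : arr F (push e z) (push e z) (C1 z) by exact: arr1.
have triv : trivial_tw e z i3 i1.
  apply: (U Fp (k := 2) (i := 0) (j := 0)) => //; rewrite ?expg0 ?act1 //.
  have c1 p : arr F (push e z) (push e z) p -> cact 1%g p = p.
    by move=> [b _ ->]; rewrite cact_cls; congr cls; apply/funext => u; exact: act1.
  by rewrite /= !(c1 _ a1) (cmulr1 aw) !(c1 _ aw) sq (cmulr1 a1) (c1 _ a1) (cmulr1 a1).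
have rt : rightwards z i3 i1.
  by exists 1 => //; rewrite z1 z3 /move /=; congr pair; ring.
apply: (trivial_twists_root ce ei U tt) => z' k a Fz' iz' rz'.
exact: (trivial_tw_everywhere ce ei Fz iso rt Fz' iz' rz' triv).
Qed.

Lemma tight2 z k a k' a' : F2 z -> isolated z k a -> isolated z k' a' -> k != k' ->
  dist (z a) (z k) + dist (z a') (z k') < dist (z a) (z a') ->
  tight (pred2 k k') (fun l => if l == k then a else a') z.
Proof.
move=> Fz [ka iso] [ka' iso'] kk ap.
have k'k : (k' == k) = false by rewrite eq_sym (negbTE kk).
split=> /=.
- by move=> i j _ _ /Fz.
- move=> l /orP[] /eqP ->; rewrite ?eqxx ?k'k => /Fz h.
    by rewrite h eqxx in ka.
  by rewrite h eqxx in ka'.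
- move=> l l' /orP[] /eqP ->; rewrite ?eqxx ?k'k negb_or => /andP[l1 l2] l3.
    exact: iso.
  exact: iso'.
- move=> l l' /orP[] /eqP -> /orP[] /eqP ->; rewrite ?eqxx ?k'k //.
  by rewrite [X in X < _]addrC [X in _ < X]distC.
Qed.

(** [a] and [b] stand one unit apart and their images under [t] at the opposite points, so the half
    rotation exchanges the two twists; the distance from the origin keeps the two circles apart. *)
Lemma base_twists a b : a != t a -> b != t b -> b != a -> b != t a ->
  exists z, [/\ F2 z, [/\ z a = (-11, 0), z b = (-10, 0), z (t a) = (11, 0) &
      z (t b) = (10, 0)], isolated z a b, isolated z (t a) (t b) &
    P (tw z a b) = P (tw z (t a) (t b))].
Proof.
move=> at' bt ba bta.
have tba : t b != a by apply: contra bta => /eqP <-; rewrite tK.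
have tbta : t b != t a by rewrite (inj_eq perm_inj).
pose S : pred 'I_n := fun i => i \in [:: a; t a; b; t b].
pose v i : R := if i == a then -11 else if i == t a then 11 else if i == b then -10 else 10.
have va : v a = -11 by rewrite /v eqxx.
have vta : v (t a) = 11 by rewrite /v eq_sym (negbTE at') eqxx.
have vb : v b = -10 by rewrite /v (negbTE ba) (negbTE bta) eqxx.
have vtb : v (t b) = 10 by rewrite /v (negbTE tba) (negbTE tbta) eq_sym (negbTE bt).
have Sa : S a by rewrite /S !inE eqxx.
have Sta : S (t a) by rewrite /S !inE eqxx orbT.
have Sb : S b by rewrite /S !inE eqxx !orbT.
have Stb : S (t b) by rewrite /S !inE eqxx !orbT.
have [||||z [I [r [rz Sz far r100]]]] := @symmetric_position n t tt S v.
- have St i : S i -> S (t i) by rewrite {1}/S !inE => /or4P[] /eqP ->; rewrite ?tK.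
  by move=> i; apply/idP/idP => /St; rewrite ?tK.
- by move=> i; rewrite /S !inE => /or4P[] /eqP ->; rewrite ?tK ?va ?vta ?vb ?vtb ?opprK.
- move=> i; rewrite /S !inE => /or4P[] /eqP ->; rewrite ?va ?vta ?vb ?vtb ?normrN ger0_norm; lra.
- move=> i j; rewrite /S !inE => /or4P[] /eqP -> /or4P[] /eqP ->;
    rewrite ?va ?vta ?vb ?vtb // => h; exfalso; lra.
have [Fz _ _ _] := rz.
have [Ia za] := Sz a Sa; have [Ita zta] := Sz _ Sta.
have [Ib zb] := Sz b Sb; have [Itb ztb] := Sz _ Stb.
rewrite va in za; rewrite vta in zta; rewrite vb in zb; rewrite vtb in ztb.
have others l : l != a -> l != t a -> l != b -> l != t b -> 100 <= dist (0, 0) (z l).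
  by move=> h1 h2 h3 h4; apply: far; rewrite /S !inE !negb_or h1 h2 h3 h4.
have iso : isolated z a b.
  split; first by rewrite eq_sym.
  move=> l la lb; rewrite za zb dist_hor ger0_norm; last by lra.
  have [->|l1] := eqVneq l (t a); first by rewrite zta dist_hor ler0_norm; lra.
  have [->|l2] := eqVneq l (t b); first by rewrite ztb dist_hor ler0_norm; lra.
  have := others l la l1 lb l2; have := dist_tri (-10, 0) (0, 0) (z l).
  by rewrite [dist (0, 0) (-10, 0)]dist_hor ger0_norm; lra.
have iso' : isolated z (t a) (t b).
  split; first by rewrite eq_sym.
  move=> l la lb; rewrite zta ztb dist_hor ler0_norm; last by lra.
  have [->|l1] := eqVneq l a; first by rewrite za dist_hor ger0_norm; lra.
  have [->|l2] := eqVneq l b; first by rewrite zb dist_hor ger0_norm; lra.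
  have := others l l1 la l2 lb; have := dist_tri (10, 0) (0, 0) (z l).
  by rewrite [dist (0, 0) (10, 0)]dist_hor ler0_norm; lra.
exists z; split=> //.
apply: (tw_symmetric ce ei (U (push_F ei Fz)) tt rz Ia Ib iso).
by rewrite za zb !dist_hor !ger0_norm; lra.
Qed.

(** A relabelled copy of the relation of [base_twists], carried along configurations with two
    satellites. The last two hypotheses compare with the offsets [(-1, 0)] and [(1, 0)] of the
    satellites in the base position. *)
Lemma disjoint_twists a0 b0 k a k' a' z : a0 != t a0 -> b0 != t b0 -> b0 != a0 -> b0 != t a0 ->
  uniq [:: k; a; k'; a'] -> F2 z -> isolated z k a -> isolated z k' a' ->
  dist (z a) (z k) + dist (z a') (z k') < dist (z a) (z a') ->
  (forall u : R, 0 <= u <= 1 -> lerp u (-1, 0) (move (z k) (z a) (-1)) <> (0, 0)) ->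
  (forall u : R, 0 <= u <= 1 -> lerp u (1, 0) (move (z k') (z a') (-1)) <> (0, 0)) ->
  P (tw z k a) = P (tw z k' a').
Proof.
move=> at' bt ba bta un Fz iz iz' ap nz nz'.
have [y [Fy [ya yb yta ytb] iy iy' rel]] := base_twists at' bt ba bta.
have un0 : uniq [:: a0; b0; t a0; t b0].
  rewrite /= !inE !negb_or ![a0 == _]eq_sym ba [t a0 == a0]eq_sym at' bta bt.
  rewrite (inj_eq perm_inj) [a0 == b0]eq_sym ba !andbT /=.
  by apply: contra bta => /eqP <-; rewrite tK.
have [//|s [sk sa sk' sa']] := perm_extend un un0.
have kk : k != k' by move: un; rewrite /= !inE !negb_or => /andP[/and3P[]].
have Fs : F2 (act s y) by exact: Fconf_act.
have is1 : isolated (act s y) k a by apply: act_isolated; rewrite sk sa.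
have is2 : isolated (act s y) k' a' by apply: act_isolated; rewrite sk' sa'.
have rel' : P (tw (act s y) k a) = P (tw (act s y) k' a').
  by apply: tw_eq_act; rewrite sk sa sk' sa'.
have ts : tight (pred2 k k') (fun l => if l == k then a else a') (act s y).
  apply: tight2 => //; rewrite /act sk sa sk' sa' ya yb yta ytb !dist_hor.
  by rewrite ger0_norm ?[`|10 - 11|]ler0_norm ?ler0_norm; lra.
have tz := tight2 Fz iz iz' kk ap.
have k'k : (k' == k) = false by rewrite eq_sym (negbTE kk).
have sat l : pred2 k k' l -> ~~ pred2 k k' (if l == k then a else a').
  move=> /= /orP[] /eqP ->; rewrite ?eqxx ?k'k /=; move: un; rewrite /= !inE !negb_or;
    move=> /and4P[/and3P[h1 h2 h3] /andP[h4 h5] h6 _]; rewrite ![_ == k]eq_sym ?h1 ?h2 ?h3 //=.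
  by rewrite eq_sym.
have [|c [cc tc c0 c1]] := tight_connected sat ts tz.
  move=> l u /= /orP[] /eqP -> u01; rewrite ?eqxx ?k'k /act.
  - rewrite sk sa ya yb (_ : move (-11, 0) (-10, 0) (-1) = (-1, 0)); first exact: nz.
    by rewrite /move /=; congr pair; ring.
  - rewrite sk' sa' yta ytb (_ : move (11, 0) (10, 0) (-1) = (1, 0)); first exact: nz'.
    by rewrite /move /=; congr pair; ring.
apply: (tw_eq_carry ce ei (c := c) _ rel'); split=> // u.
have tu := tc u; split; first exact: tight_F tu.
- have := @tight_isolated n (pred2 k k') (fun l => if l == k then a else a') (c u) k.
  by rewrite /= eqxx /=; apply=> //; have := sat k; rewrite /= eqxx => /(_ isT).
- have := @tight_isolated n (pred2 k k') (fun l => if l == k then a else a') (c u) k'.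
  by rewrite /= eqxx k'k /=; apply=> //; have := sat k'; rewrite /= k'k eqxx => /(_ isT).
Qed.

(** With [i] at the origin, halfway between [a] and [t a], the symmetry turns the twist of [i]
    around [a] directly into that of [i] around [t a]. *)
Lemma fixed_point_root a i : a != t a -> t i = i -> t = 1%g.
Proof.
move=> at' ti.
have ai : a != i by apply: contraNneq at' => ->; rewrite ti.
have tai : t a != i by rewrite -ti (inj_eq perm_inj).
pose S : pred 'I_n := fun j => j \in [:: a; t a; i].
pose v j : R := if j == a then -1 else if j == t a then 1 else 0.
have va : v a = -1 by rewrite /v eqxx.
have vta : v (t a) = 1 by rewrite /v eq_sym (negbTE at') eqxx.
have vi : v i = 0 by rewrite /v ![i == _]eq_sym (negbTE ai) (negbTE tai).
have [||||z [I [r [rz Sz far r100]]]] := @symmetric_position n t tt S v.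
- have St j : S j -> S (t j).
    by rewrite /S !inE => /or3P[] /eqP ->; rewrite ?tK ?ti ?eqxx ?orbT.
  by move=> j; apply/idP/idP => /St; rewrite ?tK.
- by move=> j; rewrite /S !inE => /or3P[] /eqP ->; rewrite ?tK ?ti ?va ?vta ?vi ?opprK ?oppr0.
- by move=> j; rewrite /S !inE => /or3P[] /eqP ->; rewrite ?va ?vta ?vi ?normrN ?normr0 ?normr1; lra.
- move=> j l; rewrite /S !inE => /or3P[] /eqP -> /or3P[] /eqP ->;
    rewrite ?va ?vta ?vi // => h; exfalso; clear ti; lra.
have [Fz _ _ _] := rz.
have [Ia za] : I a /\ z a = (v a, 0) by apply: Sz; rewrite /S !inE eqxx.
have [Ita zta] : I (t a) /\ z (t a) = (v (t a), 0) by apply: Sz; rewrite /S !inE eqxx orbT.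
have [Ii zi] : I i /\ z i = (v i, 0) by apply: Sz; rewrite /S !inE eqxx !orbT.
rewrite va in za; rewrite vta in zta; rewrite vi in zi.
have others l : l != a -> l != t a -> l != i -> 5 <= dist (0, 0) (z l).
  move=> h1 h2 h3; have := far l; rewrite /S !inE !negb_or h1 h2 h3 => /(_ isT); lra.
apply: (sharing_root at' ai tai Fz za zta zi others).
rewrite -{2}ti; apply: (tw_symmetric ce ei (U (push_F ei Fz)) tt rz Ii Ia).
  exact: (iso31 ai za zta zi others).
by rewrite za zi !dist_hor ger0_norm ?ler0_norm; lra.
Qed.

Lemma upd_F z i x : F2 z -> (forall l, l != i -> z l <> x) -> F2 (upd z i x).
Proof.
move=> Fz h j l; rewrite /upd; case: (eqVneq j i) => [->|ji]; case: (eqVneq l i) => [->|li] //.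
- by move/esym/h; case.
- by move/h; case.
- exact: Fz.
Qed.

(** The twist of [c] around [t b] is disjoint from those of [b] around [a] and around [t a], hence
    equal to both. Its satellite stands vertically above the anchor, so the offset is opposite to
    neither horizontal base offset and either role is open to it. *)
Lemma five_labels_root a b c : a != t a -> b != t b -> c \notin [:: a; t a; b; t b] ->
  b != a -> b != t a -> t = 1%g.
Proof.
move=> at' bt cn ba bta; set d := t b in cn bt.
move: cn; rewrite !inE !negb_or => /and4P[ca cta cb cd].
have da : d != a by apply: contra bta => /eqP <-; rewrite tK.
have dta : d != t a by rewrite (inj_eq perm_inj).
pose S : pred 'I_n := fun j => j \in [:: a; t a].
pose v j : R := if j == a then -1 else 1.
have va : v a = -1 by rewrite /v eqxx.
have vta : v (t a) = 1 by rewrite /v eq_sym (negbTE at').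
have [||||y [I [r [rz Sz far r100]]]] := @symmetric_position n t tt S v.
- have St j : S j -> S (t j).
    by rewrite /S !inE => /orP[] /eqP ->; rewrite ?tK ?eqxx ?orbT.
  by move=> j; apply/idP/idP => /St; rewrite ?tK.
- by move=> j; rewrite /S !inE => /orP[] /eqP ->; rewrite ?tK ?va ?vta ?opprK.
- by move=> j; rewrite /S !inE => /orP[] /eqP ->; rewrite ?va ?vta ?normrN ?normr1; lra.
- move=> j l; rewrite /S !inE => /orP[] /eqP -> /orP[] /eqP ->;
    rewrite ?va ?vta // => h; exfalso; lra.
have [Fy _ _ _] := rz.
have ya : y a = (-1, 0) by have [|_ ->] := Sz a; rewrite ?va // /S !inE eqxx.
have yta : y (t a) = (1, 0) by have [|_ ->] := Sz (t a); rewrite ?vta // /S !inE eqxx orbT.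
have yo l : l != a -> l != t a -> 100 <= dist (0, 0) (y l).
  by move=> h1 h2; apply: far; rewrite /S !inE negb_or h1 h2.
have d00 : dist (0, 0) (0, 0) = 0 by exact: dist_refl.
have dver (p q : R) : dist (0, p) (0, q) = `|p - q|.
  by rewrite /dist /= subrr expr0n add0r sqrtr_sqr.
have d10 : dist (0, 0) (0, 10) = 10 by rewrite dver ler0_norm; lra.
have d11 : dist (0, 0) (0, 11) = 11 by rewrite dver ler0_norm; lra.
have off (w : R2) l : w.1 = 0 -> dist (0, 0) w < 100 -> l != b -> y l <> w.
  move=> w1 dw _; have [->|la] := eqVneq l a.
    by rewrite ya => h; move: w1; rewrite -h /= => /eqP; rewrite oppr_eq0 oner_eq0.
  have [->|lta] := eqVneq l (t a).
    by rewrite yta => h; move: w1; rewrite -h /= => /eqP; rewrite oner_eq0.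
  by move=> h; have := yo l la lta; rewrite h; lra.
pose z1 := upd y b (0, 0); pose z2 := upd z1 d (0, 10); pose z := upd z2 c (0, 11).
have F1 : F2 z1 by apply: upd_F => // l lb; apply: off; rewrite //= d00; lra.
have nv (p q : R) : p <> q -> (0, p) <> (0, q) :> R2 by move=> pq [].
have F2' : F2 z2.
  apply: upd_F => // l ld; rewrite /z1 /upd; case: eqP => [_|/eqP lb].
    by apply: nv => /eqP; rewrite eq_sym pnatr_eq0.
  by apply: off; rewrite //= d10; lra.
have Fz : F2 z.
  apply: upd_F => // l lc; rewrite /z2 /z1 /upd; case: eqP => [_|_].
    by apply: nv => /eqP; rewrite (eqr_nat R 10 11).
  case: eqP => [_|/eqP lb].
    by apply: nv => /eqP; rewrite eq_sym pnatr_eq0.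
  by apply: off; rewrite //= d11; lra.
have za : z a = (-1, 0).
  by rewrite /z /z2 /z1 /upd ![a == _]eq_sym (negbTE ca) (negbTE da) (negbTE ba).
have zta : z (t a) = (1, 0).
  by rewrite /z /z2 /z1 /upd ![t a == _]eq_sym (negbTE cta) (negbTE dta) (negbTE bta).
have zb : z b = (0, 0).
  by rewrite /z /z2 /z1 /upd [b == c]eq_sym (negbTE cb) (negbTE bt) eqxx.
have zd : z d = (0, 10) by rewrite /z /z2 /upd [d == c]eq_sym (negbTE cd) eqxx.
have zc : z c = (0, 11) by rewrite /z /upd eqxx.
have zo l : l != a -> l != t a -> l != b -> l != c -> l != d -> 100 <= dist (0, 0) (z l).
  move=> h1 h2 h3 h4 h5.
  by rewrite /z /z2 /z1 /upd (negbTE h3) (negbTE h4) (negbTE h5); exact: yo.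
have five l : l != a -> l != t a -> l != b -> 5 <= dist (0, 0) (z l).
  move=> h1 h2 h3; have [->|h4] := eqVneq l c; first by rewrite zc d11; lra.
  have [->|h5] := eqVneq l d; first by rewrite zd d10; lra.
  by have := zo l h1 h2 h3 h4 h5; lra.
have ab : a != b by rewrite eq_sym.
have tab : t a != b by rewrite eq_sym.
have iba := iso31 ab za zta zb five.
have ibta := iso32 tab za zta zb five.
have dcd : dist (z d) (z c) = 1 by rewrite zd zc dver ler0_norm; lra.
have cdis w : dist (0, 0) w <= 1 -> 9 <= dist (z d) w.
  by have := dist_tri w (0, 0) (z d); rewrite zd d10 [dist w _]distC; lra.
have n1 : dist (0, 0) (-1, 0) = 1 by rewrite dist_hor ger0_norm; lra.
have n2 : dist (0, 0) (1, 0) = 1 by rewrite dist_hor ler0_norm; lra.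
have icd : isolated z c d.
  split=> // l lc ld; rewrite dcd.
  have [->|h1] := eqVneq l a; first by have := cdis (z a); rewrite za n1; lra.
  have [->|h2] := eqVneq l (t a); first by have := cdis (z (t a)); rewrite zta n2; lra.
  have [->|h3] := eqVneq l b; first by have := cdis (z b); rewrite zb d00; lra.
  have := zo l h1 h2 h3 lc ld; have := dist_tri (z d) (0, 0) (z l); rewrite zd d10; lra.
have e1 : P (tw z c d) = P (tw z b a).
  apply: (disjoint_twists at' bt ba bta) => //.
  - by rewrite /= !inE !negb_or cd cb ca eq_sym bt da ba.
  - have := cdis (z a); rewrite dcd za zb n1 [dist (-1, 0) (0, 0)]distC n1; lra.
  - by move=> u u01; rewrite zc zd; apply: lerp_turn; rewrite // oppr_eq0 oner_eq0.
  - by move=> u u01; rewrite za zb; exact: lerp_right.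
have e2 : P (tw z b (t a)) = P (tw z c d).
  apply: (disjoint_twists at' bt ba bta) => //.
  - by rewrite /= !inE !negb_or bta eq_sym cb bt ![t a == _]eq_sym cta dta cd.
  - have := cdis (z (t a)); rewrite dcd zta zb n2 [dist (1, 0) (0, 0)]distC n2.
    by rewrite [dist (1, 0) (z d)]distC; lra.
  - by move=> u u01; rewrite zta zb; exact: lerp_left.
  - by move=> u u01; rewrite zc zd; apply: lerp_turn; rewrite // oner_eq0.
by apply: (sharing_root at' ab tab Fz za zta zb five); rewrite e2 e1.
Qed.

(** Exchanging the labels [b] and [t a] in the relation of [base_twists] makes the twist of [a]
    around [t a] equal to that of [b] around [t b]. One pair turns forwards and the other backwards
    by a half turn; the square of this braid over [t] is one of these twists times the inverse of
    the other. *)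
Lemma four_labels_root a b : a != t a -> b != t b -> b != a -> b != t a ->
  (forall i, i \in [:: a; t a; b; t b]) -> t = 1%g.
Proof.
move=> at' bt ba bta all4.
have tba : t b != a by apply: contra bta => /eqP <-; rewrite tK.
have tbta : t b != t a by rewrite (inj_eq perm_inj).
have [y [Fy [ya yb yta ytb] iy iy' rel]] := base_twists at' bt ba bta.
pose s := tperm b (t a); pose z := act s y.
have sa : s a = a by rewrite /s tpermD // eq_sym.
have sta : s (t a) = b by rewrite /s tpermR.
have sb : s b = t a by rewrite /s tpermL.
have stb : s (t b) = t b by rewrite /s tpermD // eq_sym.
have za : z a = (-11, 0) by rewrite /z /act sa.
have zta : z (t a) = (-10, 0) by rewrite /z /act sta.
have zb : z b = (11, 0) by rewrite /z /act sb.
have ztb : z (t b) = (10, 0) by rewrite /z /act stb.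
have Fz : F2 z by exact: Fconf_act.
have rel' : P (tw z a (t a)) = P (tw z b (t b)).
  by apply: tw_eq_act; rewrite sa sta sb stb.
pose A i := (i == a) || (i == t a).
have At i : A (t i) = A i.
  by rewrite /A (inj_eq perm_inj) -[t i == a](inj_eq (@perm_inj _ t)) tK orbC.
have Ab : A b = false by rewrite /A (negbTE ba) (negbTE bta).
have Atb : A (t b) = false by rewrite At.
have An i : A i = ~~ ((i == b) || (i == t b)).
  apply/idP/idP => [|h].
    move=> /orP[] /eqP ->; rewrite negb_or ![_ == b]eq_sym ![_ == t b]eq_sym.
      by rewrite ba tba.
    by rewrite bta tbta.
  by have := all4 i; rewrite !inE; case/or4P => // hi; rewrite /A ?hi ?orbT //;
    move: h; rewrite hi ?orbT.
pose c i : R2 := if A i then (- (21 / 2), 0) else (21 / 2, 0).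
have dc i : dist (c i) (z i) = 2^-1.
  have := all4 i; rewrite !inE => /or4P[] /eqP ->; rewrite /c ?At ?Ab /A ?eqxx /=.
  - by rewrite za dist_hor ger0_norm; lra.
  - by rewrite zta dist_hor ler0_norm; lra.
  - by rewrite zb dist_hor ler0_norm; lra.
  - by rewrite ztb dist_hor ger0_norm; lra.
have Fspin (th th' : R) : F2 (fun i => spin (c i) (if A i then th else th') (z i)).
  apply: spins_F => // i j; rewrite !dc /c; case: (A i); case: (A j); try by left.
  - by right; rewrite dist_hor ler0_norm; lra.
  - by right; rewrite dist_hor ger0_norm; lra.
have Aa : A a by rewrite /A eqxx.
have Ata : A (t a) by rewrite At.
have refl i : (2 * (c i).1 - (z i).1, 2 * (c i).2 - (z i).2) = z (t i).
  have := all4 i; rewrite !inE => /or4P[] /eqP ->; rewrite ?tK /c ?Aa ?Ata ?Ab ?Atb.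
  - by rewrite za zta /=; congr pair; field.
  - by rewrite za zta /=; congr pair; field.
  - by rewrite zb ztb /=; congr pair; field.
  - by rewrite zb ztb /=; congr pair; field.
apply: (@half_twist_root n M e ce ei t U z c (fun i => if A i then 1 else -1)).
- move=> u; have := Fspin (1 * pi * u) (-1 * pi * u).
  by congr (F2 _); apply/funext => i; case: (A i).
- by move=> i; rewrite /c At.
- by move=> i; rewrite At.
- move=> i; rewrite -refl -spin_pi; case: (A i); first by rewrite mul1r.
  by rewrite -[LHS](spin_2pi (c i)) spinD; congr spin; ring.
pose H (u : R2) : Mpow n R2 :=
  fun i => spin (c i) (if A i then 2 * pi * u.1 else 2 * pi * - u.2) (z i).
have cH : continuous H by apply: cont_spins => i; case: (A i); cont.
have FH u : F2 (H u) by exact: Fspin.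
transitivity (P (fun u => H (u, u))).
  by congr pcls; apply/funext => u; apply/funext => i; congr spin; case: (A i) => /=; ring.
rewrite (pcls_diag ce ei cH FH).
have D1 : dist (z (t a)) (z a) = 1 by rewrite za zta dist_hor ger0_norm; lra.
have D2 : dist (z (t b)) (z b) = 1 by rewrite zb ztb dist_hor ler0_norm; lra.
have c1 : lerp 2^-1 (z (t a)) (z a) = (- (21 / 2), 0).
  by rewrite za zta /lerp /=; congr pair; field.
have c2 : lerp 2^-1 (z (t b)) (z b) = (21 / 2, 0).
  by rewrite zb ztb /lerp /=; congr pair; field.
pose R2' (u : R) : Mpow n R2 := fun i =>
  spin (lerp 2^-1 (z (t b)) (z b)) (2 * pi * (if (i == b) || (i == t b) then u else 0)) (z i).
have e1 : P (fun u => H (u, 0)) = P (tw z a (t a)).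
  rewrite -(pair_rotation ce ei Fz at'); last first.
    move=> l la lta; rewrite c1 D1; have := all4 l; rewrite !inE (negbTE la) (negbTE lta) /=.
    by case/orP => /eqP ->; rewrite ?zb ?ztb dist_hor ler0_norm; lra.
  congr pcls; apply/funext => u; apply/funext => i; rewrite /H /= c1 -/(A i) /c.
  by case: (A i) => //; rewrite oppr0 mulr0 !spin0.
have e2 : P R2' = P (tw z b (t b)).
  rewrite -(pair_rotation ce ei Fz bt) //.
  move=> l lb ltb; rewrite c2 D2; have := all4 l; rewrite !inE (negbTE lb) (negbTE ltb) !orbF.
  by case/orP => /eqP ->; rewrite ?za ?zta dist_hor ger0_norm; lra.
have itb : isolated z b (t b).
  split=> // l lb ltb; rewrite D2; have := all4 l; rewrite !inE (negbTE lb) (negbTE ltb) !orbF.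
  by case/orP => /eqP ->; rewrite ztb ?za ?zta dist_hor ger0_norm; lra.
have FR u : F2 (R2' u).
  have := FH (0, - u); congr (F2 _); apply/funext => i; rewrite /H /R2' /= An c2 /c An.
  by case: (_ || _) => /=; rewrite ?opprK ?mulr0 ?spin0.
have pR : pth F2 z z R2'.
  split=> //.
  - by apply: cont_spins => i; case: (_ || _); cont; exact: cont_mull.
  - by apply/funext => i; rewrite /R2'; case: (_ || _); rewrite mulr0 spin0.
  - by apply/funext => i; rewrite /R2'; case: (_ || _); rewrite ?mulr0 ?mulr1 ?spin0 ?spin_2pi.
have e3 : P (fun u => H (1, u)) = cinv F (P R2').
  rewrite -(pcls_rev ce ei pR); congr pcls; apply/funext => u; apply/funext => i.
  rewrite /Creverse /H /R2' /= c2 /c An; case: (_ || _) => /=; last first.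
    by rewrite mulr1 mulr0 spin_2pi spin0.
  rewrite (_ : 2 * pi * (1 - u) = 2 * pi + 2 * pi * - u); last by ring.
  by rewrite -spinD spin_2pi.
by rewrite e1 e3 rel' e2 (cmulrV (tw_arr ce ei Fz itb)).
Qed.

Lemma no_involution : (3 <= n)%N -> t = 1%g.
Proof.
move=> n3; apply: contrapT => t1.
have [a at'] : exists a, a != t a.
  apply: contrapT => h; apply: t1; apply/permP => i; rewrite perm1.
  by apply: contrapT => /eqP ti; apply: h; exists i; rewrite eq_sym.
have [[i ti]|nofix] := pselect (exists i, t i = i).
  by apply: t1; exact: (fixed_point_root at' ti).
have moved i : i != t i by apply/eqP => h; apply: nofix; exists i.
(* Here at least three labels are required: some label lies outside the pair of [a], and since
   nothing is fixed it brings a second pair. *)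
have [b bn] : exists b, b \notin [:: a; t a].
  apply: contrapT => h.
  have : (size (enum 'I_n) <= size [:: a; t a])%N.
    apply: uniq_leq_size; first exact: enum_uniq.
    by move=> i _; apply: contrapT => /negP hi; apply: h; exists i.
  by rewrite size_enum_ord leqNgt n3.
move: bn; rewrite !inE negb_or => /andP[ba bta].
have [[c cn]|h] := pselect (exists c, c \notin [:: a; t a; b; t b]).
  by apply: t1; exact: (five_labels_root at' (moved b) cn ba bta).
apply: t1; apply: (four_labels_root at' (moved b) ba bta) => i.
by apply: contrapT => /negP hi; apply: h; exists i.
Qed.

End Involutions.

Theorem theorem2 (n : nat) (M : topologicalType)
  (hn : (3 <= n)%N)
  (hM : surface_with_boundary M)
  (hcompact : compact [set: M])
  (hconn : connected [set: M])
  (hS2 : ~ homeomorphic_S2 M)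
  (hRP2 : ~ homeomorphic_RP2 M)
  (z0 : Mpow n M) (hz0 : Fconf n M z0)
  (H : set (R -> set M))
  (hH : braid_subgroup n M (qconf z0) H)
  (hPH : pure_braids z0 `<=` H)
  (hPneq : exists2 g, H g & ~ pure_braids z0 g) :
  ~ biorderable_subgroup n M (qconf z0) H.
Proof.
move=> bo.
have [t t1 U0] := biorder_unique_roots hM.1 hz0 hH hPH hPneq bo.
have [e ce ei] := plane_embedding (z0 (Ordinal (leq_trans (isT : 0 < 3)%N hn))) hM.
pose p := pdiv #[t]%g.
have ot : (1 < #[t]%g)%N by rewrite order_gt1.
have pp : prime p by exact: pdiv_prime.
(* Powers of [s] are powers of [t], so unique roots pass to this element of prime order;
   connectedness of the configuration space gives them at every base point. *)
pose s := (t ^+ (#[t] %/ p))%g.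
have pd : (p %| #[t]%g)%N by exact: pdiv_dvd.
have os : #[s]%g = p.
  rewrite /s orderXdiv ?dvdn_div // -{1}(divnK pd) mulKn //.
  by rewrite divn_gt0 ?prime_gt0 // dvdn_leq // order_gt0.
have sp : (s ^+ p)%g = 1%g by rewrite -os expg_order.
have s1 : s <> 1%g by move=> h; move: pp; rewrite -os h order1.
have U (z : Mpow n M) : Fconf n M z -> unique_roots z s.
  move=> Fz.
  have [||c pc] := @configurations_connected M n predT z0 z hM hconn.
  - by move=> i j _ _ /hz0.
  - by move=> i j _ _ /Fz.
  have pc' : pth (Fconf n M) z0 z c.
    by have [? h ? ?] := pc; split=> // u i j /(h u _ _ isT isT).
  move=> k i j q q' k0; rewrite /s -!expgM.
  exact: (unique_roots_transport (arr_cls pc') U0 k0).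
have [po|pe] := boolP (odd p).
  by apply: s1; exact: (no_odd_order ce ei U pp po sp).
have p2 : p = 2 by have [//|] := even_prime pp => h; rewrite h in pe.
apply: s1; apply: (no_involution ce ei hM hcompact U) => //.
by move: sp; rewrite p2 expgS expg1.
Qed.
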